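(* Let $(M,g)$ be a time-orientable Lorentzian surface with a Spin structure, and let $\psi^+\in\Gamma(S^+)$ and $\psi^-\in\Gamma(S^-)$ be two twistor spinors without zeros. Then $(M,g)$ is conformally flat. In particular, if $M$ is compact, then $(M,g)$ is (geodesically) complete.
   Context: A Lorentzian surface $(M,g)$ is a smooth oriented $2$-manifold with a metric of signature $(1,1)$; in an orthonormal basis $(s_1,s_2)$ the vector $s_1$ is timelike ($g(s_1,s_1)=-1$) and $s_2$ is spacelike. It is time-orientable if it admits a nowhere vanishing timelike vector field. $(M,g)$ is conformally flat if there is a smooth function $\lambda>0$ on $M$ such that $\lambda g$ is flat (globally). The spinor bundle $S=Q\times_{Spin}\Delta_{1,1}$, $\Delta_{1,1}=\mathbb{C}^2$, uses the Clifford representation $e_1\mapsto\begin{pmatrix}0&i\\-i&0\end{pmatrix}$, $e_2\mapsto\begin{pmatrix}0&i\\i&0\end{pmatrix}$ (so $v\cdot v=-g(v,v)$). $S^{+}$ and $S^{-}$ are the eigenbundles of $\omega=s_1\cdot s_2$ (for an oriented orthonormal frame) for the eigenvalues $-1$ and $+1$ respectively. With $\nabla^S$ the spinor connection induced by the Levi-Civita connection, $D\varphi=-s_1\cdot\nabla^S_{s_1}\varphi+s_2\cdot\nabla^S_{s_2}\varphi$. A spinor $\varphi$ is twistor if $\nabla^S_V\varphi=-\tfrac12V\cdot D\varphi$ for all vector fields $V$. *)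

(* Defs.v *)
From HB Require Import structures.
From mathcomp Require Import all_boot all_order all_algebra.
From mathcomp Require Import all_classical all_reals all_analysis.
From mathcomp.real_closed Require Import complex.
From mathcomp Require Import ring.

Set Implicit Arguments.
Unset Strict Implicit.
Unset Printing Implicit Defensive.

Import Order.TTheory GRing.Theory Num.Theory.
Import numFieldNormedType.Exports.

Local Open Scope classical_set_scope.
Local Open Scope ring_scope.
Local Open Scope complex_scope.

(* C^k and C^oo maps on an open subset U of a (finite-dimensional) space. *)
Fixpoint Ck_on (R : realType) (V W : normedModType R) (k : nat)
    (U : set V) (f : V -> W) : Prop :=
  match k with
  | 0 => forall x, U x -> {for x, continuous f}
  | k'.+1 => (forall x, U x -> differentiable f x) /\
             (forall v : V, Ck_on k' U ('D_v f))
  end.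

Definition smooth_on (R : realType) (V W : normedModType R)
    (U : set V) (f : V -> W) : Prop := forall k, Ck_on k U f.

(* Smooth oriented surfaces, given by an oriented smooth atlas.  [coord i] is
   the chart on the open set [cdom i] and [param i] its inverse; both are
   meaningless outside of [cdom i], resp. outside of its image.  The Jacobians
   of the library act on row vectors from the right. *)
Record surface (R : realType) := Surface {
  spoint :> topologicalType ;
  chart : Type ;
  cdom : chart -> set spoint ;
  coord : chart -> spoint -> 'rV[R]_2 ;
  param : chart -> 'rV[R]_2 -> spoint ;
  surface_hausdorff : hausdorff_space spoint ;
  surface_second_countable : @second_countable spoint ;
  cdom_open : forall i, open (cdom i) ;
  cdom_cover : forall p, exists i, cdom i p ;
  cimg_open : forall i, open (coord i @` cdom i) ;
  coordK : forall i p, cdom i p -> param i (coord i p) = p ;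
  coord_continuous : forall i, {within cdom i, continuous (coord i)} ;
  param_continuous :
    forall i, {within coord i @` cdom i, continuous (param i)} ;
  transition_smooth : forall i j,
    smooth_on (coord i @` (cdom i `&` cdom j)) (coord j \o param i) ;
  transition_oriented : forall i j p, cdom i p -> cdom j p ->
    0 < \det (jacobian (coord j \o param i) (coord i p))
}.

Section Surface.
Context {R : realType} (M : surface R).
Implicit Types (i j : chart M) (p : M).

(* Change of tangent coordinates from chart i to chart j: a tangent vector at p
   with components v (a row) in chart i has components v *m tjac i j p in j. *)
Definition tjac i j p : 'M[R]_2 :=
  jacobian (coord j \o param i) (coord i p).

Definition msmooth (W : normedModType R) (U : set M) (f : M -> W) : Prop :=
  forall i, smooth_on (coord i @` (U `&` cdom i)) (f \o param i).

(* Smoothness of complex matrix-valued functions, entrywise on real and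
   imaginary parts. *)
Definition mcsmooth (m n : nat) (U : set M) (f : M -> 'M[R[i]]_(m, n)) : Prop :=
  forall k l, msmooth (W := R) U (fun p => complex.Re (f p k l)) /\
              msmooth (W := R) U (fun p => complex.Im (f p k l)).

(* Vector fields and metrics are families of components, [X i p] being the
   components at p in chart i (meaningful when p is in [cdom i]). *)
Record is_vfield (X : chart M -> M -> 'rV[R]_2) : Prop := IsVfield {
  vfield_compat : forall i j p, cdom i p -> cdom j p ->
    X j p = X i p *m tjac i j p ;
  vfield_smooth : forall i, smooth_on (coord i @` cdom i) (X i \o param i)
}.

Definition mform (A : 'M[R]_2) (v w : 'rV[R]_2) : R := (v *m A *m w^T) 0 0.

Definition eta : 'M[R]_2 := diag_mx (\row_k (if k == 0 then -1 else 1)).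

Record is_lorentzian (g : chart M -> M -> 'M[R]_2) : Prop := IsLorentzian {
  metric_compat : forall i j p, cdom i p -> cdom j p ->
    g i p = tjac i j p *m g j p *m (tjac i j p)^T ;
  metric_smooth : forall i, smooth_on (coord i @` cdom i) (g i \o param i) ;
  metric_sym : forall i p, cdom i p -> (g i p)^T = g i p ;
  (* existence of an orthonormal basis, timelike vector first *)
  metric_signature : forall i p, cdom i p ->
    exists2 F : 'M[R]_2, F \in unitmx & F *m g i p *m F^T = eta
}.

Definition time_orientable (g : chart M -> M -> 'M[R]_2) : Prop :=
  exists2 X, is_vfield X &
    forall i p, cdom i p -> X i p != 0 /\ mform (g i p) (X i p) (X i p) < 0.

(* Directional derivative along the tangent vector at p of components v in
   chart i. *)
Definition tder (W : normedModType R) i (v : 'rV[R]_2) (f : M -> W) p : W :=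
  'D_v (f \o param i) (coord i p).

Definition pder i (k : 'I_2) (f : M -> R) p : R :=
  tder i (delta_mx 0 k) f p.

(* Christoffel symbols of the Levi-Civita connection of g:
   [christoffel g i k l m] is Gamma^m_{kl} in chart i. *)
Definition christoffel (g : chart M -> M -> 'M[R]_2) i (k l m : 'I_2) p : R :=
  2^-1 * \sum_(n < 2) invmx (g i p) m n *
    (pder i k (fun q => g i q l n) p + pder i l (fun q => g i q k n) p
     - pder i n (fun q => g i q k l) p).

Definition chris_vec g i p (v w : 'rV[R]_2) : 'rV[R]_2 :=
  \row_m \sum_(k < 2) \sum_(l < 2) christoffel g i k l m p * v 0 k * w 0 l.

(* Covariant derivative at p along v of a (local) vector field Y, in the
   components of chart i. *)
Definition covder g i (v : 'rV[R]_2) (Y : M -> 'rV[R]_2) p : 'rV[R]_2 :=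
  tder i v Y p + chris_vec g i p v (Y p).

(* Component R^n_{mkl} of R(d_k, d_l) d_m. *)
Definition riemann g i (k l m n : 'I_2) p : R :=
  pder i k (christoffel g i l m n) p - pder i l (christoffel g i k m n) p
  + \sum_(a < 2) (christoffel g i k a n p * christoffel g i l m a p
                  - christoffel g i l a n p * christoffel g i k m a p).

Definition flat (g : chart M -> M -> 'M[R]_2) : Prop :=
  forall i p, cdom i p -> forall k l m n, riemann g i k l m n p = 0.

Definition conformally_flat (g : chart M -> M -> 'M[R]_2) : Prop :=
  exists lam : M -> R, [/\ msmooth setT lam, (forall p, 0 < lam p) &
    flat (fun i p => lam p *: g i p)].

Definition geodesic_on g (J : set R) (c : R -> M) : Prop :=
  [/\ open J, is_interval J, J !=set0, (forall t, J t -> {for t, continuous c})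
    & forall i t, J t -> cdom i (c t) ->
      let x := coord i \o c in
      [/\ derivable x t 1, derivable (derive1 x) t 1 &
          derive1 (derive1 x) t
            + chris_vec g i (c t) (derive1 x t) (derive1 x t) = 0]].

Definition inextendible_geodesic g (J : set R) (c : R -> M) : Prop :=
  geodesic_on g J c /\
  forall (J' : set R) (c' : R -> M), geodesic_on g J' c' -> J `<=` J' ->
    (forall t, J t -> c' t = c t) -> J' = J.

Definition geodesically_complete g : Prop :=
  forall (J : set R) (c : R -> M), inextendible_geodesic g J c -> J = setT.

End Surface.

Section Clifford.
Context {R : realType}.

Definition cl1 : 'M[R[i]]_2 :=
  \matrix_(k, l) (if k == l then 0 else if k == 0 then 'i%C else - 'i%C).
Definition cl2 : 'M[R[i]]_2 :=
  \matrix_(k, l) (if k == l then 0 else 'i%C).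

(* The Clifford representation of v = v_1 e_1 + v_2 e_2. *)
Definition cl (v : 'rV[R]_2) : 'M[R[i]]_2 :=
  (v 0 0)%:C *: cl1 + (v 0 1)%:C *: cl2.

Definition vol : 'M[R[i]]_2 := cl1 *m cl2.

Lemma cl_sqr (v : 'rV[R]_2) : cl v *m cl v = (- (mform eta v v)%:C)%:M.
Proof.
have ord1E : lift ord0 ord0 = 1 :> 'I_2 by apply/val_inj.
rewrite /mform /eta /cl /cl1 /cl2.
apply/matrixP => -[[|[|//]] ?] -[[|[|//]] ?];
  rewrite !mxE !big_ord_recl !big_ord0 !mxE /= !big_ord_recl !big_ord0 !mxE /=;
  rewrite ord1E; apply/eqP; rewrite eq_complex /=;
  apply/andP; split; apply/eqP; rewrite /=; ring.
Qed.

Lemma volE : vol = diag_mx (\row_k (if k == 0 then -1 else 1)) :> 'M[R[i]]_2.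
Proof.
apply/matrixP => -[[|[|//]] ?] -[[|[|//]] ?];
  rewrite !mxE !big_ord_recl !big_ord0 !mxE /=;
  apply/eqP; rewrite eq_complex /=;
  apply/andP; split; apply/eqP; rewrite /=; ring.
Qed.

(* Spin(1,1): the products of an even number of vectors x with g(x,x) = 1 or
   -1, seen in 'M_2(C) through the (faithful) representation [cl]. *)
Definition spin11 (h : 'M[R[i]]_2) : Prop :=
  exists s : seq 'rV[R]_2,
    [/\ ~~ odd (size s),
        all (fun x => (mform eta x x == 1) || (mform eta x x == -1)) s &
        h = \prod_(x <- s) cl x].

(* L is the image of h under the covering Spin(1,1) -> SO(1,1), as a matrix
   acting on rows: the vector v *m L is h . v . h^-1. *)
Definition spin_cover (h : 'M[R[i]]_2) (L : 'M[R]_2) : Prop :=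
  forall v : 'rV[R]_2, cl (v *m L) = h *m cl v *m invmx h.

End Clifford.

Section Spin.
Context {R : realType} (M : surface R).
Variable g : chart M -> M -> 'M[R]_2.

(* A spin structure: a principal Spin(1,1)-bundle Q over M, together with the
   equivariant map [sframe] from Q to the oriented orthonormal frames of M.
   The right action [sact q h] is relevant only for h in Spin(1,1).  The smooth
   structure of Q is given by the local sections [ssec a] (local
   trivialisations) over an open cover, with smooth transition functions.
   [sframe i q] has as rows the components of s_1 and s_2 in chart i. *)
Record spin_structure := SpinStructure {
  spin_total :> Type ;
  sproj : spin_total -> M ;
  sact : spin_total -> 'M[R[i]]_2 -> spin_total ;
  sact1 : forall q, sact q 1%:M = q ;
  sactM : forall q h h', spin11 h -> spin11 h' ->
    sact q (h *m h') = sact (sact q h) h' ;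
  sproj_act : forall q h, spin11 h -> sproj (sact q h) = sproj q ;
  sact_torsor : forall q q', sproj q = sproj q' ->
    exists! h, spin11 h /\ q' = sact q h ;
  striv : Type ;
  sdom : striv -> set M ;
  ssec : striv -> M -> spin_total ;
  sdom_open : forall a, open (sdom a) ;
  sdom_cover : forall p, exists a, sdom a p ;
  ssecK : forall a p, sdom a p -> sproj (ssec a p) = p ;
  ssec_transition : forall a b, exists2 h : M -> 'M[R[i]]_2,
    (forall p, sdom a p -> sdom b p ->
       spin11 (h p) /\ ssec b p = sact (ssec a p) (h p)) &
    mcsmooth (sdom a `&` sdom b) h ;
  sframe : chart M -> spin_total -> 'M[R]_2 ;
  sframe_compat : forall i j q, cdom i (sproj q) -> cdom j (sproj q) ->
    sframe j q = sframe i q *m tjac i j (sproj q) ;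
  sframe_orthonormal : forall i q, cdom i (sproj q) ->
    sframe i q *m g i (sproj q) *m (sframe i q)^T = eta ;
  sframe_oriented : forall i q, cdom i (sproj q) -> 0 < \det (sframe i q) ;
  sframe_equivariant : forall q h, spin11 h ->
    exists2 L : 'M[R]_2, spin_cover h L &
      forall i, cdom i (sproj q) -> sframe i (sact q h) = L *m sframe i q ;
  sframe_smooth : forall a i,
    smooth_on (coord i @` (sdom a `&` cdom i))
      ((fun p => sframe i (ssec a p)) \o param i)
}.

Variable Q : spin_structure.

(* Smooth sections of S = Q x_Spin C^2, as equivariant functions: the section
   at [sproj q] is the class [q, phi q]. *)
Record is_spinor (phi : Q -> 'cV[R[i]]_2) : Prop := IsSpinor {
  spinor_equivariant : forall q h, spin11 h ->
    phi (sact q h) = invmx h *m phi q ;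
  spinor_smooth : forall a, mcsmooth (sdom a) (phi \o @ssec Q a)
}.

Definition spinor_plus (phi : Q -> 'cV[R[i]]_2) : Prop :=
  is_spinor phi /\ forall q, vol *m phi q = - phi q.

Definition spinor_minus (phi : Q -> 'cV[R[i]]_2) : Prop :=
  is_spinor phi /\ forall q, vol *m phi q = phi q.

Definition ctder (i : chart M) (v : 'rV[R]_2) (u : M -> 'cV[R[i]]_2) (p : M) :
    'cV[R[i]]_2 :=
  \col_k (tder (W := R) i v (fun x => complex.Re (u x k 0)) p
          +i* tder (W := R) i v (fun x => complex.Im (u x k 0)) p).

Definition sec_frame (a : striv Q) (i : chart M) (k : 'I_2) (p : M) :
    'rV[R]_2 :=
  row k (sframe i (ssec a p)).

(* The spinor connection, in the trivialisation a and at p, along the vector of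
   components v in chart i.  In general the local formula is
     v(u) + 1/2 sum_(k < l) eps_k eps_l g(nabla_v s_k, s_l) e_k e_l u,
   here with the single term k = 1, l = 2 and eps_1 eps_2 = -1. *)
Definition spin_nabla (phi : Q -> 'cV[R[i]]_2) (a : striv Q) (i : chart M)
    (v : 'rV[R]_2) (p : M) : 'cV[R[i]]_2 :=
  ctder i v (phi \o @ssec Q a) p
  - (2^-1 * mform (g i p) (covder g i v (sec_frame a i 0) p)
                          (sec_frame a i 1 p))%:C
      *: (vol *m phi (ssec a p)).

Definition dirac (phi : Q -> 'cV[R[i]]_2) (a : striv Q) (i : chart M) (p : M) :
    'cV[R[i]]_2 :=
  - (cl1 *m spin_nabla phi a i (sec_frame a i 0 p) p)
  + cl2 *m spin_nabla phi a i (sec_frame a i 1 p) p.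

(* Clifford multiplication by the tangent vector of components v in chart i;
   [v *m invmx _] are its components in the frame of the trivialisation a. *)
Definition cliff (a : striv Q) (i : chart M) (v : 'rV[R]_2) (p : M) :
    'M[R[i]]_2 :=
  cl (v *m invmx (sframe i (ssec a p))).

Definition twistor (phi : Q -> 'cV[R[i]]_2) : Prop :=
  forall V, is_vfield V -> forall a i p, sdom a p -> cdom i p ->
    spin_nabla phi a i (V i p) p =
    - ((2^-1)%:C *: (cliff a i (V i p) p *m dirac phi a i p)).

Definition no_zeros (phi : Q -> 'cV[R[i]]_2) : Prop := forall q, phi q != 0.

End Spin.

(* Main.v *)
(** With respect to a local spin frame (s_1, s_2), put n_± = s_1 ± s_2.  The
    Levi-Civita connection satisfies ∇_v n_± = ± ω(v) n_±, and for a half spinor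
    the twistor equation, even taken only along the time-orienting vector field,
    says that its single component f_± is parallel along n_∓.  Hence the null
    fields N_± = ε |f_±|^2 n_±, where ε = 1 or -1 is determined by the time
    orientation, are globally defined and satisfy
    ∇_{N_+} N_- = ∇_{N_-} N_+ = 0.  In particular they commute, and since
    g(N_+, N_-) = - 2 Ω with Ω = |f_+|^2 |f_-|^2, they are parallel for the
    metric g / Ω, which is therefore flat.

    Write the velocity of a geodesic as c' = a N_+ + b N_-.  The geodesic equation
    becomes a' = - N_+(ln Ω) a^2 and b' = - N_-(ln Ω) b^2, so that E = Ω a b is
    constant while (Ω a)' = E N_-(ln Ω) and (Ω b)' = E N_+(ln Ω).  On a compact
    surface a and b are thus bounded on bounded intervals, and the geodesic can be
    continued past any finite time by solving the equation in a chart around a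
    cluster point. *)

From mathcomp Require Import all_boot all_order all_algebra.
From mathcomp Require Import all_classical all_reals all_analysis.
From mathcomp.real_closed Require Import complex.
From mathcomp Require Import ring lra.
Require Import Defs.

Set Implicit Arguments.
Unset Strict Implicit.
Unset Printing Implicit Defensive.

Import Order.TTheory GRing.Theory Num.Theory.
Import numFieldNormedType.Exports.

Local Open Scope classical_set_scope.
Local Open Scope ring_scope.

(** * Smooth functions *)

(** The sign ε answers the components of the spin group. An element of Spin(1,1) is diag(t, s) with
    ts = 1 or -1; changing the spin frame by it multiplies f_+, f_-, n_+, n_- by 1/t, 1/s, t/s, s/t,
    hence both |f_±|^2 n_± by the sign ts, which also records whether s_1 changes its side of the
    time cone. The twistor condition speaks of global vector fields, whereas n_± are local. The
    time-orienting field is global, and since it is timelike both its null components are nonzero,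
    which lets the one equation along it split into one for each null direction. Flatness of g / Ω
    is read off as integrability: a parallel field has partial derivatives linear in the Christoffel
    symbols, and symmetry of second derivatives then makes the curvature annihilate the field. Near
    a finite end β of a geodesic, compactness gives only a cluster point, not a limit. What
    compensates is an existence time uniform over a box of initial states: a solution started late
    enough lasts beyond β, and uniqueness identifies it with the geodesic before β. The lower end
    follows by reversing time. *)

Section SmoothCalculus.
Context {R : realType} {V : normedModType R}.
Implicit Types (U : set V) (x v : V).

Lemma near_eq_differentiable (W : normedModType R) (f g : V -> W) x :
  {near x, f =1 g} -> differentiable f x -> differentiable g x.
Proof.
move=> fg df.
have gE : g \o shift x = cst (g x) + 'd f x +o_ 0 id.
  apply/eqaddoP => _/posnumP[e].
  have /eqaddoP/(_ e%:num) := diff_locally df => /(_ (gt0 e)) dfe.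
  have : \forall h \near (0 : V), f (h + x) = g (h + x).
    by move: fg; rewrite /= (near_shift 0)/=; apply: filterS => h; rewrite /= subr0.
  move: dfe; apply: filterS2 => h /= dfh fgh.
  rewrite !fctE /= in dfh *.
  by rewrite -fgh -(nbhs_singleton fg).
have dgE := diff_unique (diff_continuous df) gE.
by apply/diff_locallyP; split; rewrite dgE //; exact: diff_continuous.
Qed.

(** Openness of [U] turns equality on [U] into equality of germs at its points, so the directional
    derivatives agree on [U] as well and the induction on the order goes through. *)
Lemma near_eq_Ck_on (W : normedModType R) k U (f g : V -> W) :
  open U -> {in U, f =1 g} -> Ck_on k U f -> Ck_on k U g.
Proof.
move=> oU; elim: k f g => [|k IH] f g fg.
  move=> cf x Ux; have fgx : {near x, f =1 g}.
    by near=> y; apply: fg; rewrite inE; near: y; exact: open_nbhs_nbhs.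
  rewrite /prop_for /continuous_at -(nbhs_singleton fgx).
  exact: cvg_trans (near_eq_cvg fgx) (cf x Ux).
move=> [df Cf]; have fgU x : U x -> {near x, f =1 g}.
  by move=> Ux; near=> y; apply: fg; rewrite inE; near: y; exact: open_nbhs_nbhs.
split=> [x Ux|v]; first exact: near_eq_differentiable (fgU x Ux) (df x Ux).
apply: IH (Cf v) => x; rewrite inE => Ux.
exact: near_eq_derive (fgU x Ux).
Unshelve. all: by end_near. Qed.

Lemma near_eq_smooth_on (W : normedModType R) U (f g : V -> W) :
  open U -> {in U, f =1 g} -> smooth_on U f -> smooth_on U g.
Proof. by move=> oU fg Cf k; apply: near_eq_Ck_on fg (Cf k). Qed.

Lemma sub_smooth_on (W : normedModType R) U U' (f : V -> W) :
  U' `<=` U -> smooth_on U f -> smooth_on U' f.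
Proof.
move=> UU Cf k; move: (Cf k) => {Cf}; elim: k f => [|k IH] f /=.
  by move=> cf x /UU; exact: cf.
move=> [df Cf]; split=> [x /UU|v]; [exact: df|exact: IH].
Qed.

(** [Ck_on] is a conjunction of conditions at single points, each on a germ in the whole space, so
    membership of [x] in some [U'] is all that has to be provided. *)
Lemma smooth_on_local (W : normedModType R) U (f : V -> W) :
  (forall x, U x -> exists2 U', U' x & smooth_on U' f) -> smooth_on U f.
Proof.
move=> loc k.
have {}loc x : U x -> exists2 U', U' x & Ck_on k U' f.
  by move=> /loc[U' U'x Cf]; exists U'.
elim: k f loc => [|k IH] f loc /=.
  by move=> x /loc[U' U'x]; apply.
split=> [x /loc[U' U'x [df _]]|v]; first exact: df.
by apply: IH => x /loc[U' U'x [_ /(_ v) Cf]]; exists U'.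
Qed.

Lemma smooth_on_differentiable (W : normedModType R) U (f : V -> W) x :
  smooth_on U f -> U x -> differentiable f x.
Proof. by move=> /(_ 1%N)[df _]; exact: df. Qed.

Lemma smooth_on_derive (W : normedModType R) U (f : V -> W) v :
  smooth_on U f -> smooth_on U ('D_v f).
Proof. by move=> Cf k; have [_] := Cf k.+1; exact. Qed.

Lemma Ck_onW (W : normedModType R) k U (f : V -> W) :
  Ck_on k.+1 U f -> Ck_on k U f.
Proof.
elim: k f => [|k IH] f /=.
  by move=> [df _] x Ux; exact/differentiable_continuous/df.
by move=> [df Cf]; split=> // v; apply: IH; have [] := Cf v.
Qed.

Lemma smooth_on_cst (W : normedModType R) U (w : W) : smooth_on U (fun=> w).
Proof.
move=> k; elim: k w => [|k IH] w /=; first by move=> x _; exact: cst_continuous.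
split=> [x _|v]; first exact: differentiable_cst.
suff -> : 'D_v (fun=> w) = (fun=> 0 : W) by exact: IH.
by apply/funext => x; rewrite derive_cst.
Qed.

Lemma Ck_on_add (W : normedModType R) k U (f g : V -> W) : open U ->
  Ck_on k U f -> Ck_on k U g -> Ck_on k U (fun x => f x + g x).
Proof.
move=> oU; elim: k f g => [|k IH] f g /=.
  by move=> cf cg x Ux; apply: continuousD; [exact: cf|exact: cg].
move=> [df Cf] [dg Cg]; split=> [x Ux|v].
  by apply: differentiableD; [exact: df|exact: dg].
apply: near_eq_Ck_on (IH _ _ (Cf v) (Cg v)) => // x; rewrite inE => Ux.
by rewrite -deriveD //; apply: diff_derivable; [exact: df|exact: dg].
Qed.

Lemma smooth_on_add (W : normedModType R) U (f g : V -> W) : open U ->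
  smooth_on U f -> smooth_on U g -> smooth_on U (fun x => f x + g x).
Proof. by move=> oU Cf Cg k; apply: Ck_on_add; [|exact: Cf|exact: Cg]. Qed.

Lemma derive_mul (f g : V -> R) x v :
  differentiable f x -> differentiable g x ->
  'D_v (fun y => f y * g y) x = 'D_v f x * g x + f x * 'D_v g x.
Proof.
move=> df dg; have -> : (fun y => f y * g y) = f * g by [].
by rewrite deriveM; [rewrite addrC mulrC|exact: diff_derivable..].
Qed.

Lemma derive_inv (f : V -> R) x v : f x != 0 -> differentiable f x ->
  'D_v (fun y => (f y)^-1) x = - ('D_v f x * ((f x)^-1 * (f x)^-1)).
Proof.
move=> fx0 df; rewrite deriveV //; last exact: diff_derivable.
by rewrite -invfM -expr2 scaleNr; congr (- _); exact: mulrC.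
Qed.

Lemma Ck_on_mul k U (f g : V -> R) : open U ->
  Ck_on k U f -> Ck_on k U g -> Ck_on k U (fun x => f x * g x).
Proof.
move=> oU; elim: k f g => [|k IH] f g.
  by move=> /= cf cg x Ux; apply: continuousM; [exact: cf|exact: cg].
move=> Cf Cg; have [df Df] := Cf; have [dg Dg] := Cg; split=> [x Ux|v].
  by apply: differentiableM; [exact: df|exact: dg].
apply: near_eq_Ck_on (Ck_on_add oU (IH _ _ (Df v) (Ck_onW Cg))
                                (IH _ _ (Ck_onW Cf) (Dg v))) => // x.
by rewrite inE => Ux; rewrite derive_mul //; [exact: df|exact: dg].
Qed.

Lemma smooth_on_mul U (f g : V -> R) : open U ->
  smooth_on U f -> smooth_on U g -> smooth_on U (fun x => f x * g x).
Proof. by move=> oU Cf Cg k; apply: Ck_on_mul; [|exact: Cf|exact: Cg]. Qed.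

(** Induction on the order for the inverse itself: its derivative is [- f' f^-1 f^-1], in which the
    inverse occurs at one order less. *)
Lemma smooth_on_inv U (f : V -> R) : open U -> (forall x, U x -> f x != 0) ->
  smooth_on U f -> smooth_on U (fun x => (f x)^-1).
Proof.
move=> oU f0 Cf k; move: (Cf k) => {Cf}.
elim: k => [|k IH] Cf; first by move=> x Ux; apply: continuousV; [exact: f0|exact: Cf].
have [df Df] := Cf; split=> [x Ux|v].
  by apply: differentiableV; [exact: df|exact: f0].
have IHk := IH (Ck_onW Cf).
have cN1 : Ck_on k U (fun=> -1 : R) by exact: smooth_on_cst.
apply: near_eq_Ck_on (Ck_on_mul oU cN1 (Ck_on_mul oU (Df v)
  (Ck_on_mul oU IHk IHk))) => // x.
by rewrite inE => Ux; rewrite derive_inv ?mulN1r //; [exact: f0|exact: df].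
Qed.

Lemma differentiable_entry m n (A : V -> 'M[R]_(m, n)) k l x :
  differentiable A x -> differentiable (fun y => A y k l) x.
Proof.
move=> dA.
exact: (@differentiable_comp _ _ _ _ A (fun B => B k l) x dA (differentiable_coord _ _ _)).
Qed.

Lemma derive_entry m n (A : V -> 'M[R]_(m, n)) k l x v :
  differentiable A x -> 'D_v A x k l = 'D_v (fun y => A y k l) x.
Proof.
by move=> dA; rewrite derive_mx ?mxE //; exact: diff_derivable.
Qed.

Lemma smooth_on_entry m n U (A : V -> 'M[R]_(m, n)) k l : open U ->
  smooth_on U A -> smooth_on U (fun x => A x k l).
Proof.
move=> oU CA r; move: (CA r) => {CA}; elim: r A => [|r IH] A /=.
  move=> cA x Ux.
  exact: (@continuous_comp _ _ _ A (fun B => B k l) x (cA x Ux) (@matrix_normedtype.coord_continuous _ _ _ _ _ _)).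
move=> [dA CA]; split=> [x Ux|v]; first exact/differentiable_entry/dA.
apply: near_eq_Ck_on (IH _ (CA v)) => // x; rewrite inE => Ux.
exact/derive_entry/dA.
Qed.

End SmoothCalculus.

Lemma is_derive_comp_curve (R : realType) (V W : normedModType R)
    (f : V -> W) (c : R -> V) (t : R) (c' : V) :
  is_derive t 1 c c' -> differentiable f (c t) ->
  is_derive t 1 (f \o c) ('D_c' f (c t)).
Proof.
move=> dc df; have dct : differentiable c t by apply/derivable1_diffP/ex_derive.
have dfc : differentiable (f \o c) t by exact: differentiable_comp.
apply: DeriveDef; first exact: diff_derivable.
rewrite deriveE // diff_comp //= [RHS]deriveE //; congr ('d f (c t) _).
by rewrite -deriveE // derive_val.
Qed.

(** * Symmetry of second directional derivatives *)

Section Schwarz.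
Context {R : realType} {V : normedModType R}.
Implicit Types (U : set V) (x u v : V).

Lemma is_derive_line (f : V -> R) x u (s : R) : differentiable f (x + s *: u) ->
  is_derive s 1 (fun r : R => f (x + r *: u)) ('D_u f (x + s *: u)).
Proof.
move=> df; apply: (@is_derive_comp_curve _ _ _ f (fun r => x + r *: u)) => //.
have -> : (fun r : R => x + r *: u) = cst x + ( *:%R^~ u) by [].
rewrite -[X in is_derive _ _ _ X]add0r; apply: is_deriveD.
apply: DeriveDef; first exact/derivable1_diffP.
by rewrite deriveE // diff_val scale1r.
Qed.

Lemma MVT_le (f df : R -> R) (s : R) : 0 < s ->
  (forall r, 0 <= r <= s -> is_derive r 1 f (df r)) ->
  exists2 r, 0 <= r <= s & f s - f 0 = df r * s.
Proof.
move=> s0 dfs; have [r rs||r rs E] := @MVT_segment _ f df 0 s (ltW s0).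
- by apply: dfs; rewrite !ltW ?(itvP rs).
- apply: derivable_within_continuous => r rs.
  by apply: ex_derive; apply: dfs; rewrite ?(itvP rs).
by exists r; [rewrite !(itvP rs)|rewrite E subr0].
Qed.

(** The mean value theorem, applied along [u] to the difference of two parallel segments and then
    along [v], turns the second difference into [s ^+ 2] times a mixed derivative at a nearby point;
    continuity of that derivative does the rest. *)
Lemma second_difference U (phi : V -> R) x u v (e : R) :
  open U -> smooth_on U phi -> U x -> 0 < e ->
  exists2 d, 0 < d & forall s, 0 < s < d ->
    `|phi (x + s *: v + s *: u) - phi (x + s *: v) - (phi (x + s *: u) - phi x)
      - s ^+ 2 * 'D_v ('D_u phi) x| <= e * s ^+ 2.
Proof.
move=> oU Cphi Ux e0.
have Cu := smooth_on_derive u Cphi; have Cuv := smooth_on_derive v Cu.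
have /differentiable_continuous cuv := smooth_on_differentiable Cuv Ux.
have : \forall y \near x, U y /\ `|'D_v ('D_u phi) x - 'D_v ('D_u phi) y| < e.
  near=> y; split; first by near: y; exact: open_nbhs_nbhs.
  near: y; move/cvgrPdist_lt : cuv; exact.
move=> /nbhs_ballP[r /= r0 br].
(* With this [n], steps of length below [r / n] along [u] and [v] stay in the ball of radius [r];
   the summand 1 keeps [n] positive when both vectors vanish. *)
pose n := `|u| + `|v| + 1; have n0 : 0 < n by rewrite ltr_wpDl ?addr_ge0.
have brs s s' d' : 0 < d' -> 0 <= s <= d' -> 0 <= s' <= d' -> d' < r / n ->
    ball x r (x + s *: u + s' *: v).
  move=> d'0 /andP[s0 sd] /andP[s'0 sd'] d'r; rewrite -ball_normE /ball_ /=.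
  rewrite opprD addrA opprD addrA subrr sub0r.
  rewrite (le_lt_trans (ler_normB _ _)) // normrN !normrZ (ger0_norm s0) (ger0_norm s'0).
  have: d' * n < r by rewrite -ltr_pdivlMr.
  apply: le_lt_trans; rewrite /n !mulrDr mulr1.
  by rewrite -[leLHS]addr0; apply: lerD (ltW d'0); apply: lerD; exact: ler_wpM2r.
exists (r / n) => [|s /andP[s0 sd]]; first exact: divr_gt0.
have [||a /andP[a0 as_] Ea] :=
    @MVT_le (fun a => phi (x + s *: v + a *: u) - phi (x + a *: u))
          (fun a => 'D_u phi (x + s *: v + a *: u) - 'D_u phi (x + a *: u)) s.
- by [].
- move=> a /andP[a0 as_].
  have h1 : U (x + s *: v + a *: u).
    rewrite addrAC; apply: (br _ _).1; apply: (@brs _ _ s) => //.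
      by rewrite a0 as_.
    by rewrite ltW /=.
  have h2 : U (x + a *: u).
    rewrite -[x + _]addr0 -(scale0r v); apply: (br _ _).1; apply: (@brs _ _ s) => //.
      by rewrite a0 as_.
    by rewrite lexx ltW /=.
  by apply: is_deriveB; apply: is_derive_line; exact: smooth_on_differentiable Cphi _.
have [||b /andP[b0 bs] Eb] :=
    @MVT_le (fun b => 'D_u phi (x + a *: u + b *: v))
          (fun b => 'D_v ('D_u phi) (x + a *: u + b *: v)) s.
- by [].
- move=> b /andP[b0 bs].
  apply: is_derive_line; apply: smooth_on_differentiable Cu _.
  by apply: (br _ _).1; apply: (@brs _ _ s) => //; apply/andP.
rewrite scale0r addr0 in Eb.
have -> : phi (x + s *: v + s *: u) - phi (x + s *: v) - (phi (x + s *: u) - phi x)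
    = s ^+ 2 * 'D_v ('D_u phi) (x + a *: u + b *: v).
  have -> : s ^+ 2 * 'D_v ('D_u phi) (x + a *: u + b *: v) =
    'D_v ('D_u phi) (x + a *: u + b *: v) * s * s by ring.
  by rewrite -Eb [x + a *: u + s *: v]addrAC -Ea scale0r !addr0; ring.
rewrite -mulrBr normrM ger0_norm ?sqr_ge0 // mulrC ler_wpM2r ?sqr_ge0 //.
rewrite distrC ltW //.
by apply: (br _ _).2; apply: (@brs _ _ s) => //; apply/andP.
Unshelve. all: by end_near. Qed.

(** The second difference is symmetric in [u] and [v], so both mixed derivatives, times [s ^+ 2],
    lie within [e / 2 * s ^+ 2] of the same number. *)
Lemma derive_comm U (phi : V -> R) x u v :
  open U -> smooth_on U phi -> U x ->
  'D_u ('D_v phi) x = 'D_v ('D_u phi) x.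
Proof.
have aux (e p1 p2 p3 p4 q a b : R) : `|p1 - p2 - (p3 - p4) - q * a| <= e / 2 * q ->
    `|p1 - p3 - (p2 - p4) - q * b| <= e / 2 * q -> `|q * (b - a)| <= e * q.
  rewrite !ler_norml => /andP[h1 h2] /andP[h3 h4].
  by apply/andP; split; lra.
move=> oU Cphi Ux; apply/eqP; rewrite -subr_eq0 -normr_eq0 eq_le normr_ge0 andbT.
apply/ler_addgt0Pl => e e0; rewrite addr0.
have e20 : 0 < e / 2 by rewrite divr_gt0.
have [d1 d10 H1] := second_difference u v oU Cphi Ux e20.
have [d2 d20 H2] := second_difference v u oU Cphi Ux e20.
pose s := Num.min d1 d2 / 2; have s0 : 0 < s by rewrite divr_gt0 // lt_min d10.
have sd : s < Num.min d1 d2.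
  by rewrite /s ltr_pdivrMr // ltr_pMr ?ltr1n // lt_min d10.
move: sd; rewrite lt_min => /andP[sd1 sd2].
have {}H1 := H1 s; have {}H2 := H2 s; rewrite s0 ?sd1 ?sd2 in H1 H2.
have {}H1 := H1 isT; have {}H2 := H2 isT.
rewrite (addrAC x (s *: u)) in H2.
set A := 'D_v _ x in H1 *; set B := 'D_u _ x in H2 *.
have := aux _ _ _ _ _ _ _ _ H1 H2.
rewrite normrM ger0_norm ?sqr_ge0 // mulrC ler_pM2r ?exprn_gt0 //.
Qed.

End Schwarz.

(** * Ordinary differential equations *)

Section RealLimits.
Context {R : realType}.

(** The Archimedean step behind the limits in Picard iteration and in uniqueness: powers of 2
    outgrow [B / x]. *)
Lemma le0_geometric (x B : R) : (forall m, x <= B / 2 ^+ m) -> x <= 0.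
Proof.
move=> xB; rewrite leNgt; apply/negP => x0.
have B0 : 0 < B by have := xB 0; rewrite expr0 divr1; exact: lt_le_trans.
pose m := Num.truncn (B / x).
have : B / x < m.+1%:R by apply: truncnS_gt.
rewrite ltr_pdivrMr // => Bm; have := xB m.+1.
rewrite ler_pdivlMr ?exprn_gt0 // leNgt => /negP; apply.
apply: lt_le_trans Bm _; rewrite mulrC ler_pM2l //.
by rewrite -natrX ler_nat ltnW // ltn_expl.
Qed.

(** The intervals of centre [u m] and radius [2 * B / 2 ^+ m] are nested, since the radius drops by
    exactly [B / 2 ^+ m] from [m] to [m.+1]; the supremum of the left ends lies in all of them. *)
Lemma geometric_limit (u : nat -> R) (B : R) :
  (forall m, `|u m.+1 - u m| <= B / 2 ^+ m) ->
  exists l, forall m, `|u m - l| <= 2 * B / 2 ^+ m.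
Proof.
move=> uB; pose d m := 2 * B / 2 ^+ m.
have dS m : d m.+1 + B / 2 ^+ m = d m.
  by rewrite /d exprS invfM; field; rewrite expf_neq0 // pnatr_eq0.
have lo m k : u m - d m <= u (m + k)%N - d (m + k)%N.
  elim: k => [|k IH]; first by rewrite addn0.
  apply: le_trans IH _; rewrite addnS; have := uB (m + k)%N.
  have := dS (m + k)%N; rewrite ler_norml; lra.
have up m k : u (m + k)%N + d (m + k)%N <= u m + d m.
  elim: k => [|k IH]; first by rewrite addn0.
  apply: le_trans IH; rewrite addnS; have := uB (m + k)%N.
  have := dS (m + k)%N; rewrite ler_norml; lra.
have d0 m : 0 <= d m.
  have /(le_trans (normr_ge0 _)) := uB m; rewrite /d -mulrA => h.
  by rewrite mulr_ge0.
have lu m k : u m - d m <= u k + d k.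
  apply: le_trans (lo m k) _; rewrite addnC; apply: le_trans (up k m).
  by have := d0 (k + m)%N; lra.
pose A := range (fun m => u m - d m).
have A0 : A !=set0 by exists (u 0%N - d 0%N); exists 0%N.
have ubA k : ubound A (u k + d k) by move=> _ [m _ <-]; exact: lu.
exists (sup A) => m; rewrite ler_norml; apply/andP; split.
  have := ge_sup A0 (ubA m); rewrite -/(d m); lra.
have : u m - d m <= sup A.
  by apply: ub_le_sup; [exists (u 0%N + d 0%N); exact: ubA|exists m].
by rewrite -/(d m); lra.
Qed.

(** The retraction onto [[lo, hi]]. Being 1-Lipschitz and the identity on the interval, it makes
    local data global without enlarging Lipschitz constants or changing anything inside. *)
Definition clampr (lo hi x : R) := Num.max lo (Num.min x hi).

Lemma clampr_itv lo hi x : lo <= hi -> lo <= clampr lo hi x <= hi.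
Proof.
by move=> h; rewrite /clampr le_max lexx /= ge_max h ge_min lexx orbT.
Qed.

Lemma clampr_id lo hi x : lo <= x <= hi -> clampr lo hi x = x.
Proof. by move=> /andP[h1 h2]; rewrite /clampr min_l // max_r. Qed.

Lemma clampr_lip lo hi x y : `|clampr lo hi x - clampr lo hi y| <= `|x - y|.
Proof.
have maxl (a u v : R) : u <= v -> 0 <= Num.max a v - Num.max a u <= v - u.
  by move=> uv; case: (leP a u) => ?; case: (leP a v) => ?; lra.
have minl (a u v : R) : u <= v -> 0 <= Num.min v a - Num.min u a <= v - u.
  by move=> uv; case: (leP u a) => ?; case: (leP v a) => ?; lra.
wlog xy : x y / x <= y.
  by move=> H; case: (leP x y) => [/H//|/ltW/H]; rewrite distrC (distrC y).
have /andP[m0 m1] := minl hi x y xy.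
have /(maxl lo)/andP[M0 M1] : Num.min x hi <= Num.min y hi by rewrite -subr_ge0.
rewrite distrC [leRHS]distrC ger0_norm // (le_trans M1) // (le_trans m1) //.
exact: ler_norm.
Qed.

Lemma clampr_continuous lo hi : continuous (clampr lo hi).
Proof.
move=> x; apply/cvgrPdist_lt => e e0; near=> y.
apply: le_lt_trans (clampr_lip _ _ _ _) _.
by near: y; apply: cvgr_dist_lt.
Unshelve. all: by end_near. Qed.

(** The primitive is frozen outside [[-T, T]]: it lives on the whole line, and estimates on
    [[-T, T]] hold at all times. *)
Lemma antiderivative (f : R -> R) (T : R) : continuous f -> 0 < T ->
  exists G : R -> R, [/\ continuous G, G 0 = 0,
    forall t : R, `|t| < T -> is_derive t 1 G (f t) &
    forall t, G t = G (clampr (- T) T t)].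
Proof.
move=> cf T0.
(* A margin of one unit on both sides lets the fundamental theorem apply at the ends of [[-T, T]]
   too. *)
pose a := - T - 1.
pose H x := (\int[@lebesgue_measure R]_(t in [set` `[a, x]]) (f t))%R.
have dH x : a < x < T + 1 -> is_derive x 1 H (f x).
  move=> /andP[ax xT].
  have fi : (@lebesgue_measure R).-integrable `[a, T + 1] (EFin \o f).
    apply: continuous_compact_integrable; first exact: segment_compact.
    exact: continuous_subspaceT.
  have [dH HE] := continuous_FTC1_closed xT fi ax (cf x).
  exact: (DeriveDef dH (etrans (esym (derive1E _ _)) HE)).
pose cl := clampr (- T) T.
have clT t : - T <= cl t <= T by apply: clampr_itv; lra.
exists (fun t => H (cl t) - H 0); split.
- move=> x; apply: (@continuousB _ _ _ (H \o cl) (cst (H 0)));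
    last exact: cst_continuous.
  apply: continuous_comp; first exact: clampr_continuous.
  apply/differentiable_continuous/derivable1_diffP.
  have /andP[h1 h2] := clT x.
  by apply: ex_derive; apply: dH; rewrite /a; lra.
- by rewrite /cl clampr_id ?subrr //; lra.
- move=> t; rewrite ltr_norml => /andP[h1 h2].
  apply: (@near_eq_is_derive _ _ _ (fun t => H t - H 0)).
    near=> s; rewrite /cl clampr_id //; apply/andP; split; apply: ltW; near: s.
      exact: lt_nbhsr.
    exact: lt_nbhsl.
  rewrite -[X in is_derive _ _ _ X]subr0; apply: is_deriveB.
  by apply: dH; rewrite /a; lra.
- by move=> t; rewrite /cl [clampr _ _ (clampr _ _ _)]clampr_id //; exact: clT.
Unshelve. all: by end_near. Qed.

Lemma MVT_bound (f df : R -> R) (a b M : R) : a <= b ->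
  (forall x, a < x < b -> is_derive x 1 f (df x)) ->
  {within `[a, b], continuous f} ->
  (forall x, a < x < b -> `|df x| <= M) -> `|f b - f a| <= M * (b - a).
Proof.
rewrite le_eqVlt => /predU1P[<-|ab] dfab cf dfM; first by rewrite !subrr normr0 mulr0.
have dfab' x : x \in `]a, b[ -> is_derive x 1 f (df x).
  by move=> xab; apply: dfab; rewrite !(itvP xab).
have [x xab ->] := MVT ab dfab' cf.
have ba : 0 <= b - a by rewrite subr_ge0 ltW.
rewrite normrM (ger0_norm ba); apply: ler_wpM2r => //.
by apply: dfM; rewrite !(itvP xab).
Qed.

Lemma MVT_bound0 (G g : R -> R) (T M s : R) : continuous G -> G 0 = 0 ->
  (forall t : R, `|t| < T -> is_derive t 1 G (g t)) ->
  (forall t, `|t| < T -> `|g t| <= M) -> `|s| <= T -> `|G s| <= M * `|s|.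
Proof.
move=> cG G0 dG gM; rewrite ler_norml => /andP[Ts sT].
have cGs a b : {within `[a, b], continuous G} by exact: continuous_subspaceT.
case: (leP 0 s) => s0.
- have xT x : 0 < x < s -> `|x| < T.
    by move=> /andP[x0 xs]; rewrite (gtr0_norm x0) (lt_le_trans xs).
  have := MVT_bound s0 (fun x hx => dG x (xT x hx)) (cGs _ _)
    (fun x hx => gM x (xT x hx)).
  by rewrite G0 !subr0 (ger0_norm s0).
- have xT x : s < x < 0 -> `|x| < T.
    move=> /andP[sx x0]; rewrite (ltr0_norm x0) ltrNl.
    exact: le_lt_trans Ts sx.
  have := MVT_bound (ltW s0) (fun x hx => dG x (xT x hx)) (cGs _ _)
    (fun x hx => gM x (xT x hx)).
  by rewrite G0 !sub0r normrN (ltr0_norm s0).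
Qed.

End RealLimits.

(** * Picard iteration for globally Lipschitz systems *)

Section Picard.
Context {R : realType} {I : finType}.
Implicit Types (y z : I -> R) (F : (I -> R) -> I -> R).

(** Lipschitz continuity for the sup distance, phrased through an arbitrary bound [e] of that
    distance instead of a maximum over [I]. *)
Definition lip_on (A : set (I -> R)) (L : R) F := forall e y z, A y -> A z ->
  (forall k, `|y k - z k| <= e) -> forall k, `|F y k - F z k| <= L * e.

Lemma continuous_lip F L (u : R -> I -> R) : 0 < L -> lip_on setT L F ->
  (forall k, continuous (fun t => u t k)) ->
  forall k, continuous (fun t => F (u t) k).
Proof.
move=> L0 lF cu k t; apply/cvgrPdist_le => e e0; near=> s.
have -> : e = L * (e / L) by rewrite mulrCA divff ?mulr1 // gt_eqF.
apply: lF => // j; move: j; near: s; apply: filter_forall => j.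
by apply: (@cvgr_dist_le _ _ _ _ _ _ (u t j)); [exact: cu|rewrite divr_gt0].
Unshelve. all: by end_near. Qed.

Let aux4 (e p q a b : R) : `|p - a| <= e / 4 -> `|q - b| <= e / 4 ->
  `|p - q| <= e / 4 -> 0 < e -> `|a - b| <= e.
Proof. by rewrite !ler_norml; lra. Qed.

(** The integral operator shrinks the sup distance by the factor [L * T <= 2^-1], so the m-th
    iterate moves by at most [B / 2 ^+ m] and the iterates converge uniformly in time. *)
Lemma picard F (L T : R) y0 : 0 < L -> 0 < T -> L * T <= 2^-1 -> lip_on setT L F ->
  exists u : R -> I -> R, u 0 = y0 /\
    forall (t : R) k, `|t| < T -> is_derive t 1 (fun s => u s k) (F (u t) k).
Proof.
move=> L0 T0 LT lF.
(* One operator for all functions, by choice. Its value at a discontinuous function is junk, which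
   is why continuity is carried along for all iterates. *)
have [J HJ] : exists J : (R -> R) -> (R -> R), forall f, continuous f ->
    [/\ continuous (J f), J f 0 = 0,
    forall t : R, `|t| < T -> is_derive t 1 (J f) (f t) &
    forall t, J f t = J f (clampr (- T) T t)].
  have : forall f : R -> R, exists g : R -> R, continuous f ->
    [/\ continuous g, g 0 = 0,
    forall t : R, `|t| < T -> is_derive t 1 g (f t) &
    forall t, g t = g (clampr (- T) T t)].
    move=> f; have [cf|ncf] := pselect (continuous f); last by exists f.
    by have [g Hg] := antiderivative cf T0; exists g.
  by move=> /choice[J HJ]; exists J.
have ct t : `|clampr (- T) T t| <= T.
  by rewrite ler_norml; apply: clampr_itv; rewrite ge0_cp // ltW.
have Jbound f M : continuous f -> 0 <= M -> (forall t, `|f t| <= M) ->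
    forall t, `|J f t| <= M * T.
  move=> cf M0 fM t; have [cJ J0 dJ ->] := HJ _ cf.
  apply: le_trans (MVT_bound0 cJ J0 dJ (fun t _ => fM t) (ct t)) _.
  exact: ler_wpM2l (ct t).
have Jdist f g M : continuous f -> continuous g -> 0 <= M ->
    (forall t, `|f t - g t| <= M) -> forall t, `|J f t - J g t| <= M * T.
  move=> cf cg M0 fgM t.
  have [cJf Jf0 dJf ->] := HJ _ cf; have [cJg Jg0 dJg ->] := HJ _ cg.
  have cB : continuous (fun t => J f t - J g t).
    by move=> x; apply: (@continuousB _ _ _ (J f) (J g)); [exact: cJf|exact: cJg].
  have B0 : J f 0 - J g 0 = 0 by rewrite Jf0 Jg0 subrr.
  have dB (x : R) : `|x| < T ->
      is_derive x 1 (fun t => J f t - J g t) (f x - g x).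
    by move=> xT; apply: is_deriveB; [exact: dJf|exact: dJg].
  apply: le_trans (MVT_bound0 cB B0 dB (fun t _ => fgM t) (ct t)) _.
  exact: ler_wpM2l (ct t).
pose Phi (u : R -> I -> R) t k := y0 k + J (fun s => F (u s) k) t.
pose cont (u : R -> I -> R) := forall k, continuous (fun t => u t k).
have cF u k : cont u -> continuous (fun t => F (u t) k).
  by move=> cu; exact: (continuous_lip L0 lF cu).
have Phi_cont u : cont u -> cont (Phi u).
  move=> cu k t; apply: continuousD; first exact: cst_continuous.
  by have [cJ _ _ _] := HJ _ (cF u k cu); exact: cJ.
have Phi_lip u v e : cont u -> cont v -> (forall t k, `|u t k - v t k| <= e) ->
    forall t k, `|Phi u t k - Phi v t k| <= e / 2.
  move=> cu cv uv t k.
  have e0 : 0 <= e by apply: le_trans (normr_ge0 _) (uv t k).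
  rewrite /Phi opprD addrACA subrr add0r.
  have LM : 0 <= L * e by rewrite mulr_ge0 // ltW.
  apply: le_trans (Jdist _ _ _ (cF u k cu) (cF v k cv) LM _ t) _.
    by move=> s; apply: lF.
  by rewrite mulrAC mulrC ler_wpM2l.
pose it m := iter m Phi (fun _ => y0).
have it_cont m : cont (it m).
  by elim: m => [|m IH]; [move=> k; exact: cst_continuous|exact: Phi_cont].
have [B HB] : exists B, forall t k, `|it 1%N t k - it 0%N t k| <= B.
  pose M := \sum_k `|F y0 k|; exists (M * T) => t k.
  rewrite /it /= /Phi addrAC subrr add0r.
  apply: Jbound => [||s]; [exact: cst_continuous|by rewrite sumr_ge0|].
  by rewrite /M (bigD1 k) //= lerDl sumr_ge0.
have step m t k : `|it m.+1 t k - it m t k| <= B / 2 ^+ m.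
  elim: m t k => [|m IH] t k; first by rewrite expr0 divr1.
  rewrite exprSr invfM mulrA; exact: (Phi_lip (it m.+1) (it m)).
have [u Hu] : exists u : R -> I -> R, forall t k m,
    `|it m t k - u t k| <= 2 * B / 2 ^+ m.
  have : forall tk : R * I, exists l, forall m, `|it m tk.1 tk.2 - l| <= 2 * B / 2 ^+ m.
    by move=> [t k]; exact: geometric_limit (fun m => step m t k).
  by move=> /choice[l Hl]; exists (fun t k => l (t, k)) => t k m; exact: (Hl (t, k)).
have u_cont : cont u.
  move=> k t; apply/cvgrPdist_le => e e0.
  have [m Hm] : exists m, 2 * B / 2 ^+ m <= e / 4.
    apply/not_existsP => H; have : e / 4 <= 0.
      apply: (@le0_geometric _ _ (2 * B)) => m; apply: ltW.
      by rewrite ltNge; apply/negP/H.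
    by apply/negP; rewrite -ltNge divr_gt0.
  near=> s.
  have h1 := Hu t k m; have h2 := Hu s k m.
  have h3 : `|it m t k - it m s k| <= e / 4.
    near: s; apply: (@cvgr_dist_le _ _ _ _ _ _ (it m t k)); first exact: it_cont.
    by rewrite divr_gt0.
  exact: aux4 (le_trans h1 Hm) (le_trans h2 Hm) h3 e0.
have uE t k : u t k = Phi u t k.
  apply/eqP; rewrite -subr_eq0 -normr_eq0 eq_le normr_ge0 andbT.
  apply: (@le0_geometric _ _ (2 * B)) => m.
  have h1 := Hu t k m.+1.
  have h2 := Phi_lip _ _ _ (it_cont m) u_cont (fun t k => Hu t k m) t k.
  rewrite exprSr invfM mulrA in h1.
  apply: le_trans (ler_distD (it m.+1 t k) _ _) _.
  by rewrite [leRHS]splitr lerD // distrC.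
exists u; split.
  apply/funext => k; rewrite uE /Phi.
  by have [_ -> _ _] := HJ _ (cF u k u_cont); rewrite addr0.
move=> t k tT.
have -> : (fun s => u s k) = (fun s => y0 k + J (fun s => F (u s) k) s).
  by apply/funext => s; rewrite uE.
rewrite -[F (u t) k]add0r; apply: is_deriveD.
by have [_ _ dJ _] := HJ _ (cF u k u_cont); exact: dJ.
Unshelve. all: by end_near. Qed.

End Picard.

Lemma MVT_dist (R : realType) (J : set R) (f df : R -> R) (M a b : R) :
  is_interval J -> (forall x, J x -> is_derive x 1 f (df x)) ->
  (forall x, J x -> `|df x| <= M) -> J a -> J b -> `|f b - f a| <= M * `|b - a|.
Proof.
move=> iJ dJ dM.
wlog ab : a b / a <= b.
  move=> H Ja Jb; case: (leP a b) => [/H|/ltW/H]; first exact.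
  by move=> /(_ Jb Ja); rewrite distrC (distrC a).
move=> Ja Jb; rewrite (ger0_norm (_ : 0 <= b - a)) ?subr_ge0 //.
have Jx x : a <= x <= b -> J x by exact: iJ Ja Jb x.
apply: MVT_bound ab _ _ _ => [x /andP[ax xb]||x /andP[ax xb]].
- by apply: dJ; apply: Jx; rewrite !ltW.
- apply: derivable_within_continuous => x xab; apply: ex_derive; apply: dJ.
  by apply: Jx; rewrite !(itvP xab).
- by apply: dM; apply: Jx; rewrite !ltW.
Qed.

(** * Uniqueness of solutions and flow boxes *)

Section Flow.
Context {R : realType} {I : finType}.
Implicit Types (y z : I -> R) (F : (I -> R) -> I -> R).

(** A bound [e] on the distance of [u] and [v] over [[t0, t]] improves to [L * d * e <= e / 2] when
    the difference is estimated from [t0] by the mean value theorem; iterating from a maximum forces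
    the distance to vanish. *)
Lemma ode_unique F (L d t0 : R) (u v : R -> I -> R) :
  0 < L -> L * d <= 2^-1 -> lip_on setT L F ->
  (forall t k, t0 <= t < t0 + d -> is_derive t 1 (fun s => u s k) (F (u t) k)) ->
  (forall t k, t0 <= t < t0 + d -> is_derive t 1 (fun s => v s k) (F (v t) k)) ->
  u t0 = v t0 -> forall t, t0 <= t < t0 + d -> u t = v t.
Proof.
move=> L0 Ld lF du dv uv0 t /andP[t0t td].
pose w k s := u s k - v s k.
have sd s : t0 <= s <= t -> t0 <= s < t0 + d.
  by move=> /andP[-> st]; rewrite (le_lt_trans st).
have dw s k : t0 <= s <= t -> is_derive s 1 (w k) (F (u s) k - F (v s) k).
  by move=> /sd st; apply: is_deriveB; [exact: du|exact: dv].
have cw k s : t0 <= s <= t -> {within `[t0, s], continuous (w k)}.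
  move=> /andP[_ st]; apply: derivable_within_continuous => x xs.
  apply: ex_derive; apply: dw; rewrite (itvP xs) /=.
  by apply: le_trans st; rewrite (itvP xs).
have [e0 He0] : exists e0, forall s k, t0 <= s <= t -> `|w k s| <= e0.
  have : forall k, exists e, forall s, t0 <= s <= t -> `|w k s| <= e.
    move=> k; have ct : t0 <= t <= t by rewrite t0t lexx.
    have cn : {within `[t0, t], continuous (fun s => `|w k s|)}.
      move=> x; apply: continuous_comp; first exact: cw.
      exact: norm_continuous.
    have [c _ Hc] := EVT_max t0t cn.
    by exists (`|w k c|) => s st; apply: Hc; rewrite in_itv.
  move=> /choice[e He]; exists (\sum_k `|e k|) => s k st.
  apply: le_trans (He k s st) _; apply: le_trans (ler_norm _) _.
  by rewrite (bigD1 k) //= lerDl sumr_ge0.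
have Hm m s k : t0 <= s <= t -> `|w k s| <= e0 / 2 ^+ m.
  elim: m s k => [|m IH] s k st; first by rewrite expr0 divr1; exact: He0.
  have /andP[t0s s_t] := st.
  have e1 : 0 <= e0 / 2 ^+ m by apply: le_trans (normr_ge0 _) (IH s k st).
  have -> : w k s = w k s - w k t0 by rewrite /w uv0 subrr subr0.
  have bd x : t0 < x < s -> `|F (u x) k - F (v x) k| <= L * (e0 / 2 ^+ m).
    move=> /andP[h1 h2]; apply: lF => // j; apply: IH.
    by rewrite (ltW h1) (le_trans (ltW h2)).
  have dws x : t0 < x < s -> is_derive x 1 (w k) (F (u x) k - F (v x) k).
    by move=> /andP[h1 h2]; apply: dw; rewrite (ltW h1) (le_trans (ltW h2)).
  apply: le_trans (MVT_bound t0s dws (cw k s st) bd) _.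
  have -> : L * (e0 / 2 ^+ m) * (s - t0) = e0 / 2 ^+ m * (L * (s - t0)) by ring.
  have -> : e0 / 2 ^+ m.+1 = e0 / 2 ^+ m * 2^-1 by rewrite exprSr invfM mulrA.
  apply: ler_wpM2l => //.
  apply: le_trans Ld; rewrite ler_pM2l // lerBlDl ltW //.
  exact: le_lt_trans s_t td.
apply/funext => k; apply/eqP; rewrite -subr_eq0 -normr_eq0 eq_le normr_ge0 andbT.
by apply: (@le0_geometric _ _ e0) => m; apply: Hm; rewrite t0t lexx.
Qed.

Definition box y (rho : I -> R) : set (I -> R) :=
  [set z | forall k, `|z k - y k| <= rho k].

Definition clampb y (rho : I -> R) z : I -> R :=
  fun k => clampr (y k - rho k) (y k + rho k) (z k).

Lemma clampb_box y rho z : (forall k, 0 < rho k) -> box y rho (clampb y rho z).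
Proof.
move=> rho0 k; rewrite ler_distl /clampb; apply: clampr_itv.
by rewrite lerD2l ge0_cp // ltW.
Qed.

Lemma clampb_id y rho z : box y rho z -> clampb y rho z = z.
Proof.
move=> yz; apply/funext => k; apply: clampr_id.
by have := yz k; rewrite ler_distl.
Qed.

Lemma lip_on_clampb y rho L F : (forall k, 0 < rho k) -> lip_on (box y rho) L F ->
  lip_on setT L (F \o clampb y rho).
Proof.
move=> rho0 lF e z z' _ _ zz; apply: lF; [exact: clampb_box|exact: clampb_box|].
by move=> k; apply: le_trans (clampr_lip _ _ _ _) (zz k).
Qed.

(** The field is made globally Lipschitz by clamping its argument to the box. Solutions starting in
    the box of half size stay inside the full box up to time [T], where the clamp does nothing. What
    matters later is that one [T] serves all these initial values. *)
Lemma flow_box F y (rho : I -> R) (L M : R) :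
  0 < L -> 0 < M -> (forall k, 0 < rho k) -> lip_on (box y rho) L F ->
  (forall z k, box y rho z -> `|F z k| <= M) ->
  exists2 T, 0 < T & forall z, (forall k, `|z k - y k| <= rho k / 2) ->
    exists u : R -> I -> R, u 0 = z /\ forall t, `|t| < T ->
      (forall k, `|u t k - y k| < rho k) /\
      forall k, is_derive t 1 (fun s => u s k) (F (u t) k).
Proof.
move=> L0 M0 rho0 lF FM.
(* The time [S^-1] satisfies [L * S^-1 <= 2^-1], as Picard iteration demands, and
   [M * S^-1 <= rho k / 2] for every [k], so that no solution crosses the outer half of the box. *)
pose S := 2 * L + \sum_k 2 * M / rho k.
have S0 : 0 < S.
  rewrite ltr_wpDr ?mulr_gt0 // sumr_ge0 // => k _.
  by rewrite divr_ge0 ?mulr_ge0 // ltW.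
have LS : 2 * L <= S by rewrite lerDl sumr_ge0 // => k _; rewrite divr_ge0 ?mulr_ge0 // ltW.
have MS k : 2 * M / rho k <= S.
  rewrite /S (bigD1 k) //= addrCA lerDl addr_ge0 ?mulr_ge0 ?(ltW L0) //.
  by rewrite sumr_ge0 // => j _; rewrite divr_ge0 ?mulr_ge0 // ltW.
exists S^-1 => [|z zy]; first by rewrite invr_gt0.
have S0' : 0 < S^-1 by rewrite invr_gt0.
have LT : L * S^-1 <= 2^-1.
  by rewrite ler_pdivrMr // mulrC ler_pdivlMr // mulrC.
have [u [u0 du]] := picard z L0 S0' LT (lip_on_clampb rho0 lF).
exists u; split=> // t tT.
have dist k : `|u t k - y k| < rho k.
  have -> : u t k - y k = (u t k - u 0 k) + (z k - y k) by rewrite u0 addrA subrK.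
  rewrite (le_lt_trans (ler_normD _ _)) //.
  rewrite [ltRHS]splitr ltr_leD //.
  have iJ : is_interval [set s : R | `|s| < S^-1].
    move=> a b /=; rewrite !ltr_norml => /andP[a1 a2] /andP[b1 b2] c /andP[ac cb].
    by rewrite ltr_norml (lt_le_trans a1 ac) (le_lt_trans cb b2).
  have J0 : `|0 : R| < S^-1 by rewrite normr0.
  have bd (x : R) : `|x| < S^-1 -> `|(F \o clampb y rho) (u x) k| <= M.
    by move=> _; apply: FM; exact: clampb_box.
  apply: le_lt_trans (MVT_dist iJ (fun x hx => du x k hx) bd J0 tT) _.
  rewrite subr0; apply: (@lt_le_trans _ _ (M * S^-1)); first by rewrite ltr_pM2l.
  have := MS k; rewrite ler_pdivrMr // => h.
  rewrite ler_pdivrMr //; have -> : rho k / 2 * S = S * rho k / 2 by ring.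
  by rewrite ler_pdivlMr // mulrC.
split=> // k; have := du t k tT; rewrite /= clampb_id // => j.
exact/ltW/dist.
Qed.

End Flow.

(** * Local Lipschitz bounds for smooth functions *)

Section Lipschitz.
Context {R : realType} {n : nat}.
Implicit Types (x : 'rV[R]_n).

Lemma nbhs_row x (P : set 'rV[R]_n) : nbhs x P ->
  exists2 r : R, 0 < r & forall y : 'rV[R]_n, (forall k, `|y 0 k - x 0 k| <= r) -> P y.
Proof.
move=> /nbhs_ballP[r /= r0 xP]; exists (r / 2) => [|y yx]; first by rewrite divr_gt0.
apply: xP; rewrite -ball_normE /ball_ /=.
apply: (@le_lt_trans _ _ (r / 2)); last by rewrite ltr_pdivrMr // ltr_pMr // ltr1n.
rewrite /Num.Def.normr /= mx_normrE; apply: bigmax_le => [|[i k] _].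
  by rewrite divr_ge0 // ltW.
by rewrite /= !mxE ord1 distrC.
Qed.

Lemma derive_row (W : normedModType R) (f : 'rV[R]_n -> W) x v :
  differentiable f x -> 'D_v f x = \sum_k v 0 k *: 'D_(delta_mx 0 k) f x.
Proof.
move=> df; rewrite deriveE // {1}(row_sum_delta v) linear_sum /=.
by apply: eq_bigr => k _; rewrite linearZ /= deriveE.
Qed.

(** Mean value theorem on the segment from [z] to [y], which stays in the convex box, with partial
    derivatives bounded near [x] by continuity. *)
Lemma smooth_on_lip U (f : 'rV[R]_n -> R) x : open U -> smooth_on U f -> U x ->
  exists r K : R, [/\ 0 < r, 0 < K,
    forall y : 'rV[R]_n, (forall k, `|y 0 k - x 0 k| <= r) -> U y /\ `|f y| <= K &
    forall (y z : 'rV[R]_n) (e : R), 0 <= e -> (forall k, `|y 0 k - x 0 k| <= r) ->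
      (forall k, `|z 0 k - x 0 k| <= r) ->
      (forall k, `|y 0 k - z 0 k| <= e) -> `|f y - f z| <= K * e].
Proof.
move=> oU Cf Ux.
(* [B] bounds the sum of the absolute partial derivatives near [x]; [K] dominates both [B] and the
   values of [f], so one constant serves both estimates. *)
pose B := \sum_k (`|'D_(delta_mx 0 k) f x| + 1).
pose K := `|f x| + 1 + B.
have B0 : 0 <= B by apply: sumr_ge0 => k _; rewrite addr_ge0.
have near1 (g : 'rV[R]_n -> R) : smooth_on U g ->
    \forall y \near x, `|g y| <= `|g x| + 1.
  move=> Cg; have /differentiable_continuous cg := smooth_on_differentiable Cg Ux.
  near=> y; have h : `|g x - g y| <= 1.
    by near: y; apply: (@cvgr_dist_le _ _ _ _ _ _ (g x)).
  rewrite -lerBlDl; apply: le_trans h; rewrite distrC.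
  exact: lerB_dist.
have : \forall y \near x, U y /\ `|f y| <= `|f x| + 1 /\
    forall k, `|'D_(delta_mx 0 k) f y| <= `|'D_(delta_mx 0 k) f x| + 1.
  near=> y; split; first by near: y; exact: open_nbhs_nbhs.
  split; first by near: y; exact: near1.
  near: y; apply: filter_forall => k; apply: near1; exact: smooth_on_derive.
move=> /nbhs_row[r r0 Hr]; exists r, K; split=> //.
- by rewrite /K ltr_wpDr // ltr_wpDl.
- move=> y /Hr[Uy [fy _]]; split=> //; apply: le_trans fy _.
  by rewrite /K lerDl.
move=> y z e e0 yx zx yz.
pose w := y - z.
pose c (s : R) := z + s *: w.
have iJ : is_interval [set s : R | 0 <= s <= 1].
  move=> a b /= /andP[a1 a2] /andP[b1 b2] d /andP[ad db].
  by rewrite (le_trans a1 ad) (le_trans db b2).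
have cx (s : R) : 0 <= s <= 1 -> forall k, `|c s 0 k - x 0 k| <= r.
  move=> /andP[s0 s1] k; rewrite /c /w !mxE.
  have -> : z 0 k + s * (y 0 k - z 0 k) - x 0 k =
     s * (y 0 k - x 0 k) + (1 - s) * (z 0 k - x 0 k) by ring.
  apply: le_trans (ler_normD _ _) _; rewrite !normrM (ger0_norm s0).
  rewrite (ger0_norm (_ : 0 <= 1 - s)) ?subr_ge0 //.
  apply: le_trans (lerD (ler_wpM2l s0 (yx k)) (ler_wpM2l _ (zx k))) _.
    by rewrite subr_ge0.
  by rewrite -mulrDl addrC subrK mul1r.
have dc (s : R) : 0 <= s <= 1 ->
    is_derive s 1 (fun s => f (c s)) ('D_w f (c s)).
  move=> s01; apply: is_derive_line; apply: smooth_on_differentiable Cf _.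
  by have [] := Hr _ (cx s s01).
have bd (s : R) : 0 <= s <= 1 -> `|'D_w f (c s)| <= K * e.
  move=> s01; have [Uc [_ Dc]] := Hr _ (cx s s01).
  rewrite derive_row; last exact: smooth_on_differentiable Cf Uc.
  apply: le_trans (ler_norm_sum _ _ _) _.
  apply: (@le_trans _ _ (B * e)); last first.
    by apply: ler_wpM2r => //; rewrite /K lerDr addr_ge0.
  rewrite /B mulr_suml; apply: ler_sum => k _; rewrite normrM mulrC.
  apply: ler_pM => //; rewrite /w !mxE; exact: yz.
have := @MVT_dist _ _ (fun s => f (c s)) (fun s => 'D_w f (c s)) (K * e) 0 1 iJ dc bd.
rewrite /= !lexx !ler01.
move=> /(_ isT isT); rewrite subr0 normr1 mulr1 /c scale1r scale0r addr0.
by rewrite /w [z + _]addrC subrK.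
Unshelve. all: by end_near. Qed.

End Lipschitz.

(** * The Levi-Civita connection in the plane *)

Section RowCalculus.
Context {R : realType} {V : normedModType R}.
Implicit Types (x v : V).

Lemma is_derive_add (f g : V -> R) x v (df dg : R) :
  is_derive x v f df -> is_derive x v g dg ->
  is_derive x v (fun y => f y + g y) (df + dg).
Proof. exact: is_deriveD. Qed.

Lemma is_derive_opp (f : V -> R) x v (df : R) :
  is_derive x v f df -> is_derive x v (fun y => - f y) (- df).
Proof. exact: is_deriveN. Qed.

Lemma is_derive_mul (f g : V -> R) x v (df dg : R) :
  is_derive x v f df -> is_derive x v g dg ->
  is_derive x v (fun y => f y * g y) (df * g x + f x * dg).
Proof.
move=> hf hg; rewrite addrC [df * _]mulrC; exact: (is_deriveM hf hg).
Qed.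

Lemma is_derive_diff (W : normedModType R) (f : V -> W) x v :
  differentiable f x -> is_derive x v f ('D_v f x).
Proof. by move=> df; exact/derivableP/diff_derivable. Qed.

Lemma differentiable_entries m n (A : V -> 'M[R]_(m, n)) x :
  (forall k l, differentiable (fun y => A y k l) x) -> differentiable A x.
Proof.
move=> dA.
have -> : A = \sum_(kl : 'I_m * 'I_n) (fun y => A y kl.1 kl.2 *: delta_mx kl.1 kl.2).
  apply/funext => y; rewrite fct_sumE {1}(matrix_sum_delta (A y)).
  by rewrite pair_bigA.
elim/big_ind : _ => [|f g df dg|kl _].
- exact: differentiable_cst.
- exact: differentiableD.
- exact: differentiableZl.
Qed.

Lemma differentiable_scale m n (f : V -> R) (A : V -> 'M[R]_(m, n)) x :
  differentiable f x -> differentiable A x -> differentiable (fun y => f y *: A y) x.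
Proof.
move=> df dA; apply: differentiable_entries => k l.
have -> : (fun y => (f y *: A y) k l) = f * (fun y => A y k l).
  by apply/funext => y; rewrite mxE.
by apply: differentiableM => //; exact: differentiable_entry.
Qed.

Lemma derive_scale m n (f : V -> R) (A : V -> 'M[R]_(m, n)) x v :
  differentiable f x -> differentiable A x ->
  'D_v (fun y => f y *: A y) x = 'D_v f x *: A x + f x *: 'D_v A x.
Proof.
move=> df dA; apply/matrixP => k l.
rewrite derive_entry; last exact: differentiable_scale.
rewrite !mxE derive_entry //.
have -> : (fun y => (f y *: A y) k l) = (fun y => f y * A y k l).
  by apply/funext => y; rewrite mxE.
by rewrite derive_mul //; exact: differentiable_entry.
Qed.

Lemma deriveDv (W : normedModType R) (f : V -> W) x v w : differentiable f x ->
  'D_(v + w) f x = 'D_v f x + 'D_w f x.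
Proof. by move=> df; rewrite !deriveE // linearD. Qed.

Lemma deriveZv (W : normedModType R) (f : V -> W) x a v : differentiable f x ->
  'D_(a *: v) f x = a *: 'D_v f x.
Proof. by move=> df; rewrite !deriveE // linearZ. Qed.

End RowCalculus.

Lemma sum2 (V : nmodType) (F : 'I_2 -> V) : \sum_(k < 2) F k = F 0 + F 1.
Proof.
by rewrite !big_ord_recl big_ord0 addr0; congr (F _ + F _); apply/val_inj.
Qed.

Lemma ord2P (P : 'I_2 -> Prop) : P 0 -> P 1 -> forall k, P k.
Proof.
move=> P0 P1 [[|[|//]] h].
  by rewrite (_ : Ordinal h = 0) //; exact: val_inj.
by rewrite (_ : Ordinal h = 1) //; exact: val_inj.
Qed.

Lemma row2P (T : Type) (v w : 'rV[T]_2) : v 0 0 = w 0 0 -> v 0 1 = w 0 1 -> v = w.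
Proof. by move=> h0 h1; apply/rowP; apply: ord2P. Qed.

Section Bilinear.
Context {R : realType}.
Implicit Types (A F : 'M[R]_2) (u v w : 'rV[R]_2).

Lemma mformE A v w : mform A v w =
  v 0 0 * A 0 0 * w 0 0 + v 0 0 * A 0 1 * w 0 1 +
  (v 0 1 * A 1 0 * w 0 0 + v 0 1 * A 1 1 * w 0 1).
Proof. by rewrite /mform !(mxE, sum2); ring. Qed.

Lemma mformC A v w : A^T = A -> mform A v w = mform A w v.
Proof.
move=> AT; rewrite !mformE -[in LHS]AT !mxE; ring.
Qed.

Lemma mformDl A u v w : mform A (u + v) w = mform A u w + mform A v w.
Proof. by rewrite !mformE !mxE; ring. Qed.
Lemma mformDr A u v w : mform A w (u + v) = mform A w u + mform A w v.
Proof. by rewrite !mformE !mxE; ring. Qed.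
Lemma mformZl A a v w : mform A (a *: v) w = a * mform A v w.
Proof. by rewrite !mformE !mxE; ring. Qed.
Lemma mformZr A a v w : mform A w (a *: v) = a * mform A w v.
Proof. by rewrite !mformE !mxE; ring. Qed.
Lemma mformNl A v w : mform A (- v) w = - mform A v w.
Proof. by rewrite !mformE !mxE; ring. Qed.
Lemma mformNr A v w : mform A w (- v) = - mform A w v.
Proof. by rewrite !mformE !mxE; ring. Qed.
Lemma mformZ A a v w : mform (a *: A) v w = a * mform A v w.
Proof. by rewrite !mformE !mxE; ring. Qed.

Definition mformL := (mformDl, mformDr, mformZl, mformZr, mformNl, mformNr).

Lemma orthonormal_mform A F : F *m A *m F^T = eta ->
  [/\ mform A (row 0 F) (row 0 F) = -1, mform A (row 0 F) (row 1 F) = 0,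
      mform A (row 1 F) (row 0 F) = 0 & mform A (row 1 F) (row 1 F) = 1].
Proof.
have E k l : mform A (row k F) (row l F) = (F *m A *m F^T) k l.
  by rewrite mformE !(mxE, sum2); ring.
by move=> FAF; rewrite !E FAF /eta !mxE.
Qed.

Lemma orthonormal_expand A F w : F *m A *m F^T = eta -> F \in unitmx ->
  w = - mform A w (row 0 F) *: row 0 F + mform A w (row 1 F) *: row 1 F.
Proof.
move=> FAF uF; have [h00 h01 h10 h11] := orthonormal_mform FAF.
have [c wE] : exists c : 'rV[R]_2, w = c 0 0 *: row 0 F + c 0 1 *: row 1 F.
  exists (w *m invmx F); rewrite -[LHS](mulmxKV uF); move: (w *m invmx F) => c.
  by apply/rowP => k; rewrite !mxE !sum2.
rewrite wE !mformL h00 h01 h10 h11 !mulr0 mulr1 mulrN1 addr0 add0r.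
by rewrite opprK.
Qed.

End Bilinear.

Section PlaneConnection.
Context {R : realType}.
Local Notation P := 'rV[R]_2.
Implicit Types (G : P -> 'M[R]_2) (x v w : P) (Y Z : P -> P).

(** [chr], [chrv] and [cov] are the chart-level versions of [christoffel], [chris_vec] and [covder],
    for a metric given as a function on the plane; [christoffelE], [chris_vecE] and [covderE]
    identify them. *)
Definition chr G (k l m : 'I_2) x : R :=
  2^-1 * \sum_(n < 2) invmx (G x) m n *
    ('D_(delta_mx 0 k) (fun y => G y l n) x + 'D_(delta_mx 0 l) (fun y => G y k n) x
     - 'D_(delta_mx 0 n) (fun y => G y k l) x).

Definition chrv G x v w : P :=
  \row_m \sum_(k < 2) \sum_(l < 2) chr G k l m x * v 0 k * w 0 l.

Definition cov G v Y x : P := 'D_v Y x + chrv G x v (Y x).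

Let contract (c : 'I_2 -> 'I_2 -> 'I_2 -> R) v w : P :=
  \row_m \sum_(k < 2) \sum_(l < 2) c k l m * v 0 k * w 0 l.

(** Metric compatibility as an identity between numbers: [A] is the metric, [dg] its partial
    derivatives, [y'] and [z'] the derivatives of [y] and [z], and the Christoffel symbols [c] are
    known only through their lowered form. With everything abstract the identity is polynomial. *)
Let metric_algebra (dg c : 'I_2 -> 'I_2 -> 'I_2 -> R) (A : 'M[R]_2) (v y z y' z' : P) :
  A 1 0 = A 0 1 -> (forall k, dg k 1 0 = dg k 0 1) ->
  (forall k l n, c k l 0 * A 0 n + c k l 1 * A 1 n =
    2^-1 * (dg k l n + dg l k n - dg n k l)) ->
  let d k l := v 0 0 * dg 0 k l + v 0 1 * dg 1 k l in
  let t k l := (y' 0 k * A k l + y 0 k * d k l) * z 0 l + y 0 k * A k l * z' 0 l in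
  t 0 0 + t 0 1 + (t 1 0 + t 1 1) =
  mform A (y' + contract c v y) z + mform A y (z' + contract c v z).
Proof.
move=> A10 dg10 low d t.
have lower u w : mform A (contract c v u) w = \sum_k \sum_l \sum_n v 0 k * u 0 l * w 0 n *
    (c k l 0 * A 0 n + c k l 1 * A 1 n).
  rewrite mformE !(mxE, sum2).
  by move: (v 0 0) (v 0 1) (u 0 0) (u 0 1) (w 0 0) (w 0 1) => *; ring.
have AT : A^T = A.
  by apply/matrixP; apply: ord2P; apply: ord2P; rewrite mxE ?A10.
rewrite !mformL (mformC y (contract c v z) AT) !lower !sum2 !low !mformE {low lower AT} /t /d !dg10 A10.
by field.
Qed.

Lemma chrvDl G x u v w : chrv G x (u + v) w = chrv G x u w + chrv G x v w.
Proof.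
by apply/rowP => m; rewrite !(mxE, sum2); move: (chr G) => c; ring.
Qed.
Lemma chrvDr G x u v w : chrv G x w (u + v) = chrv G x w u + chrv G x w v.
Proof.
by apply/rowP => m; rewrite !(mxE, sum2); move: (chr G) => c; ring.
Qed.
Lemma chrvZl G x a v w : chrv G x (a *: v) w = a *: chrv G x v w.
Proof.
by apply/rowP => m; rewrite !(mxE, sum2); move: (chr G) => c; ring.
Qed.
Lemma chrvZr G x a v w : chrv G x w (a *: v) = a *: chrv G x w v.
Proof.
by apply/rowP => m; rewrite !(mxE, sum2); move: (chr G) => c; ring.
Qed.

Lemma covDl G u v Y x : differentiable Y x ->
  cov G (u + v) Y x = cov G u Y x + cov G v Y x.
Proof. by move=> dY; rewrite /cov deriveDv // chrvDl addrACA. Qed.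

Lemma covZl G a v Y x : differentiable Y x -> cov G (a *: v) Y x = a *: cov G v Y x.
Proof. by move=> dY; rewrite /cov deriveZv // chrvZl scalerDr. Qed.

Lemma cov_add G v Y Z x : differentiable Y x -> differentiable Z x ->
  cov G v (fun y => Y y + Z y) x = cov G v Y x + cov G v Z x.
Proof.
move=> dY dZ; rewrite /cov chrvDr -addrACA; congr (_ + _).
by rewrite -deriveD //; exact: diff_derivable.
Qed.

Lemma cov_scale G v (f : P -> R) Y x : differentiable f x -> differentiable Y x ->
  cov G v (fun y => f y *: Y y) x = 'D_v f x *: Y x + f x *: cov G v Y x.
Proof. by move=> df dY; rewrite /cov derive_scale // chrvZr scalerDr addrA. Qed.

Lemma derive_entry_sym G k l x v : (\forall y \near x, (G y)^T = G y) ->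
  'D_v (fun y => G y k l) x = 'D_v (fun y => G y l k) x.
Proof.
by move=> sG; apply: near_eq_derive; near=> y; rewrite -[in LHS](near sG y) // mxE.
Unshelve. all: by end_near. Qed.

Lemma chr_sym G k l m x : (\forall y \near x, (G y)^T = G y) ->
  chr G k l m x = chr G l k m x.
Proof.
move=> sG; rewrite /chr; congr (_ * _); apply: eq_bigr => n _; congr (_ * _).
by rewrite (derive_entry_sym k l _ sG) [X in X - _]addrC.
Qed.

Lemma chrvC G x v w : (\forall y \near x, (G y)^T = G y) ->
  chrv G x v w = chrv G x w v.
Proof.
move=> sG; apply/rowP => m; rewrite !(mxE, sum2) (chr_sym 1 0 m sG); ring.
Qed.

Lemma cov_torsion_free G Y Z x : (\forall y \near x, (G y)^T = G y) ->
  cov G (Y x) Z x - cov G (Z x) Y x = 'D_(Y x) Z x - 'D_(Z x) Y x.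
Proof.
by move=> sG; rewrite /cov (chrvC _ _ sG) opprD addrACA subrr addr0.
Qed.

(** Contraction with the metric cancels [invmx (G x)] and leaves the Christoffel symbols of the
    first kind; symmetry of the inverse brings the indices into the order of a matrix product. *)
Lemma chr_lower G k l n x : (\forall y \near x, (G y)^T = G y) -> G x \in unitmx ->
  chr G k l 0 x * G x 0 n + chr G k l 1 x * G x 1 n =
  2^-1 * ('D_(delta_mx 0 k) (fun y => G y l n) x + 'D_(delta_mx 0 l) (fun y => G y k n) x
     - 'D_(delta_mx 0 n) (fun y => G y k l) x).
Proof.
move=> /nbhs_singleton sG uG; rewrite /chr.
have iT : (invmx (G x))^T = invmx (G x) by rewrite trmx_inv sG.
pose f (n : 'I_2) := ('D_(delta_mx 0 k) (fun y => G y l n) x +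
  'D_(delta_mx 0 l) (fun y => G y k n) x - 'D_(delta_mx 0 n) (fun y => G y k l) x).
have E : \sum_j f j * (invmx (G x) *m G x) j n = f n.
  rewrite mulVmx // (bigD1 n) //= big1 ?addr0 => [|j jn]; rewrite mxE ?eqxx ?mulr1 //.
  by rewrite (negbTE jn) mulr0.
rewrite -/(f n) -E !sum2 -/(f 0) -/(f 1) !(mxE, sum2).
have -> : invmx (G x) 1 0 = invmx (G x) 0 1 by rewrite -[in LHS]iT mxE.
by move: (f 0) (f 1) (invmx (G x)) (G x) => *; ring.
Qed.

Lemma cov_metric G Y Z x v : (\forall y \near x, (G y)^T = G y) ->
  G x \in unitmx -> differentiable G x -> differentiable Y x -> differentiable Z x ->
  'D_v (fun y => mform (G y) (Y y) (Z y)) x =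
    mform (G x) (cov G v Y x) (Z x) + mform (G x) (Y x) (cov G v Z x).
Proof.
move=> sG uG dG dY dZ.
have isG k l : is_derive x v (fun y => G y k l) ('D_v (fun y => G y k l) x).
  by apply: is_derive_diff; exact: differentiable_entry.
have isY k : is_derive x v (fun y => Y y 0 k) ('D_v Y x 0 k).
  by rewrite derive_entry //; apply: is_derive_diff; exact: differentiable_entry.
have isZ k : is_derive x v (fun y => Z y 0 k) ('D_v Z x 0 k).
  by rewrite derive_entry //; apply: is_derive_diff; exact: differentiable_entry.
have -> : (fun y => mform (G y) (Y y) (Z y)) = (fun y =>
  Y y 0 0 * G y 0 0 * Z y 0 0 + Y y 0 0 * G y 0 1 * Z y 0 1 +
  (Y y 0 1 * G y 1 0 * Z y 0 0 + Y y 0 1 * G y 1 1 * Z y 0 1)).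
  by apply/funext => y; rewrite mformE.
have D3 k l := is_derive_mul (is_derive_mul (isY k) (isG k l)) (isZ l).
have Dall := is_derive_add (is_derive_add (D3 0 0) (D3 0 1))
  (is_derive_add (D3 1 0) (D3 1 1)).
rewrite (@derive_val _ _ _ _ _ _ _ Dall) {Dall D3 isG isY isZ}.
have DG k l : 'D_v (fun y => G y k l) x =
    v 0 0 * 'D_(delta_mx 0 0) (fun y => G y k l) x +
    v 0 1 * 'D_(delta_mx 0 1) (fun y => G y k l) x.
  by rewrite derive_row ?sum2 //; exact: differentiable_entry.
have G10 : G x 1 0 = G x 0 1 by rewrite -[in LHS](nbhs_singleton sG) mxE.
have dG10 k := derive_entry_sym 1 0 (delta_mx 0 k) sG.
rewrite !DG.
exact: (@metric_algebra (fun k l n => 'D_(delta_mx 0 k) (fun y => G y l n) x)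
  (fun k l m => chr G k l m x) _ _ _ _ _ _ G10 dG10 (fun k l n => chr_lower k l n sG uG)).
Qed.

End PlaneConnection.

(** * Linear algebra of orthonormal and null frames *)

Section Frames.
Context {R : realType}.
Local Notation P := 'rV[R]_2.
Implicit Types (A F : 'M[R]_2) (v w p q : P).

Lemma orthonormal_unit A F : F *m A *m F^T = eta -> F \in unitmx /\ A \in unitmx.
Proof.
move=> FAF; have : \det F * \det A * \det F = -1.
  rewrite -{2}(det_tr F) -!det_mulmx FAF /eta det_diag.
  by rewrite !big_ord_recl big_ord0 !mxE /= !mulr1.
rewrite !unitmxE !unitfE => dFA; split; apply/eqP => d0; move: dFA;
  by rewrite d0 ?(mulr0, mul0r) => /eqP; rewrite eq_sym oppr_eq0 oner_eq0.
Qed.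

(** The determinant with rows [p] and [q], from which Cramer's rule and linear independence are
    drawn. *)
Definition wedge p q : R := p 0 0 * q 0 1 - p 0 1 * q 0 0.

Lemma wedge_expand p q w : wedge p q != 0 ->
  w = (wedge w q / wedge p q) *: p + (wedge p w / wedge p q) *: q.
Proof.
rewrite /wedge => d0; apply: row2P; rewrite !mxE.
  by move: (p 0 0) (p 0 1) (q 0 0) (q 0 1) (w 0 0) (w 0 1) d0 => *; field.
by move: (p 0 0) (p 0 1) (q 0 0) (q 0 1) (w 0 0) (w 0 1) d0 => *; field.
Qed.

(** The Gram determinant of [p] and [q] equals [wedge p q ^+ 2 * \det A]; for null vectors it is
    minus the square of their product, hence nonzero. *)
Lemma null_wedge A p q : A^T = A -> mform A p p = 0 -> mform A q q = 0 ->
  mform A p q != 0 -> wedge p q != 0.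
Proof.
move=> AT pp qq pq0; apply/eqP => d0.
have : wedge p q ^+ 2 * (A 0 0 * A 1 1 - A 0 1 * A 1 0) =
    mform A p p * mform A q q - mform A p q * mform A q p.
  by rewrite !mformE /wedge; ring.
rewrite d0 pp (mformC q p AT) expr2 !mul0r sub0r => /esym/eqP.
by rewrite oppr_eq0 mulf_eq0 (negbTE pq0).
Qed.

Lemma null_expand A p q w : A^T = A -> mform A p p = 0 -> mform A q q = 0 ->
  mform A p q != 0 ->
  w = (mform A w q / mform A p q) *: p + (mform A w p / mform A p q) *: q.
Proof.
move=> AT pp qq pq0; have wE := wedge_expand w (null_wedge AT pp qq pq0).
move: (_ / _) (_ / wedge p q) wE => a b ->.
by rewrite !mformL pp qq (mformC q p AT) !mulr0 addr0 add0r !mulfK.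
Qed.

Lemma wedge_eq0 p q (a b : R) : wedge p q != 0 ->
  a * p 0 0 + b * p 0 1 = 0 -> a * q 0 0 + b * q 0 1 = 0 -> a = 0 /\ b = 0.
Proof.
rewrite /wedge => d0 hp hq; split; apply/eqP.
  have : a * wedge p q = (a * p 0 0 + b * p 0 1) * q 0 1 - (a * q 0 0 + b * q 0 1) * p 0 1.
    by rewrite /wedge; ring.
  by rewrite hp hq !mul0r subrr => /eqP; rewrite mulf_eq0 (negbTE d0) orbF.
have : b * wedge p q = (a * q 0 0 + b * q 0 1) * p 0 0 - (a * p 0 0 + b * p 0 1) * q 0 0.
  by rewrite /wedge; ring.
by rewrite hp hq !mul0r subrr => /eqP; rewrite mulf_eq0 (negbTE d0) orbF.
Qed.

Lemma comb_inj p q (a b a' b' : R) : wedge p q != 0 ->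
  a *: p + b *: q = a' *: p + b' *: q -> a = a' /\ b = b'.
Proof.
move=> d0 E.
have E0 : (a *: p + b *: q) 0 0 = (a' *: p + b' *: q) 0 0 by rewrite E.
have E1 : (a *: p + b *: q) 0 1 = (a' *: p + b' *: q) 0 1 by rewrite E.
rewrite !mxE in E0 E1.
(* The two coordinates of the equation pair the coefficients with the columns of the matrix of rows
   [p], [q]. So the matrix is transposed before [wedge_eq0] is applied, which preserves the
   determinant. *)
pose r := (\row_k (if k == 0 then p 0 0 else q 0 0)) : P.
pose s := (\row_k (if k == 0 then p 0 1 else q 0 1)) : P.
have d1 : wedge r s != 0.
  by move: d0; rewrite /wedge !mxE /= [q 0 0 * _]mulrC.
have [] := @wedge_eq0 r s (a - a') (b - b') d1; rewrite ?mxE /=.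
- by apply/eqP; rewrite -(subr_eq0) in E0 *; move: (p 0 0) (q 0 0) E0 => ? ? E0; apply/eqP; rewrite subr0 !mulrBl; lra.
- by move: (p 0 1) (q 0 1) E1 => ? ? E1; rewrite !mulrBl; lra.
by move=> /eqP; rewrite subr_eq0 => /eqP -> /eqP; rewrite subr_eq0 => /eqP ->.
Qed.

End Frames.

(** * Covariant derivatives of a rescaled null frame *)

Section NullFrame.
Context {R : realType}.
Local Notation P := 'rV[R]_2.
Variables (G S : P -> 'M[R]_2) (x : P).
Hypothesis G_sym : \forall y \near x, (G y)^T = G y.
Hypothesis G_diff : differentiable G x.
Hypothesis S_diff : differentiable S x.
Hypothesis S_orthonormal : \forall y \near x, S y *m G y *m (S y)^T = eta.

Let s k y := row k (S y).
Let omega v := mform (G x) (cov G v (s 0) x) (s 1 x).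

Let s_diff k : differentiable (s k) x.
Proof.
apply: differentiable_entries => i j.
have -> : (fun y => s k y i j) = (fun y => S y k j).
  by apply/funext => y; rewrite /s mxE.
exact: differentiable_entry.
Qed.

(** Differentiating the constant products -1, 0, 1 leaves each covariant derivative only its
    component along the other frame vector. The mixed product ties these two components together,
    and the signature makes their coefficients equal rather than opposite. *)
Lemma frame_cov v :
  cov G v (s 0) x = omega v *: s 1 x /\ cov G v (s 1) x = omega v *: s 0 x.
Proof.
have SGS := nbhs_singleton S_orthonormal.
have [uS uG] := orthonormal_unit SGS.
have GT := nbhs_singleton G_sym.
have D k l (c : R) : (\forall y \near x, mform (G y) (s k y) (s l y) = c) ->
    mform (G x) (cov G v (s k) x) (s l x) + mform (G x) (s k x) (cov G v (s l) x) = 0.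
  move=> kl; rewrite -cov_metric //.
  by rewrite (near_eq_derive _ (g := cst c)) ?derive_cst.
have h00 : mform (G x) (cov G v (s 0) x) (s 0 x) = 0.
  have := D 0 0 (-1); rewrite (mformC (s 0 x)) // -mulr2n => h.
  suff /eqP : mform (G x) (cov G v (s 0) x) (s 0 x) *+ 2 = 0 by rewrite mulrn_eq0 => /eqP.
  by apply: h; near=> y; have [] := orthonormal_mform (near S_orthonormal y _).
have h11 : mform (G x) (cov G v (s 1) x) (s 1 x) = 0.
  have := D 1 1 1; rewrite (mformC (s 1 x)) // -mulr2n => h.
  suff /eqP : mform (G x) (cov G v (s 1) x) (s 1 x) *+ 2 = 0 by rewrite mulrn_eq0 => /eqP.
  by apply: h; near=> y; have [] := orthonormal_mform (near S_orthonormal y _).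
have h10 : mform (G x) (cov G v (s 1) x) (s 0 x) = - omega v.
  have := D 0 1 0; rewrite -/(omega v) (mformC (s 0 x)) // => h; apply/eqP.
  rewrite -addr_eq0 addrC h //.
  by near=> y; have [] := orthonormal_mform (near S_orthonormal y _).
split; rewrite [LHS](orthonormal_expand _ SGS uS) -/(s 0 x) -/(s 1 x).
  by rewrite h00 -/(omega v) oppr0 scale0r add0r.
by rewrite h11 h10 opprK scale0r addr0.
Unshelve. all: by end_near. Qed.

(** These will be the functions ε |f_+|^2 and ε |f_-|^2; [f1_eq] and [f2_eq] below are then the
    twistor equations, passed on to squared moduli. *)
Variables (f1 f2 : P -> R).
Hypotheses (f1_diff : differentiable f1 x) (f2_diff : differentiable f2 x).
Hypotheses (f1_neq0 : f1 x != 0) (f2_neq0 : f2 x != 0).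
Let np y := s 0 y + s 1 y.
Let nm y := s 0 y - s 1 y.
Let Np y := f1 y *: np y.
Let Nm y := f2 y *: nm y.
Let Om y := f1 y * f2 y.
Hypothesis f1_eq : 'D_(nm x) f1 x = - (omega (nm x) * f1 x).
Hypothesis f2_eq : 'D_(np x) f2 x = omega (np x) * f2 x.

Let np_diff : differentiable np x. Proof. exact: differentiableD. Qed.
Let nm_diff : differentiable nm x. Proof. exact: differentiableB. Qed.

Lemma cov_Np v : cov G v Np x = ('D_v f1 x + f1 x * omega v) *: np x.
Proof.
rewrite cov_scale // scalerDl -scalerA cov_add //.
by have [-> ->] := frame_cov v; rewrite -scalerDr [s 1 x + _]addrC.
Qed.

Lemma cov_Nm v : cov G v Nm x = ('D_v f2 x - f2 x * omega v) *: nm x.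
Proof.
rewrite cov_scale // scalerBl -scalerA -scalerN.
have -> : cov G v nm x = cov G v (s 0) x - cov G v (s 1) x.
  have -> : nm = (fun y => s 0 y + (-1) *: s 1 y).
    by apply/funext => y; rewrite scaleN1r.
  rewrite cov_add //; last exact: differentiableZ.
  rewrite (@cov_scale _ _ _ (cst (-1)) (s 1)) // derive_cst scale0r add0r.
  by rewrite scaleN1r.
have [-> ->] := frame_cov v; rewrite -scalerBr -scalerN opprB.
by [].
Qed.

(** For the last two equalities [omega] is eliminated through the other factor: [f2_eq] makes
    [omega (Np x)] the logarithmic derivative of [f2], which adds up with that of [f1] to the one of
    [Om]; the roles are exchanged along [Nm]. *)
Lemma null_frame_cov :
  [/\ cov G (Nm x) Np x = 0, cov G (Np x) Nm x = 0,
      cov G (Np x) Np x = ('D_(Np x) Om x / Om x) *: Np x &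
      cov G (Nm x) Nm x = ('D_(Nm x) Om x / Om x) *: Nm x].
Proof.
have aux1 (d o a b : R) : a != 0 -> b != 0 ->
    d + a * o = (d * b + a * (o * b)) / (a * b) * a.
  by move=> a0 b0; field; rewrite a0 b0.
have aux2 (d o a b : R) : a != 0 -> b != 0 ->
    d - b * o = (- (o * a) * b + a * d) / (a * b) * b.
  by move=> a0 b0; field; rewrite a0 b0.
have omegaZ a v : omega (a *: v) = a * omega v by rewrite /omega covZl // mformZl.
have e1 : 'D_(Nm x) f1 x = - (omega (Nm x) * f1 x).
  by rewrite deriveZv // f1_eq omegaZ scalerN -mulrA.
have e2 : 'D_(Np x) f2 x = omega (Np x) * f2 x.
  by rewrite deriveZv // f2_eq omegaZ -mulrA.
rewrite !cov_Np !cov_Nm; split.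
- by rewrite e1 [omega _ * _]mulrC addNr scale0r.
- by rewrite e2 [omega _ * _]mulrC subrr scale0r.
- rewrite /Np scalerA; congr (_ *: _); rewrite -/(Np x) derive_mul // e2 /Om.
  exact: aux1.
- rewrite /Nm scalerA; congr (_ *: _); rewrite -/(Nm x) derive_mul // e1 /Om.
  exact: aux2.
Qed.

End NullFrame.

(** * Flatness from a commuting null frame of constant product *)

Section PlaneFlat.
Context {R : realType}.
Local Notation P := 'rV[R]_2.
Local Notation e_ k := (delta_mx 0 k : P).

Definition riem (G : P -> 'M[R]_2) (k l m n : 'I_2) (x : P) : R :=
  'D_(e_ k) (chr G l m n) x - 'D_(e_ l) (chr G k m n) x
  + \sum_(a < 2) (chr G k a n x * chr G l m a x - chr G l a n x * chr G k m a x).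

Variables (U : set P) (H : P -> 'M[R]_2) (p q : P -> P).
Hypothesis oU : open U.
Hypothesis H_diff : forall x, U x -> differentiable H x.
Hypothesis H_sym : forall x, U x -> (H x)^T = H x.
Hypothesis H_unit : forall x, U x -> H x \in unitmx.
Hypothesis p_smooth : forall k, smooth_on U (fun x => p x 0 k).
Hypothesis q_smooth : forall k, smooth_on U (fun x => q x 0 k).
Hypothesis pp : forall x, U x -> mform (H x) (p x) (p x) = 0.
Hypothesis qq : forall x, U x -> mform (H x) (q x) (q x) = 0.
Hypothesis pq : forall x, U x -> mform (H x) (p x) (q x) = -2.
Hypothesis bracket0 : forall x, U x -> 'D_(p x) q x = 'D_(q x) p x.

Let nearU x : U x -> \forall y \near x, U y.
Proof. by move=> Ux; exact: open_nbhs_nbhs. Qed.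

Let p_diff x : U x -> differentiable p x.
Proof.
move=> Ux; apply: differentiable_entries => i k; rewrite ord1.
exact: smooth_on_differentiable (p_smooth k) Ux.
Qed.

Let q_diff x : U x -> differentiable q x.
Proof.
move=> Ux; apply: differentiable_entries => i k; rewrite ord1.
exact: smooth_on_differentiable (q_smooth k) Ux.
Qed.

Let pq0 x : U x -> mform (H x) (p x) (q x) != 0.
Proof. by move=> Ux; rewrite pq // oppr_eq0 pnatr_eq0. Qed.

Let wpq x : U x -> wedge (p x) (q x) != 0.
Proof. by move=> Ux; apply: (@null_wedge _ (H x)); auto. Qed.

(** Constancy of the three products forces [cov H w p x = al w *: p x] and
    [cov H w q x = - al w *: q x]. Zero torsion and zero bracket then give
    [- al p *: q = al q *: p], so the one-form [al] vanishes on a basis. *)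
Lemma null_parallel x v : U x -> cov H v p x = 0 /\ cov H v q x = 0.
Proof.
move=> Ux; have sH : \forall y \near x, (H y)^T = H y.
  by near=> y; apply: H_sym; near: y; exact: nearU.
have D (Y Z : P -> P) (c : R) : differentiable Y x -> differentiable Z x ->
    (forall y, U y -> mform (H y) (Y y) (Z y) = c) -> forall w,
    mform (H x) (cov H w Y x) (Z x) + mform (H x) (Y x) (cov H w Z x) = 0.
  move=> dY dZ YZ w; rewrite -cov_metric //; [|exact: H_unit|exact: H_diff].
  rewrite (near_eq_derive _ (g := cst c)) ?derive_cst //.
  by near=> y; apply: YZ; near: y; exact: nearU.
have HT := H_sym Ux; have dp := p_diff Ux; have dq := q_diff Ux.
have hpp w : mform (H x) (cov H w p x) (p x) = 0.
  have := D p p 0 dp dp pp w; rewrite (mformC (p x)) // -mulr2n => /eqP.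
  by rewrite mulrn_eq0 => /eqP.
have hqq w : mform (H x) (cov H w q x) (q x) = 0.
  have := D q q 0 dq dq qq w; rewrite (mformC (q x)) // -mulr2n => /eqP.
  by rewrite mulrn_eq0 => /eqP.
pose al w := mform (H x) (cov H w p x) (q x) / mform (H x) (p x) (q x).
have alD a b u w : al (a *: u + b *: w) = a * al u + b * al w.
  by rewrite /al covDl // !covZl // !mformL mulrDl !mulrA.
have covp w : cov H w p x = al w *: p x.
  rewrite {1}(null_expand (cov H w p x) HT (pp Ux) (qq Ux) (pq0 Ux)).
  by rewrite hpp mul0r scale0r addr0.
have covq w : cov H w q x = - al w *: q x.
  rewrite {1}(null_expand (cov H w q x) HT (pp Ux) (qq Ux) (pq0 Ux)).
  rewrite hqq mul0r scale0r add0r; congr (_ *: _); rewrite /al -mulNr; congr (_ / _).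
  apply/eqP; rewrite -addr_eq0 addrC (mformC _ (p x)) //; apply/eqP.
  exact: D dp dq pq w.
have /eqP : cov H (p x) q x - cov H (q x) p x = 0.
  by rewrite cov_torsion_free // bracket0 // subrr.
rewrite subr_eq0 covp covq => /eqP E.
have [a0 b0] : al (q x) = 0 /\ al (p x) = 0.
  by apply: (comb_inj (wpq Ux)); rewrite !scale0r addr0 -E scaleNr addNr.
have al0 : al v = 0.
  have vE := wedge_expand v (wpq Ux); move: (_ / _) (_ / wedge _ _) vE => a b ->.
  by rewrite alD a0 b0 !mulr0 addr0.
by rewrite covp covq al0 oppr0 !scale0r.
Unshelve. all: by end_near. Qed.

Let chr_eq (N : P -> P) x k n : (forall v, cov H v N x = 0) -> differentiable N x ->
  'D_(e_ k) (fun y => N y 0 n) x =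
  - (chr H k 0 n x * N x 0 0 + chr H k 1 n x * N x 0 1).
Proof.
move=> /(_ (e_ k)) covN dN; have := congr1 (fun w : P => w 0 n) covN.
rewrite /cov !mxE derive_entry // => /eqP; rewrite addr_eq0 => /eqP ->; congr (- _).
move: (chr H) => c; rewrite !sum2 !mxE /=.
by move: k {covN}; apply: ord2P; rewrite /= ?mulr1 ?mulr0 ?mul0r ?addr0 ?add0r.
Qed.

(** [H] is assumed differentiable once, while the symbols already contain its first derivatives.
    They are recovered from the parallel frame instead: the equations for [p] and [q] determine them
    by Cramer's rule as rational expressions in [p], [q] and their first derivatives, which are
    smooth. *)
Lemma chr_diff x k l n : U x -> differentiable (chr H k l n) x.
Proof.
move=> Ux; pose D y := wedge (p y) (q y).
pose Dp y := 'D_(e_ k) (fun y => p y 0 n) y.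
pose Dq y := 'D_(e_ k) (fun y => q y 0 n) y.
have l01 : l = 0 \/ l = 1 by move: (l); apply: ord2P; [left|right].
(* The index other than [l]; [sg] is the sign that Cramer's rule gives to its cofactor. *)
pose l' : 'I_2 := if l == 0 then 1 else 0.
pose sg : R := if l == 0 then -1 else 1.
apply: (@near_eq_differentiable _ _ _
    (fun y => sg * (Dp y * q y 0 l' - Dq y * p y 0 l') / D y)).
  near=> y; have Uy : U y by near: y; exact: nearU.
  have covp v := (null_parallel v Uy).1; have covq v := (null_parallel v Uy).2.
  have := wpq Uy; rewrite -/(D y) => D0.
  apply: (mulIf D0); rewrite divfK // /Dp /Dq.
  rewrite (chr_eq k n covp (p_diff Uy)) (chr_eq k n covq (q_diff Uy)) /D /wedge.
  move: (chr H k) (p y 0) (q y 0) => c p' q'; rewrite /sg /l'.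
  by case: l01 => -> /=; ring.
have dw : differentiable D x.
  have sp k' := smooth_on_differentiable (p_smooth k') Ux.
  have sq k' := smooth_on_differentiable (q_smooth k') Ux.
  by apply: differentiableB; apply: differentiableM.
have sp k' := smooth_on_differentiable (p_smooth k') Ux.
have sq k' := smooth_on_differentiable (q_smooth k') Ux.
have dDp : differentiable Dp x.
  exact: smooth_on_differentiable (smooth_on_derive _ (p_smooth n)) Ux.
have dDq : differentiable Dq x.
  exact: smooth_on_differentiable (smooth_on_derive _ (q_smooth n)) Ux.
apply: (@differentiableM _ _ (fun y => sg * (Dp y * q y 0 l' - Dq y * p y 0 l'))
  (fun y => (D y)^-1)); last by apply: differentiableV => //; exact: wpq.
apply: (@differentiableM _ _ (cst sg)); first exact: differentiable_cst.
by apply: differentiableB; apply: differentiableM.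
Unshelve. all: by end_near. Qed.

Let riem_algebra (c : 'I_2 -> 'I_2 -> 'I_2 -> R) k l n (a0 a1 b0 b1 n0 n1 : R) :
  - (a0 * n0 + c l 0 n * - (c k 0 0 * n0 + c k 1 0 * n1) +
     (a1 * n1 + c l 1 n * - (c k 0 1 * n0 + c k 1 1 * n1))) =
  - (b0 * n0 + c k 0 n * - (c l 0 0 * n0 + c l 1 0 * n1) +
     (b1 * n1 + c k 1 n * - (c l 0 1 * n0 + c l 1 1 * n1))) ->
  (a0 - b0 + (c k 0 n * c l 0 0 - c l 0 n * c k 0 0 +
     (c k 1 n * c l 0 1 - c l 1 n * c k 0 1))) * n0 +
  (a1 - b1 + (c k 0 n * c l 1 0 - c l 0 n * c k 1 0 +
     (c k 1 n * c l 1 1 - c l 1 n * c k 1 1))) * n1 = 0.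
Proof.
move=> E; transitivity (
  - (b0 * n0 + c k 0 n * - (c l 0 0 * n0 + c l 1 0 * n1) +
     (b1 * n1 + c k 1 n * - (c l 0 1 * n0 + c l 1 1 * n1))) +
    (a0 * n0 + c l 0 n * - (c k 0 0 * n0 + c k 1 0 * n1) +
     (a1 * n1 + c l 1 n * - (c k 0 1 * n0 + c k 1 1 * n1)))).
  by ring.
by rewrite -E addNr.
Qed.

(** For a parallel field the partial derivatives of [N] are [- Γ N]. Differentiating once more,
    symmetry of the second derivatives leaves exactly the curvature applied to [N]. *)
Let riem_contract (N : P -> P) x k l n : (forall y v, U y -> cov H v N y = 0) ->
  (forall j, smooth_on U (fun y => N y 0 j)) -> U x ->
  riem H k l 0 n x * N x 0 0 + riem H k l 1 n x * N x 0 1 = 0.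
Proof.
move=> covN sN Ux.
have dN y : U y -> differentiable N y.
  move=> Uy; apply: differentiable_entries => i j; rewrite ord1.
  exact: smooth_on_differentiable (sN j) Uy.
have D2 a b : 'D_(e_ a) ('D_(e_ b) (fun y => N y 0 n)) x =
    - ('D_(e_ a) (chr H b 0 n) x * N x 0 0
       + chr H b 0 n x * - (chr H a 0 0 x * N x 0 0 + chr H a 1 0 x * N x 0 1)
     + ('D_(e_ a) (chr H b 1 n) x * N x 0 1
       + chr H b 1 n x * - (chr H a 0 1 x * N x 0 0 + chr H a 1 1 x * N x 0 1))).
  rewrite (near_eq_derive _
    (g := fun y => - (chr H b 0 n y * N y 0 0 + chr H b 1 n y * N y 0 1))); last first.
    near=> y; have Uy : U y by near: y; exact: nearU.
    by apply: chr_eq => [v|]; [exact: covN|exact: dN].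
  have isc j : is_derive x (e_ a) (chr H b j n) _ := is_derive_diff (e_ a) (chr_diff b j n Ux).
  have isN j : is_derive x (e_ a) (fun y => N y 0 j)
      (- (chr H a 0 j x * N x 0 0 + chr H a 1 j x * N x 0 1)).
    rewrite -chr_eq; [|by move=> v; exact: covN|exact: dN].
    by apply: is_derive_diff; exact: smooth_on_differentiable (sN j) Ux.
  have E := is_derive_opp (is_derive_add (is_derive_mul (isc 0) (isN 0))
    (is_derive_mul (isc 1) (isN 1))).
  by rewrite (@derive_val _ _ _ _ _ _ _ E).
have := derive_comm (e_ k) (e_ l) oU (sN n) Ux; rewrite !D2 /riem !sum2.
exact: (@riem_algebra (fun k l m => chr H k l m x)).
Unshelve. all: by end_near. Qed.

Lemma null_flat x k l m n : U x -> riem H k l m n x = 0.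
Proof.
move=> Ux.
have hp := riem_contract k l n (fun y v Uy => (null_parallel v Uy).1) p_smooth Ux.
have hq := riem_contract k l n (fun y v Uy => (null_parallel v Uy).2) q_smooth Ux.
have [h0 h1] := wedge_eq0 (wpq Ux) hp hq.
by move: m; apply: ord2P.
Qed.

End PlaneFlat.

(** * Surfaces with a null frame *)

Section Charts.
Context {R : realType} {M : surface R}.
Implicit Types (i j : chart M) (p : M) (x y : 'rV[R]_2) (g : chart M -> M -> 'M[R]_2).

Definition cimg i : set 'rV[R]_2 := coord i @` cdom i.

Lemma cimg_coord i p : cdom i p -> cimg i (coord i p).
Proof. by move=> ip; exists p. Qed.

Lemma cimg_param i x : cimg i x -> cdom i (param i x) /\ coord i (param i x) = x.
Proof. by move=> [p ip <-]; rewrite coordK. Qed.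

Lemma cimgP (P : 'rV[R]_2 -> Prop) i : (forall p, cdom i p -> P (coord i p)) ->
  forall x, cimg i x -> P x.
Proof. by move=> HP _ [p ip <-]; exact: HP. Qed.

Lemma coord_cts i p : cdom i p -> {for p, continuous (coord i)}.
Proof.
move=> ip; have := @Defs.coord_continuous _ M i.
by rewrite continuous_open_subspace; [apply; rewrite inE|exact: cdom_open].
Qed.

Lemma param_cts i x : cimg i x -> {for x, continuous (param i)}.
Proof.
move=> ix; have := @param_continuous _ M i.
by rewrite continuous_open_subspace; [apply; rewrite inE|exact: cimg_open].
Qed.

Lemma near_cdom i p : cdom i p -> \forall q \near p, cdom i q.
Proof. by move=> ip; apply: open_nbhs_nbhs; split=> //; exact: cdom_open. Qed.

Lemma near_cimg i x : cimg i x -> \forall y \near x, cimg i y.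
Proof. by move=> ix; apply: open_nbhs_nbhs; split=> //; exact: cimg_open. Qed.

Lemma near_param i p (P : set M) : cdom i p -> (\forall q \near p, P q) ->
  \forall y \near coord i p, P (param i y).
Proof.
move=> ip pP; have := param_cts (cimg_coord ip) => /(_ P); apply.
by rewrite /= coordK.
Qed.

Lemma open_chart_img i (A : set M) : open A -> open (coord i @` (A `&` cdom i)).
Proof.
move=> oA; rewrite openE => _ [p [Ap ip] <-].
have h1 : \forall y \near coord i p, A (param i y).
  by apply: near_param ip _; exact: open_nbhs_nbhs.
have h2 := near_cimg (cimg_coord ip).
near=> y; have iy : cimg i y by near: y.
have Ay : A (param i y) by near: y.
by have [iy1 iy2] := cimg_param iy; exists (param i y).
Unshelve. all: by end_near. Qed.

Lemma transition_diff i j p : cdom i p -> cdom j p ->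
  differentiable (coord j \o param i) (coord i p).
Proof.
move=> ip jp; apply: smooth_on_differentiable (@transition_smooth _ M i j) _.
by exists p.
Qed.

Lemma transition_near i j p : cdom i p -> cdom j p ->
  \forall x \near coord i p, param j ((coord j \o param i) x) = param i x.
Proof.
move=> ip jp.
apply: (near_param ip (P := fun q => param j (coord j q) = q)).
by apply: filterS (near_cdom jp) => q jq; rewrite coordK.
Qed.

Lemma tder_chart (f : M -> R) i j p (v : 'rV[R]_2) : cdom i p -> cdom j p ->
  differentiable (f \o param j) (coord j p) ->
  'D_v (f \o param i) (coord i p) = 'D_(v *m tjac i j p) (f \o param j) (coord j p).
Proof.
move=> ip jp df; have dt := transition_diff ip jp.
have E : (coord j \o param i) (coord i p) = coord j p by rewrite /= coordK.
rewrite (near_eq_derive _ (g := (f \o param j) \o (coord j \o param i))); last first.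
  near=> x; rewrite /= -[in LHS](near (transition_near ip jp) x) //.
rewrite -E in df.
rewrite deriveE; last exact: differentiable_comp.
rewrite diff_comp //= -[X in 'd _ _ X]deriveE // deriveEjacobian //.
by rewrite -deriveE // -[in RHS]E.
Unshelve. all: by end_near. Qed.

Lemma christoffelE g i k l m p : cdom i p ->
  christoffel g i k l m p = chr (g i \o param i) k l m (coord i p).
Proof. by move=> ip; rewrite /christoffel /chr /= coordK. Qed.

Lemma chris_vecE g i p v w : cdom i p ->
  chris_vec g i p v w = chrv (g i \o param i) (coord i p) v w.
Proof.
move=> ip; apply/rowP => m; rewrite !mxE.
by apply: eq_bigr => k _; apply: eq_bigr => l _; rewrite christoffelE.
Qed.

Lemma covderE g i v (Y : M -> 'rV[R]_2) p : cdom i p ->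
  covder g i v Y p = cov (g i \o param i) v (Y \o param i) (coord i p).
Proof. by move=> ip; rewrite /covder /cov chris_vecE //= coordK. Qed.

Lemma riemannE g i k l m n p : cdom i p ->
  riemann g i k l m n p = riem (g i \o param i) k l m n (coord i p).
Proof.
move=> ip; have E k' l' m' (v : 'rV[R]_2) : tder i v (christoffel g i k' l' m') p =
    'D_v (chr (g i \o param i) k' l' m') (coord i p).
  apply: near_eq_derive; near=> x.
  have ix : cimg i x by near: x; exact: near_cimg (cimg_coord ip).
  by have [h1 h2] := cimg_param ix; rewrite /= christoffelE // h2.
rewrite /riemann /riem /pder !E; congr (_ + _).
by apply: eq_bigr => a _; rewrite !christoffelE.
Unshelve. all: by end_near. Qed.

End Charts.

Section NullFrameSurface.
Context {R : realType} {M : surface R}.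
Variables (g : chart M -> M -> 'M[R]_2).
Hypothesis lg : is_lorentzian g.

(** The interface between spinors and geometry: [Np], [Nm] and [Om] stand for N_+, N_- and Ω, and
    both conformal flatness and completeness are derived from a Lorentzian metric with such a
    frame. *)
Record null_frame (Np Nm : chart M -> M -> 'rV[R]_2) (Om : M -> R) : Prop := NullFrame {
  nf_smooth_p : forall i k, smooth_on (cimg i) (fun y => Np i (param i y) 0 k) ;
  nf_smooth_m : forall i k, smooth_on (cimg i) (fun y => Nm i (param i y) 0 k) ;
  nf_smooth_Om : forall i, smooth_on (cimg i) (Om \o param i) ;
  nf_Om_gt0 : forall p, 0 < Om p ;
  nf_compat_p : forall i j p, cdom i p -> cdom j p -> Np j p = Np i p *m tjac i j p ;
  nf_compat_m : forall i j p, cdom i p -> cdom j p -> Nm j p = Nm i p *m tjac i j p ;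
  nf_pp : forall i p, cdom i p -> mform (g i p) (Np i p) (Np i p) = 0 ;
  nf_mm : forall i p, cdom i p -> mform (g i p) (Nm i p) (Nm i p) = 0 ;
  nf_pm : forall i p, cdom i p -> mform (g i p) (Np i p) (Nm i p) = - 2 * Om p ;
  nf_cov_mp : forall i p, cdom i p -> covder g i (Nm i p) (Np i) p = 0 ;
  nf_cov_pm : forall i p, cdom i p -> covder g i (Np i p) (Nm i) p = 0 ;
  nf_cov_pp : forall i p, cdom i p ->
    covder g i (Np i p) (Np i) p = (tder i (Np i p) Om p / Om p) *: Np i p ;
  nf_cov_mm : forall i p, cdom i p ->
    covder g i (Nm i p) (Nm i) p = (tder i (Nm i p) Om p / Om p) *: Nm i p
}.

Lemma lorentzian_unit i p : cdom i p -> g i p \in unitmx.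
Proof.
by move=> ip; have [F _ FgF] := metric_signature lg ip; have [] := orthonormal_unit FgF.
Qed.

Lemma metric_diff i p : cdom i p -> differentiable (g i \o param i) (coord i p).
Proof.
by move=> ip; apply: smooth_on_differentiable (metric_smooth lg i) (cimg_coord ip).
Qed.

Lemma metric_sym_near i p : cdom i p ->
  \forall y \near coord i p, ((g i \o param i) y)^T = (g i \o param i) y.
Proof.
move=> ip; apply: (near_param ip (P := fun q => (g i q)^T = g i q)).
by apply: filterS (near_cdom ip) => q iq; exact: (metric_sym lg iq).
Qed.

Variables (Np Nm : chart M -> M -> 'rV[R]_2) (Om : M -> R).
Hypothesis nf : null_frame Np Nm Om.

Lemma nf_wedge i p : cdom i p -> wedge (Np i p) (Nm i p) != 0.
Proof.
move=> ip; apply: (@null_wedge _ (g i p)).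
- exact: (metric_sym lg ip).
- exact: (nf_pp nf ip).
- exact: (nf_mm nf ip).
- by rewrite (nf_pm nf ip) mulf_neq0 ?oppr_eq0 ?pnatr_eq0 // gt_eqF // (nf_Om_gt0 nf).
Qed.

Lemma nf_diff_p i p : cdom i p -> differentiable (Np i \o param i) (coord i p).
Proof.
move=> ip; apply: differentiable_entries => k l; rewrite ord1.
exact: smooth_on_differentiable (nf_smooth_p nf i l) (cimg_coord ip).
Qed.

Lemma nf_diff_m i p : cdom i p -> differentiable (Nm i \o param i) (coord i p).
Proof.
move=> ip; apply: differentiable_entries => k l; rewrite ord1.
exact: smooth_on_differentiable (nf_smooth_m nf i l) (cimg_coord ip).
Qed.

Lemma nf_bracket i p : cdom i p ->
  'D_(Np i p) (Nm i \o param i) (coord i p) = 'D_(Nm i p) (Np i \o param i) (coord i p).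
Proof.
move=> ip; apply/eqP; rewrite -subr_eq0.
have := cov_torsion_free (Np i \o param i) (Nm i \o param i) (metric_sym_near ip).
rewrite /= !coordK // -!covderE // => <-.
by rewrite (nf_cov_pm nf ip) (nf_cov_mp nf ip) subrr.
Qed.

Lemma null_frame_conformally_flat : conformally_flat g.
Proof.
exists (fun p => (Om p)^-1); split.
- move=> i; rewrite setTI; apply: smooth_on_inv; first exact: cimg_open.
    by move=> x _; rewrite gt_eqF // (nf_Om_gt0 nf).
  exact: (nf_smooth_Om nf i).
- by move=> p; rewrite invr_gt0 (nf_Om_gt0 nf).
move=> i p ip k l m n; rewrite riemannE //.
pose H := (fun x => (Om (param i x))^-1 *: g i (param i x)).
have Om0 q : Om q != 0 by rewrite gt_eqF // (nf_Om_gt0 nf).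
apply: (@null_flat _ (cimg i) H (Np i \o param i) (Nm i \o param i));
  [exact: cimg_open| | | | | | | | | |exact: cimg_coord].
- apply: cimgP => {}p {}ip; apply: differentiable_scale; last exact: metric_diff.
  apply: differentiableV; last exact: Om0.
  exact: smooth_on_differentiable (nf_smooth_Om nf i) (cimg_coord ip).
- by apply: cimgP => {}p {}ip; rewrite /H coordK // linearZ /= (metric_sym lg ip).
- apply: cimgP => {}p {}ip; rewrite /H coordK // unitmxZ ?lorentzian_unit //.
  by rewrite unitfE invr_eq0.
- exact: (nf_smooth_p nf i).
- exact: (nf_smooth_m nf i).
- by apply: cimgP => {}p {}ip; rewrite /H /= coordK // mformZ (nf_pp nf ip) mulr0.
- by apply: cimgP => {}p {}ip; rewrite /H /= coordK // mformZ (nf_mm nf ip) mulr0.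
- by apply: cimgP => {}p {}ip; rewrite /H /= coordK // mformZ (nf_pm nf ip) mulrC mulfK.
- by apply: cimgP => {}p {}ip; rewrite /= coordK // nf_bracket.
Qed.

End NullFrameSurface.

(** * Geodesics in a null frame *)

Lemma is_derive_continuous (R : realType) (V : normedModType R) (f : R -> V) (t : R) df :
  is_derive t 1 f df -> {for t, continuous f}.
Proof. by move=> h; apply/differentiable_continuous/derivable1_diffP/ex_derive. Qed.

Lemma is_derive_scale (R : realType) m n (a : R -> R) (A : R -> 'M[R]_(m, n)) (t : R) da dA :
  is_derive t 1 a da -> is_derive t 1 A dA ->
  is_derive t 1 (fun s => a s *: A s) (da *: A t + a t *: dA).
Proof.
move=> ha hA.
have da' : differentiable a t by apply/derivable1_diffP/ex_derive.
have dA' : differentiable A t by apply/derivable1_diffP/ex_derive.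
apply: DeriveDef; first exact/derivable1_diffP/differentiable_scale.
by rewrite derive_scale // !derive_val.
Qed.

Section FrameKinematics.
Context {R : realType} {M : surface R}.
Variables (g : chart M -> M -> 'M[R]_2).
Hypothesis lg : is_lorentzian g.
Variables (Np Nm : chart M -> M -> 'rV[R]_2) (Om : M -> R).
Hypothesis nf : null_frame g Np Nm Om.
Implicit Types (i j : chart M) (p : M) (c : R -> M) (a b : R -> R) (J : set R).

Let ch p : chart M := projT1 (cid (cdom_cover p)).
Let chP p : cdom (ch p) p. Proof. by rewrite /ch; case: cid. Qed.

(** The derivative of the logarithm of Ω along N_+, taken in an arbitrarily chosen chart; [kPE]
    shows that every chart gives the same value. *)
Definition kP p : R := tder (ch p) (Np (ch p) p) Om p / Om p.
Definition kM p : R := tder (ch p) (Nm (ch p) p) Om p / Om p.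

Let Om_diff i p : cdom i p -> differentiable (Om \o param i) (coord i p).
Proof. by move=> ip; exact: smooth_on_differentiable (nf_smooth_Om nf i) (cimg_coord ip). Qed.

Let Om0 p : Om p != 0. Proof. by rewrite gt_eqF // (nf_Om_gt0 nf). Qed.

Lemma kPE i p : cdom i p -> kP p = tder i (Np i p) Om p / Om p.
Proof.
move=> ip; rewrite /kP /tder; congr (_ / _).
rewrite (tder_chart (j := i) _ (chP p) ip (Om_diff ip)).
by rewrite -(nf_compat_p nf (chP p) ip).
Qed.

Lemma kME i p : cdom i p -> kM p = tder i (Nm i p) Om p / Om p.
Proof.
move=> ip; rewrite /kM /tder; congr (_ / _).
rewrite (tder_chart (j := i) _ (chP p) ip (Om_diff ip)).
by rewrite -(nf_compat_m nf (chP p) ip).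
Qed.

Let log_der_smooth i (N : chart M -> M -> 'rV[R]_2) (k : M -> R) :
  (forall l, smooth_on (cimg i) (fun y => N i (param i y) 0 l)) ->
  (forall p, cdom i p -> k p = tder i (N i p) Om p / Om p) ->
  smooth_on (cimg i) (k \o param i).
Proof.
move=> sN kE; have oi := @cimg_open _ M i; have sOm := nf_smooth_Om nf i.
have S : smooth_on (cimg i) (fun y => (N i (param i y) 0 0 * 'D_(delta_mx 0 0) (Om \o param i) y
    + N i (param i y) 0 1 * 'D_(delta_mx 0 1) (Om \o param i) y) * ((Om \o param i) y)^-1).
  apply: smooth_on_mul => //; last by apply: smooth_on_inv => // y _; exact: Om0.
  by apply: smooth_on_add => //; apply: smooth_on_mul => //; exact: smooth_on_derive.
apply: near_eq_smooth_on S => // y; rewrite inE => -[p ip <-].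
rewrite /= coordK // kE // /tder [in RHS]derive_row; last exact: Om_diff.
by rewrite sum2.
Qed.

Lemma kP_smooth i : smooth_on (cimg i) (kP \o param i).
Proof. by apply: log_der_smooth => [l|p]; [exact: (nf_smooth_p nf)|exact: kPE]. Qed.

Lemma kM_smooth i : smooth_on (cimg i) (kM \o param i).
Proof. by apply: log_der_smooth => [l|p]; [exact: (nf_smooth_m nf)|exact: kME]. Qed.

Lemma continuous_charts (f : M -> R) :
  (forall i, smooth_on (cimg i) (f \o param i)) -> continuous f.
Proof.
move=> sf p; have ip := chP p.
have cf : {for coord (ch p) p, continuous (f \o param (ch p))}.
  exact/differentiable_continuous/(smooth_on_differentiable (sf (ch p)) (cimg_coord ip)).
have h : {for p, continuous ((f \o param (ch p)) \o coord (ch p))}.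
  by apply: continuous_comp => //; exact: coord_cts.
have E : {near p, (f \o param (ch p)) \o coord (ch p) =1 f}.
  by near=> q; rewrite /= coordK //; near: q; exact: near_cdom.
rewrite /prop_for /continuous_at -(nbhs_singleton E).
exact: cvg_trans (near_eq_cvg E) h.
Unshelve. all: by end_near. Qed.

(* [a] and [b] are the components of the velocity of [c] in the null frame. *)
Definition fgeo J c a b : Prop := forall t, J t ->
  [/\ {for t, continuous c},
      forall i, cdom i (c t) ->
        is_derive t 1 (coord i \o c) (a t *: Np i (c t) + b t *: Nm i (c t)),
      is_derive t 1 a (- kP (c t) * a t ^+ 2) &
      is_derive t 1 b (- kM (c t) * b t ^+ 2)].

(** Leibniz rule for the acceleration of a curve of velocity [a Np + b Nm]. The mixed covariant
    derivatives of the frame vanish, so no term in [a b] appears and each component has an equation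
    of its own. *)
Lemma frame_accel i c a b (t : R) (a' b' : R) : {for t, continuous c} -> cdom i (c t) ->
  (\forall s \near t, is_derive (s : R) (1 : R) (coord i \o c) (a s *: Np i (c s) + b s *: Nm i (c s))) ->
  is_derive t 1 a a' -> is_derive t 1 b b' ->
  exists2 w, is_derive t 1 (derive1 (coord i \o c)) w &
    w + chris_vec g i (c t) (derive1 (coord i \o c) t) (derive1 (coord i \o c) t) =
    (a' + kP (c t) * a t ^+ 2) *: Np i (c t) + (b' + kM (c t) * b t ^+ 2) *: Nm i (c t).
Proof.
move=> ct it dx da db.
set x := coord i \o c.
set NP := Np i \o param i; set NM := Nm i \o param i.
have dxt := nbhs_singleton dx; set x' := a t *: _ + _ in dxt.
have isNP : is_derive t 1 (NP \o x) ('D_x' NP (x t)).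
  by apply: is_derive_comp_curve => //; exact: (nf_diff_p nf).
have isNM : is_derive t 1 (NM \o x) ('D_x' NM (x t)).
  by apply: is_derive_comp_curve => //; exact: (nf_diff_m nf).
exists (a' *: NP (x t) + a t *: 'D_x' NP (x t) + (b' *: NM (x t) + b t *: 'D_x' NM (x t))).
  apply: near_eq_is_derive (is_deriveD (is_derive_scale da isNP) (is_derive_scale db isNM)).
  near=> s; have is_ : cdom i (c s).
    by near: s; apply: (ct _ (near_cdom it)).
  rewrite derive1E; have -> : 'D_1 x s = a s *: Np i (c s) + b s *: Nm i (c s).
    by have h : is_derive s 1 x (a s *: Np i (c s) + b s *: Nm i (c s));
      [near: s|rewrite derive_val].
  by rewrite /NP /NM /x !fctE /= coordK.
have xtE : derive1 x t = x' by rewrite derive1E derive_val.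
have NPt : NP (x t) = Np i (c t) by rewrite /NP /x /= coordK.
have NMt : NM (x t) = Nm i (c t) by rewrite /NM /x /= coordK.
rewrite xtE chris_vecE // {2}/x' chrvDr !chrvZr.
set G := g i \o param i.
have cp : 'D_x' NP (x t) + chrv G (x t) x' (Np i (c t)) = (kP (c t) * a t) *: Np i (c t).
  transitivity (cov G x' NP (x t)); first by rewrite /cov NPt.
  rewrite /x' covDl; last exact: (nf_diff_p nf).
  rewrite !covZl; [|exact: (nf_diff_p nf)..].
  rewrite -!covderE // (nf_cov_mp nf it) (nf_cov_pp nf it) scaler0 addr0.
  by rewrite scalerA mulrC -(kPE it).
have cm : 'D_x' NM (x t) + chrv G (x t) x' (Nm i (c t)) = (kM (c t) * b t) *: Nm i (c t).
  transitivity (cov G x' NM (x t)); first by rewrite /cov NMt.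
  rewrite /x' covDl; last exact: (nf_diff_m nf).
  rewrite !covZl; [|exact: (nf_diff_m nf)..].
  rewrite -!covderE // (nf_cov_pm nf it) (nf_cov_mm nf it) scaler0 add0r.
  by rewrite scalerA mulrC -(kME it).
rewrite NPt NMt; move: cp cm.
move: ('D_x' NP (x t)) ('D_x' NM (x t)) (chrv _ _ _ _) (chrv _ _ _ (Nm i _)).
move: (Np i _) (Nm i _) => p q d1 d2 c1 c2 E1 E2.
have -> : d1 = (kP (c t) * a t) *: p - c1 by rewrite -E1 addrK.
have -> : d2 = (kM (c t) * b t) *: q - c2 by rewrite -E2 addrK.
move: (kP _) (kM _) (a t) (b t) => k1 k2 a0 b0.
by apply/rowP => k; rewrite !mxE; move: (p 0 k) (q 0 k) (c1 0 k) (c2 0 k) => *; ring.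
Unshelve. all: by end_near. Qed.

End FrameKinematics.

Section FrameGeodesics.
Context {R : realType} {M : surface R}.
Variables (g : chart M -> M -> 'M[R]_2).
Hypothesis lg : is_lorentzian g.
Variables (Np Nm : chart M -> M -> 'rV[R]_2) (Om : M -> R).
Hypothesis nf : null_frame g Np Nm Om.
Implicit Types (i j : chart M) (p : M) (c : R -> M) (a b : R -> R) (J : set R).
Local Notation fgeo := (fgeo Np Nm Om).
Local Notation kP := (kP Np Om).
Local Notation kM := (kM Nm Om).

Lemma geodesic_of_frame J c a b : open J -> is_interval J -> J !=set0 ->
  fgeo J c a b -> geodesic_on g J c.
Proof.
move=> oJ iJ J0 fg; split=> // [t Jt|i t Jt it]; first by have [] := fg t Jt.
have [ct dx da db] := fg t Jt.
have near_dx : \forall s \near t,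
    is_derive (s : R) (1 : R) (coord i \o c) (a s *: Np i (c s) + b s *: Nm i (c s)).
  near=> s; have Js : J s by near: s; exact: open_nbhs_nbhs.
  have [_ dxs _ _] := fg s Js; apply: dxs.
  by near: s; apply: (ct _ (near_cdom it)).
have [w dw Ew] := frame_accel nf ct it near_dx da db.
split; [by have [] := dx i it|by have [] := dw|].
by rewrite [X in X + _]derive1E derive_val Ew !mulNr !addNr !scale0r addr0.
Unshelve. all: by end_near. Qed.

Lemma velocity_chart c (t : R) i j v : {for t, continuous c} ->
  cdom i (c t) -> cdom j (c t) -> is_derive t 1 (coord i \o c) v ->
  is_derive t 1 (coord j \o c) (v *m tjac i j (c t)).
Proof.
move=> ct it jt dx.
have dt := transition_diff it jt.
have := is_derive_comp_curve dx dt; rewrite deriveEjacobian //.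
apply: near_eq_is_derive; near=> s.
by rewrite /= coordK //; near: s; apply: (ct _ (near_cdom it)).
Unshelve. all: by end_near. Qed.

Let ch p : chart M := projT1 (cid (cdom_cover p)).
Let chP p : cdom (ch p) p. Proof. by rewrite /ch; case: cid. Qed.

Lemma is_derive_wedge (u v : R -> 'rV[R]_2) (t : R) (du dv : 'rV[R]_2) :
  is_derive t 1 u du -> is_derive t 1 v dv ->
  derivable (fun s => wedge (u s) (v s)) t 1.
Proof.
move=> hu hv.
have du' : differentiable u t by apply/derivable1_diffP/ex_derive.
have dv' : differentiable v t by apply/derivable1_diffP/ex_derive.
apply: diff_derivable; apply: differentiableB; apply: differentiableM;
  exact: differentiable_entry.
Qed.

(** Cramer's rule yields the components of the velocity; the geodesic equation, rewritten by
    [frame_accel], splits into theirs because the null frame is independent. *)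
Lemma frame_of_geodesic J c : geodesic_on g J c -> exists a b, fgeo J c a b.
Proof.
move=> [oJ iJ J0 cc ode].
(* The chart used here jumps with [t], but the coefficients do not depend on it: near each time they
   are also given by the same formulas in one fixed chart, and this is how they are
   differentiated. *)
pose v t := derive1 (coord (ch (c t)) \o c) t.
pose a t := wedge (v t) (Nm (ch (c t)) (c t)) / wedge (Np (ch (c t)) (c t)) (Nm (ch (c t)) (c t)).
pose b t := wedge (Np (ch (c t)) (c t)) (v t) / wedge (Np (ch (c t)) (c t)) (Nm (ch (c t)) (c t)).
have dx t i : J t -> cdom i (c t) ->
    is_derive t 1 (coord i \o c) (a t *: Np i (c t) + b t *: Nm i (c t)).
  move=> Jt it; have jt := chP (c t); set j := ch (c t) in jt *.
  have [dj _ _] := ode j t Jt jt.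
  have dj' : is_derive t 1 (coord j \o c) (v t).
    by apply: (DeriveDef dj); rewrite /v derive1E.
  have := velocity_chart (cc t Jt) jt it dj'.
  rewrite (nf_compat_p nf jt it) (nf_compat_m nf jt it) !scalemxAl -mulmxDl.
  by rewrite {1}(wedge_expand (v t) (nf_wedge lg nf jt)).
exists a, b => t Jt; have jt := chP (c t); set j := ch (c t) in jt.
have ct := cc t Jt.
have nearJ : \forall s \near t, J s by exact: open_nbhs_nbhs.
have nearj : \forall s \near t, cdom j (c s) by exact: (ct _ (near_cdom jt)).
have near_dx : \forall s \near t,
    is_derive (s : R) (1 : R) (coord j \o c) (a s *: Np j (c s) + b s *: Nm j (c s)).
  by near=> s; apply: dx; near: s.
have [d1 d2 E] := ode j t Jt jt.
pose x := coord j \o c.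
have isx : is_derive t 1 x _ := derivableP d1.
have isx' : is_derive t 1 (derive1 x) _ := derivableP d2.
have isNP := is_derive_comp_curve isx (nf_diff_p nf jt).
have isNM := is_derive_comp_curve isx (nf_diff_m nf jt).
have dW : derivable (fun s => wedge (Np j (param j (x s))) (Nm j (param j (x s)))) t 1.
  exact: is_derive_wedge isNP isNM.
have W0 : wedge (Np j (param j (x t))) (Nm j (param j (x t))) != 0.
  by rewrite /x /= coordK //; exact: (nf_wedge lg nf jt).
have eqx : \forall s \near t, derive1 x s = a s *: Np j (c s) + b s *: Nm j (c s).
  near=> s; have h : is_derive (s : R) 1 x (a s *: Np j (c s) + b s *: Nm j (c s)).
    by near: s.
  by rewrite derive1E derive_val.
have coef s : cdom j (c s) -> derive1 x s = a s *: Np j (c s) + b s *: Nm j (c s) ->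
    a s = wedge (derive1 x s) (Nm j (c s)) / wedge (Np j (c s)) (Nm j (c s)) /\
    b s = wedge (Np j (c s)) (derive1 x s) / wedge (Np j (c s)) (Nm j (c s)).
  move=> js xs; have w0 := nf_wedge lg nf js; apply: (comb_inj w0).
  by rewrite -xs -wedge_expand.
have da : derivable a t 1.
  apply: (@near_eq_derivable _ _ _ (fun s => wedge (derive1 x s) (Nm j (param j (x s)))
    / wedge (Np j (param j (x s))) (Nm j (param j (x s))))).
    near=> s; have js : cdom j (c s) by near: s.
    have xs : derive1 x s = a s *: Np j (c s) + b s *: Nm j (c s) by near: s.
    by have [-> _] := coef s js xs; rewrite /x /= coordK.
  apply: (@derivableM _ _ (fun s => wedge (derive1 x s) (Nm j (param j (x s))))).
    exact: is_derive_wedge isx' isNM.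
  exact: derivableV.
have db : derivable b t 1.
  apply: (@near_eq_derivable _ _ _ (fun s => wedge (Np j (param j (x s))) (derive1 x s)
    / wedge (Np j (param j (x s))) (Nm j (param j (x s))))).
    near=> s; have js : cdom j (c s) by near: s.
    have xs : derive1 x s = a s *: Np j (c s) + b s *: Nm j (c s) by near: s.
    by have [_ ->] := coef s js xs; rewrite /x /= coordK.
  apply: (@derivableM _ _ (fun s => wedge (Np j (param j (x s))) (derive1 x s))).
    exact: is_derive_wedge isNP isx'.
  exact: derivableV.
have isa : is_derive t 1 a _ := derivableP da.
have isb : is_derive t 1 b _ := derivableP db.
have [w dw Ew] := frame_accel nf ct jt near_dx isa isb.
have : w = derive1 (derive1 x) t by rewrite derive1E derive_val.
move=> wE; rewrite wE E in Ew.
have [ea eb] : 'D_1 a t + kP (c t) * a t ^+ 2 = 0 /\ 'D_1 b t + kM (c t) * b t ^+ 2 = 0.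
  by apply: (comb_inj (nf_wedge lg nf jt)); rewrite -Ew !scale0r addr0.
split; [exact: ct|by move=> i it; exact: dx| |].
- by apply: is_derive_eq isa _; apply/eqP; rewrite mulNr -addr_eq0 ea.
- by apply: is_derive_eq isb _; apply/eqP; rewrite mulNr -addr_eq0 eb.
Unshelve. all: by end_near. Qed.

Lemma fgeo_reflect J c a b : fgeo J c a b ->
  fgeo [set t | J (- t)] (c \o -%R) (fun t => - a (- t)) (fun t => - b (- t)).
Proof.
move=> fg t /= Jt; have [ct dx da db] := fg (- t) Jt.
have isN : is_derive t 1 (-%R : R -> R) (-1).
  by have := is_deriveN (is_derive_id t (1 : R)).
have refl (V : normedModType R) (f : R -> V) df : is_derive (- t) 1 f df ->
    is_derive t 1 (f \o -%R) (- df).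
  move=> hf; have df' : differentiable f (- t) by apply/derivable1_diffP/ex_derive.
  apply: is_derive_eq (is_derive_comp_curve isN df') _.
  have -> : (-1 : R) = (-1) *: 1 by rewrite -[RHS]/(-1 * 1) mulr1.
  by rewrite deriveZv // derive_val scaleN1r.
split.
- by apply: continuous_comp; [exact: opp_continuous|].
- move=> i it; apply: is_derive_eq (refl _ _ _ (dx i it)) _.
  by rewrite opprD !scaleNr.
- apply: is_derive_eq (is_derive_opp (refl _ _ _ da)) _.
  by rewrite opprK sqrrN.
- apply: is_derive_eq (is_derive_opp (refl _ _ _ db)) _.
  by rewrite opprK sqrrN.
Qed.

Lemma geodesic_reflect J c : geodesic_on g J c ->
  geodesic_on g [set t | J (- t)] (c \o -%R).
Proof.
move=> gc; have [oJ iJ [t0 Jt0] _ _] := gc; have [a [b fg]] := frame_of_geodesic gc.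
apply: geodesic_of_frame (fgeo_reflect fg).
- by apply: (@open_comp _ _ -%R) => // x _; exact: opp_continuous.
- move=> s t /= Js Jt u /andP[su ut]; apply: (iJ (- t) (- s)) => //.
  by rewrite !lerN2 su ut.
- by exists (- t0); rewrite /= opprK.
Qed.

(** Time reversal exchanges the two ends of the interval, so only upper ends have to be studied. *)
Lemma inextendible_reflect J c : inextendible_geodesic g J c ->
  inextendible_geodesic g [set t | J (- t)] (c \o -%R).
Proof.
move=> [gc mx]; split; first exact: geodesic_reflect.
move=> J' c' gc' JJ' cc'.
have E := mx [set t | J' (- t)] (c' \o -%R) (geodesic_reflect gc').
apply/funext => t; rewrite -[in RHS]E /= ?opprK //.
- by move=> s Js /=; apply: JJ'; rewrite /= opprK.
- by move=> s Js /=; rewrite cc' /= ?opprK.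
Qed.

End FrameGeodesics.

(** * Completeness *)

(** At the infimum of the counterexamples the closure step gives [P], and the opening step gives [P]
    slightly beyond, which contradicts the infimum. *)
Lemma real_induction (R : realType) (P : R -> Prop) (t1 be : R) :
  P t1 ->
  (forall t, t1 <= t < be -> P t -> exists2 d, 0 < d & forall s, t <= s < t + d -> P s) ->
  (forall t, t1 < t < be -> (forall s, t1 <= s < t -> P s) -> P t) ->
  forall t, t1 <= t < be -> P t.
Proof.
move=> P1 Pop Pcl t /andP[t1t tb]; apply: contrapT => nPt.
pose S := [set s | t1 <= s <= t /\ ~ P s].
have S0 : S !=set0 by exists t; rewrite /S /= t1t lexx.
have lS : lbound S t1 by move=> s [/andP[]].
pose u := inf S.
have iS : has_inf S by split=> //; exists t1.
have t1u : t1 <= u by apply: lb_le_inf.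
have ut : u <= t by apply: ge_inf; [exists t1|rewrite /S /= t1t lexx].
have ub : u < be := le_lt_trans ut tb.
have Plt s : t1 <= s < u -> P s.
  move=> /andP[t1s su]; apply: contrapT => nPs.
  have : u <= s.
    by apply: ge_inf; [exists t1|split=> //; rewrite t1s (le_trans (ltW su))].
  by rewrite leNgt su.
have Pu : P u.
  move: t1u; rewrite le_eqVlt => /predU1P[<-//|t1u].
  by apply: Pcl => //; rewrite t1u.
have [|d d0 Pd] := Pop u _ Pu; first by rewrite t1u.
have [s [/andP[t1s st] nPs] su] : exists2 s, S s & s < u + d.
  by apply: inf_adherent.
have us : u <= s by apply: ge_inf; [exists t1|split=> //; rewrite t1s].
by apply: nPs; apply: Pd; rewrite us.
Qed.

Lemma continuous_eq_left (R : realType) (T : topologicalType) (f h : R -> T) (t1 t : R) :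
  hausdorff_space T -> t1 < t -> {for t, continuous f} -> {for t, continuous h} ->
  (forall s, t1 <= s < t -> f s = h s) -> f t = h t.
Proof.
move=> hT t1t cf ch fh.
have cf' : f @ t^'- --> f t by apply: cvg_at_left_filter.
have ch' : h @ t^'- --> h t by apply: cvg_at_left_filter.
have fh' : {near t^'-, h =1 f}.
  near=> s; apply/esym/fh; apply/andP; split.
    by apply: ltW; near: s; exact: nbhs_left_gt.
  by near: s; exact: nbhs_left_lt.
apply: (@cvg_unique _ hT (f @ t^'-)) => //.
exact: cvg_trans (near_eq_cvg fh') ch'.
Unshelve. all: by end_near. Qed.

Lemma smooth_on_lip_family (R : realType) n (I : finType) (U : set 'rV[R]_n)
    (f : I -> 'rV[R]_n -> R) x : open U -> (forall l, smooth_on U (f l)) -> U x ->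
  exists r K : R, [/\ 0 < r, 0 < K,
    forall y : 'rV[R]_n, (forall k, `|y 0 k - x 0 k| <= r) -> U y /\ forall l, `|f l y| <= K &
    forall (y z : 'rV[R]_n) (e : R), 0 <= e -> (forall k, `|y 0 k - x 0 k| <= r) ->
      (forall k, `|z 0 k - x 0 k| <= r) ->
      (forall k, `|y 0 k - z 0 k| <= e) -> forall l, `|f l y - f l z| <= K * e].
Proof.
move=> oU sf Ux.
have : forall l, exists rK : R * R, [/\ 0 < rK.1, 0 < rK.2,
    forall y : 'rV[R]_n, (forall k, `|y 0 k - x 0 k| <= rK.1) -> U y /\ `|f l y| <= rK.2 &
    forall (y z : 'rV[R]_n) (e : R), 0 <= e -> (forall k, `|y 0 k - x 0 k| <= rK.1) ->
      (forall k, `|z 0 k - x 0 k| <= rK.1) ->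
      (forall k, `|y 0 k - z 0 k| <= e) -> `|f l y - f l z| <= rK.2 * e].
  by move=> l; have [r [K H]] := smooth_on_lip oU (sf l) Ux; exists (r, K).
move=> /choice[rK H].
have [r0 r00 Hr0] := nbhs_row (open_nbhs_nbhs (conj oU Ux)).
(* The inverse of a sum of inverses lies below every radius, including the radius [r0] of a box
   inside [U]. *)
pose S := r0^-1 + \sum_l (rK l).1^-1; pose K := 1 + \sum_l (rK l).2.
have rpos l : 0 < (rK l).1 by have [] := H l.
have Kpos l : 0 < (rK l).2 by have [] := H l.
have Sge : 0 <= \sum_l (rK l).1^-1 by apply: sumr_ge0 => l _; rewrite invr_ge0 ltW.
have S0 : 0 < S by rewrite ltr_wpDr // invr_gt0.
have K0 : 0 < K by rewrite ltr_wpDr //; apply: sumr_ge0 => l _; rewrite ltW.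
have rS l : S^-1 <= (rK l).1.
  rewrite -[leRHS]invrK lef_pV2 ?posrE ?invr_gt0 // /S (bigD1 l) //= addrCA lerDl.
  by rewrite addr_ge0 ?invr_ge0 ?(ltW r00) // sumr_ge0 // => j _; rewrite invr_ge0 ltW.
have rS0 : S^-1 <= r0.
  by rewrite -[leRHS]invrK lef_pV2 ?posrE ?invr_gt0 // lerDl.
have KK l : (rK l).2 <= K.
  rewrite /K (bigD1 l) //= addrCA lerDl addr_ge0 // sumr_ge0 // => j _; exact: ltW.
exists S^-1, K; split=> //; first by rewrite invr_gt0.
- move=> y yx; split; first by apply: Hr0 => k; apply: le_trans (yx k) rS0.
  move=> l; have [_ _ Hl _] := H l.
  by have [|_ /le_trans] := Hl y; [move=> k; apply: le_trans (yx k) (rS l)|apply].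
- move=> y z e e0 yx zx yz l; have [_ _ _ Hl] := H l.
  apply: le_trans (Hl y z e e0 _ _ yz) _; last exact: ler_wpM2r.
    by move=> k; apply: le_trans (yx k) (rS l).
  by move=> k; apply: le_trans (zx k) (rS l).
Qed.

Section Bounds.
Context {R : realType} {M : surface R}.
Variables (g : chart M -> M -> 'M[R]_2).
Hypothesis lg : is_lorentzian g.
Variables (Np Nm : chart M -> M -> 'rV[R]_2) (Om : M -> R).
Hypothesis nf : null_frame g Np Nm Om.
Implicit Types (i j : chart M) (p : M) (c : R -> M) (a b : R -> R) (J : set R).
Local Notation fgeo := (fgeo Np Nm Om).
Local Notation kP := (kP Np Om).
Local Notation kM := (kM Nm Om).

Let Om0 p : Om p != 0. Proof. by rewrite gt_eqF // (nf_Om_gt0 nf). Qed.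

Lemma compact_frame_bounds : compact [set: M] -> [set: M] !=set0 ->
  exists K w, [/\ 0 < w, forall p, `|kP p| <= K, forall p, `|kM p| <= K &
    forall p, w <= Om p].
Proof.
move=> cM M0.
have cb (f : M -> R) : (forall i, smooth_on (cimg i) (f \o param i)) ->
    exists K, forall p, `|f p| <= K.
  move=> sf; have cf : {within [set: M], continuous (fun p => `|f p|)}.
    apply: continuous_subspaceT => p.
    apply: (@continuous_comp _ _ _ f (fun r => `|r|)); last exact: norm_continuous.
    exact: continuous_charts sf p.
  have [p0 _ Hp0] := compact_EVT_max M0 cM cf.
  by exists `|f p0| => p; apply: Hp0; rewrite inE.
have [K1 H1] := cb _ (kP_smooth nf); have [K2 H2] := cb _ (kM_smooth nf).
have cOm : {within [set: M], continuous Om}.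
  by apply: continuous_subspaceT; apply: continuous_charts; exact: (nf_smooth_Om nf).
have [p0 _ Hp0] := compact_EVT_min M0 cM cOm.
exists (Num.max K1 K2), (Om p0); split=> [|p|p|p]; first exact: (nf_Om_gt0 nf).
- by rewrite le_max H1.
- by rewrite le_max H2 orbT.
- by apply: Hp0; rewrite inE.
Qed.

Lemma fgeo_Om J c a b (t : R) : fgeo J c a b -> J t ->
  is_derive t 1 (Om \o c) (Om (c t) * (a t * kP (c t) + b t * kM (c t))).
Proof.
move=> fg Jt; have [ct dx _ _] := fg t Jt; have [i it] := cdom_cover (c t).
have dOm : differentiable (Om \o param i) ((coord i \o c) t).
  exact: smooth_on_differentiable (nf_smooth_Om nf i) (cimg_coord it).
apply: (@near_eq_is_derive _ _ _ ((Om \o param i) \o (coord i \o c))).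
  near=> s; rewrite /= coordK //; near: s; exact: (ct _ (near_cdom it)).
apply: is_derive_eq (is_derive_comp_curve (dx i it) dOm) _.
rewrite deriveDv // !deriveZv // (kPE nf it) (kME nf it) /tder.
move: ('D_(Np i (c t)) _ _) ('D_(Nm i (c t)) _ _) (Om0 (c t)) => u v.
move: (Om (c t)) (a t) (b t) => w a0 b0 w0.
by rewrite -[a0 *: u]/(a0 * u) -[b0 *: v]/(b0 * v); field.
Unshelve. all: by end_near. Qed.

(* [E = Om a b] is, up to a constant factor, the energy [g(c', c')]. *)
Lemma fgeo_bounded J c a b K w (t0 T : R) : is_interval J -> fgeo J c a b -> J t0 ->
  0 < w -> (forall p, `|kP p| <= K) -> (forall p, `|kM p| <= K) ->
  (forall p, w <= Om p) ->
  exists2 C, 0 <= C & forall t, J t -> `|t - t0| <= T -> `|a t| <= C /\ `|b t| <= C.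
Proof.
move=> iJ fg Jt0 w0 HP HM Hw.
pose A t := Om (c t) * a t; pose B t := Om (c t) * b t.
(* The [kP] part of the derivative of [Om] cancels the quadratic term of the derivative of [a]; what
   remains contains [a] and [b] only through the energy. *)
have dA (t : R) : J t -> is_derive t 1 A (Om (c t) * a t * b t * kM (c t)).
  move=> Jt; have [_ _ da _] := fg t Jt.
  apply: is_derive_eq (is_derive_mul (fgeo_Om fg Jt) da) _ => /=.
  by move: (kP _) (kM _) (Om _) => *; ring.
have dB (t : R) : J t -> is_derive t 1 B (Om (c t) * a t * b t * kP (c t)).
  move=> Jt; have [_ _ _ db] := fg t Jt.
  apply: is_derive_eq (is_derive_mul (fgeo_Om fg Jt) db) _ => /=.
  by move: (kP _) (kM _) (Om _) => *; ring.
pose E := Om (c t0) * a t0 * b t0.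
have EE t : J t -> Om (c t) * a t * b t = E.
  move=> Jt.
  have dE (s : R) : J s -> is_derive s 1 (fun s => A s * b s) 0.
    move=> Js; have [_ _ _ db] := fg s Js.
    apply: is_derive_eq (is_derive_mul (dA s Js) db) _; rewrite /A.
    by move: (kM _) (Om _) => *; ring.
  have := @MVT_dist _ J (fun s => A s * b s) (fun=> 0) 0 t0 t iJ dE _ Jt0 Jt.
  rewrite mul0r => h; apply/eqP; rewrite -subr_eq0 -normr_eq0 eq_le normr_ge0 andbT.
  by apply: h => s _; rewrite normr0.
have bd (D : R -> R) (k : M -> R) : (forall p, `|k p| <= K) ->
    (forall t : R, J t -> is_derive t 1 D (Om (c t) * a t * b t * k (c t))) ->
    forall t, J t -> `|t - t0| <= T -> `|D t| <= `|D t0| + `|E| * K * T.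
  move=> kK dD t Jt tT.
  have K0 : 0 <= `|E| * K by rewrite mulr_ge0 //; apply: le_trans (kK (c t)).
  rewrite -lerBlDl; apply: le_trans (lerB_dist _ _) _.
  apply: le_trans (MVT_dist iJ dD (M := `|E| * K) _ Jt0 Jt) _; last exact: ler_wpM2l.
  by move=> s Js; rewrite EE // normrM ler_wpM2l.
(* [T] may be negative; its absolute value keeps [C0] nonnegative. *)
pose C0 := `|A t0| + `|B t0| + `|E| * K * `|T|.
have K0 : 0 <= K by apply: le_trans (HP (c t0)).
have C00 : 0 <= C0 by rewrite !addr_ge0 // !mulr_ge0.
exists (C0 / w) => [|t Jt tT]; first by rewrite divr_ge0 // ltW.
have fin (y : R) : `|Om (c t) * y| <= C0 -> `|y| <= C0 / w.
  rewrite normrM (gtr0_norm (nf_Om_gt0 nf _)) => h; rewrite ler_pdivlMr // mulrC.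
  by apply: le_trans h; rewrite ler_wpM2r.
have TT : `|E| * K * T <= `|E| * K * `|T| by rewrite ler_wpM2l ?ler_norm // mulr_ge0.
split; apply: fin.
  apply: le_trans (bd A kM HM dA t Jt tT) _; rewrite /C0 -addrA lerD2l.
  by rewrite (le_trans TT) // lerDr.
apply: le_trans (bd B kP HP dB t Jt tT) _.
by rewrite /C0 lerD // lerDr.
Qed.

End Bounds.

(** * The geodesic equation as a first-order system in a chart *)

Section Extension.
Context {R : realType} {M : surface R}.
Variables (g : chart M -> M -> 'M[R]_2).
Hypothesis lg : is_lorentzian g.
Variables (Np Nm : chart M -> M -> 'rV[R]_2) (Om : M -> R).
Hypothesis nf : null_frame g Np Nm Om.
Implicit Types (i j : chart M) (p : M) (c : R -> M) (a b : R -> R) (J : set R).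
Local Notation fgeo := (fgeo Np Nm Om).
Local Notation kP := (kP Np Om).
Local Notation kM := (kM Nm Om).
(* States of the geodesic flow in a chart: the two coordinates of the point,
   then the two components of the velocity in the null frame. *)
Local Notation I := ('I_2 + 'I_2)%type.
Implicit Types (y z : I -> R).

Definition spos y : 'rV[R]_2 := \row_k y (inl k).

(** Velocities are recorded in the null frame, so that the bounds of [fgeo_bounded] apply directly
    to the state. Outside the image of the chart the values are junk, which [gflow_box] avoids by
    its choice of [r]. *)
Definition gflow i y (k : I) : R :=
  match k with
  | inl k => y (inr 0) * Np i (param i (spos y)) 0 k
             + y (inr 1) * Nm i (param i (spos y)) 0 k
  | inr k => if k == 0 then - kP (param i (spos y)) * y (inr 0) ^+ 2
             else - kM (param i (spos y)) * y (inr 1) ^+ 2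
  end.

Definition gstate i p (a b : R) (k : I) : R :=
  match k with
  | inl k => coord i p 0 k
  | inr k => if k == 0 then a else b
  end.

Lemma spos_gstate i p (a b : R) : spos (gstate i p a b) = coord i p.
Proof. by apply/rowP => k; rewrite mxE. Qed.

Let lip_mul (K D e n n' a a' : R) : 0 <= e -> `|n| <= K -> `|a'| <= D ->
  `|a - a'| <= e -> `|n - n'| <= K * e -> `|a * n - a' * n'| <= (1 + D) * K * e.
Proof.
move=> e0 nK aD ae nne; have K0 : 0 <= K by apply: le_trans nK.
have -> : a * n - a' * n' = (a - a') * n + a' * (n - n') by ring.
apply: le_trans (ler_normD _ _) _; rewrite !normrM.
have h1 : `|a - a'| * `|n| <= e * K by apply: ler_pM.
have h2 : `|a'| * `|n - n'| <= D * (K * e) by apply: ler_pM.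
by apply: le_trans (lerD h1 h2) _; rewrite le_eqVlt; apply/orP; left; apply/eqP; ring.
Qed.

Let lip_sqr (K D e n n' a a' : R) : 0 <= e -> `|n'| <= K -> `|a| <= D -> `|a'| <= D ->
  `|a - a'| <= e -> `|n - n'| <= K * e ->
  `|- n * a ^+ 2 - - n' * a' ^+ 2| <= (D ^+ 2 + 2 * D) * K * e.
Proof.
move=> e0 nK aD aD' ae nne; have K0 : 0 <= K by apply: le_trans nK.
have -> : - n * a ^+ 2 - - n' * a' ^+ 2 =
  - ((n - n') * (a * a) + n' * ((a - a') * (a + a'))) by ring.
rewrite normrN; apply: le_trans (ler_normD _ _) _; rewrite !normrM.
have h1 : `|n - n'| * (`|a| * `|a|) <= (K * e) * (D * D).
  by apply: ler_pM => //; rewrite ?mulr_ge0 //; exact: ler_pM.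
have h3 : `|a + a'| <= D + D by apply: le_trans (ler_normD _ _) (lerD aD aD').
have h2 : `|n'| * (`|a - a'| * `|a + a'|) <= K * (e * (D + D)).
  by apply: ler_pM => //; rewrite ?mulr_ge0 //; exact: ler_pM.
by apply: le_trans (lerD h1 h2) _; rewrite le_eqVlt; apply/orP; left; apply/eqP; ring.
Qed.

(** The velocity radius [2 * C + 1] is such that all velocities bounded by [C] lie in the box of
    half size, where [flow_box] accepts initial values. *)
Lemma gflow_box i p (C : R) : cdom i p -> 0 <= C ->
  exists r L B : R, let rho (k : I) := if k is inl _ then r else 2 * C + 1 in
    let y0 := gstate i p 0 0 in
    [/\ [/\ 0 < r, 0 < L & 0 < B], lip_on (box y0 rho) L (gflow i),
        (forall z k, box y0 rho z -> `|gflow i z k| <= B) &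
        forall x : 'rV[R]_2, (forall k, `|x 0 k - coord i p 0 k| <= r) -> cimg i x].
Proof.
move=> ip C0.
(* The six coefficients of the system, two components for each null field together with [kP] and
   [kM], form one finite family so as to share their constants. *)
pose f (l : I + bool) (x : 'rV[R]_2) : R := match l with
  | inl (inl k) => Np i (param i x) 0 k
  | inl (inr k) => Nm i (param i x) 0 k
  | inr true => kP (param i x)
  | inr false => kM (param i x) end.
have sf l : smooth_on (cimg i) (f l).
  case: l => [[k|k]|[]].
  - exact: (nf_smooth_p nf).
  - exact: (nf_smooth_m nf).
  - exact: (kP_smooth nf).
  - exact: (kM_smooth nf).
have [r [K [r0 K0 fK flip]]] :=
  smooth_on_lip_family (@cimg_open _ M i) sf (cimg_coord ip).
pose D := 2 * C + 1; have D0 : 0 < D by rewrite ltr_wpDl // mulr_ge0.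
pose L := 2 * ((1 + D) * K) + (D ^+ 2 + 2 * D) * K.
pose B := 2 * (D * K) + K * (D * D).
have L1 : 0 < (1 + D) * K by rewrite mulr_gt0 // ltr_wpDl.
have L2 : 0 < (D ^+ 2 + 2 * D) * K by rewrite mulr_gt0 // addr_gt0 ?exprn_gt0 ?mulr_gt0.
have B1 : 0 < D * K by rewrite mulr_gt0.
have B2 : 0 < K * (D * D) by rewrite !mulr_gt0.
exists r, L, B => rho y0.
have posb z : box y0 rho z -> forall k, `|spos z 0 k - coord i p 0 k| <= r.
  by move=> bz k; have := bz (inl k); rewrite mxE.
have velb z : box y0 rho z -> forall k, `|z (inr k)| <= D.
  by move=> bz k; have := bz (inr k); rewrite /y0 /= if_same subr0.
split.
- by split=> //; rewrite addr_gt0 // mulr_gt0.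
- move=> e y z by_ bz yz k.
  have e0 : 0 <= e by apply: le_trans (normr_ge0 _) (yz (inr 0)).
  have fl := flip _ _ e e0 (posb _ by_) (posb _ bz).
  have {}fl : forall l, `|f l (spos y) - f l (spos z)| <= K * e.
    by apply: fl => k'; rewrite !mxE; exact: yz.
  have [_ fy] := fK _ (posb _ by_); have [_ fz] := fK _ (posb _ bz).
  have vy := velb _ by_; have vz := velb _ bz.
  case: k => k.
  + have h1 := lip_mul e0 (fy (inl (inl k))) (vz 0) (yz (inr 0)) (fl (inl (inl k))).
    have h2 := lip_mul e0 (fy (inl (inr k))) (vz 1) (yz (inr 1)) (fl (inl (inr k))).
    rewrite /= opprD addrACA; apply: le_trans (ler_normD _ _) _.
    apply: le_trans (lerD h1 h2) _; rewrite -mulrDl; apply: ler_wpM2r => //.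
    by rewrite /L mulr_natl mulr2n lerDl ltW.
  + rewrite /gflow; apply: (@le_trans _ _ ((D ^+ 2 + 2 * D) * K * e)); last first.
      by apply: ler_wpM2r => //; rewrite /L lerDr mulr_ge0 // ltW.
    case: eqP => _.
      exact: lip_sqr e0 (fz (inr true)) (vy 0) (vz 0) (yz (inr 0)) (fl (inr true)).
    exact: lip_sqr e0 (fz (inr false)) (vy 1) (vz 1) (yz (inr 1)) (fl (inr false)).
- move=> z k bz; have [_ fz] := fK _ (posb _ bz); have vz := velb _ bz.
  case: k => k.
  + rewrite /=; apply: le_trans (ler_normD _ _) _; rewrite !normrM.
    apply: (@le_trans _ _ (D * K + D * K)).
      apply: lerD; apply: ler_pM => //; first exact: (fz (inl (inl k))).
      exact: (fz (inl (inr k))).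
    by rewrite /B mulr_natl mulr2n lerDl ltW.
  + rewrite /gflow; apply: (@le_trans _ _ (K * (D * D))); last first.
      by rewrite /B lerDr mulr_ge0 // ltW.
    have dd (m : 'I_2) : `|z (inr m)| * `|z (inr m)| <= D * D by apply: ler_pM.
    have d0 (m : 'I_2) : 0 <= `|z (inr m)| * `|z (inr m)| by rewrite mulr_ge0.
    case: eqP => _; rewrite normrM normrN expr2 [X in _ * X]normrM.
      by apply: ler_pM; [exact: normr_ge0|exact: d0|exact: (fz (inr true))|exact: dd].
    by apply: ler_pM; [exact: normr_ge0|exact: d0|exact: (fz (inr false))|exact: dd].
- by move=> x /fK[].
Qed.

(** A curve solved in the single chart [i] has the right velocity in every chart, because both null
    fields transform by the Jacobian of the transition. *)
Lemma chart_curve i (x : R -> 'rV[R]_2) (s : R) (a b : R) : cimg i (x s) ->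
  is_derive s 1 x (a *: Np i (param i (x s)) + b *: Nm i (param i (x s))) ->
  {for s, continuous (param i \o x)} /\
  forall j, cdom j (param i (x s)) -> is_derive s 1 (coord j \o (param i \o x))
    (a *: Np j (param i (x s)) + b *: Nm j (param i (x s))).
Proof.
move=> ix dx; have [ip xE] := cimg_param ix.
split=> [|j jp].
  by apply: continuous_comp; [exact: is_derive_continuous dx|exact: param_cts].
rewrite (nf_compat_p nf ip jp) (nf_compat_m nf ip jp) !scalemxAl -mulmxDl.
have dt := transition_diff ip jp; rewrite xE in dt.
apply: is_derive_eq (is_derive_comp_curve dx dt) _.
by rewrite (deriveEjacobian _ dt) /tjac xE.
Qed.

End Extension.

Lemma is_derive_row (R : realType) n (x : R -> 'rV[R]_n) (t : R) (dx : 'rV[R]_n) :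
  (forall k, is_derive t 1 (fun s => x s 0 k) (dx 0 k)) -> is_derive t 1 x dx.
Proof.
move=> h; have dd : differentiable x t.
  apply: differentiable_entries => i k; rewrite ord1.
  by apply/derivable1_diffP; have [] := h k.
apply: DeriveDef; first exact: diff_derivable.
by apply/rowP => k; rewrite derive_entry // derive_val.
Qed.

Lemma is_derive_row_entry (R : realType) n (x : R -> 'rV[R]_n) (t : R) (dx : 'rV[R]_n) k :
  is_derive t 1 x dx -> is_derive t 1 (fun s => x s 0 k) (dx 0 k).
Proof.
move=> h; have dd : differentiable x t by apply/derivable1_diffP/ex_derive.
apply: DeriveDef; first exact/diff_derivable/differentiable_entry.
by rewrite -derive_entry // derive_val.
Qed.

Lemma is_derive_translate (R : realType) (f : R -> R) (t1 s df : R) :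
  is_derive (s - t1) 1 f df -> is_derive s 1 (fun t => f (t - t1)) df.
Proof.
move=> h; have df' : differentiable f (s - t1) by apply/derivable1_diffP/ex_derive.
have dB : is_derive s 1 (fun t : R => t - t1) (1 : R).
  rewrite -[X in is_derive _ _ _ X]subr0; exact: is_deriveB.
by apply: is_derive_eq (is_derive_comp_curve dB df') _; rewrite derive_val.
Qed.

(** * Continuation of geodesics on a compact surface *)

Section Completeness.
Context {R : realType} {M : surface R}.
Variables (g : chart M -> M -> 'M[R]_2).
Hypothesis lg : is_lorentzian g.
Variables (Np Nm : chart M -> M -> 'rV[R]_2) (Om : M -> R).
Hypothesis nf : null_frame g Np Nm Om.
Implicit Types (i j : chart M) (p : M) (c : R -> M) (a b : R -> R) (J : set R).
Local Notation fgeo := (fgeo Np Nm Om).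
Local Notation gflow := (gflow Np Nm Om).
Local Notation I := ('I_2 + 'I_2)%type.

(** [fgeo] is a condition on germs at each time separately, so singletons carry it from one curve to
    another; this is how two pieces of a geodesic are glued. *)
Lemma fgeo_local c a b c' a' b' (t : R) : fgeo [set t] c a b ->
  (\forall s \near t, [/\ c s = c' s, a s = a' s & b s = b' s]) ->
  fgeo [set t] c' a' b'.
Proof.
move=> fg E _ ->; have [ct dx da db] := fg t erefl.
have Ec : {near t, c =1 c'} by apply: filterS E => s [].
have Ea : \forall s \near t, a s = a' s by apply: filterS E => s [].
have Eb : \forall s \near t, b s = b' s by apply: filterS E => s [].
rewrite -(nbhs_singleton Ec) -(nbhs_singleton Ea) -(nbhs_singleton Eb); split.
- rewrite /prop_for /continuous_at -(nbhs_singleton Ec).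
  exact: cvg_trans (near_eq_cvg Ec) ct.
- move=> i it; apply: near_eq_is_derive (dx i it).
  by apply: filterS Ec => s /= ->.
- exact: near_eq_is_derive Ea da.
- exact: near_eq_is_derive Eb db.
Qed.

Lemma near_coord_box i p c (t r : R) : {for t, continuous c} -> cdom i (c t) ->
  (forall k, `|coord i (c t) 0 k - coord i p 0 k| < r) ->
  \forall s \near t, cdom i (c s) /\ forall k, `|coord i (c s) 0 k - coord i p 0 k| <= r.
Proof.
move=> ct it tr; near=> s; split; first by near: s; exact: (ct _ (near_cdom it)).
near: s; apply: filter_forall => k.
have cx : {for t, continuous (fun s => coord i (c s) 0 k)}.
  apply: (@continuous_comp _ _ _ (coord i \o c) (fun x : 'rV[R]_2 => x 0 k)).
    by apply: continuous_comp => //; exact: coord_cts.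
  exact: matrix_normedtype.coord_continuous.
have e0 : 0 < r - `|coord i (c t) 0 k - coord i p 0 k| by rewrite subr_gt0.
near=> s; have h : `|coord i (c t) 0 k - coord i (c s) 0 k| <=
    r - `|coord i (c t) 0 k - coord i p 0 k|.
  by near: s; apply: (@cvgr_dist_le _ _ _ _ _ _ (coord i (c t) 0 k)).
apply: le_trans (ler_distD (coord i (c t) 0 k) _ _) _.
by rewrite -lerBrDr distrC.
Unshelve. all: by end_near. Qed.

Lemma gflow_gstate i p (a b : R) : cdom i p ->
  (forall k, gflow i (gstate i p a b) (inl k) = (a *: Np i p + b *: Nm i p) 0 k) /\
  (gflow i (gstate i p a b) (inr 0) = - kP Np Om p * a ^+ 2) /\
  (gflow i (gstate i p a b) (inr 1) = - kM Nm Om p * b ^+ 2).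
Proof.
move=> ip; rewrite /gflow /= spos_gstate coordK //.
by split=> // k; rewrite !mxE.
Qed.

Lemma geodesic_extend J c a b (t0 be : R) : compact [set: M] -> open J ->
  is_interval J -> fgeo J c a b -> J t0 -> (forall t, J t -> t < be) ->
  (forall t, t0 <= t < be -> J t) ->
  exists J' c', [/\ geodesic_on g J' c', J `<=` J', forall t, J t -> c' t = c t & J' be].
Proof.
move=> cM oJ iJ fg Jt0 Jlt Jge.
have t0be := Jlt _ Jt0.
have [K [w [w0 HP HM Hw]]] := compact_frame_bounds nf cM (ex_intro _ (c t0) Logic.I).
have [C C0 HC] := fgeo_bounded nf (be - t0) iJ fg Jt0 w0 HP HM Hw.
have {}HC t : t0 <= t < be -> `|a t| <= C /\ `|b t| <= C.
  move=> /[dup] h /andP[h1 h2]; apply: HC; first exact: Jge.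
  by rewrite ger0_norm ?subr_ge0 // lerD2r ltW.
(* Only a cluster point of [c] at [be] from the left; convergence is not known here. *)
have [p [_ clp]] := cM (c @ be^'-) _ filterT.
have [i ip] := cdom_cover p.
have [r [L [B]]] := gflow_box nf ip C0.
set rho := fun k : I => _; set y0 := gstate i p 0 0.
move=> [[r0 L0 B0] lipF bdF boxi].
have rho0 k : 0 < rho k by case: k => k //=; rewrite ltr_wpDl // mulr_ge0.
have [T T0 HT] := flow_box L0 B0 rho0 lipF bdF.
(* A starting time so late that the flow time [T] reaches past [be], at which [c] visits the
   half-sized box around [p]; the cluster property supplies it. *)
have [t1 [/andP[t01 t1be] t1T it1 t1r]] : exists t1, [/\ t0 <= t1 < be, be - t1 < T,
    cdom i (c t1) & forall k, `|coord i (c t1) 0 k - coord i p 0 k| <= r / 2].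
  pose U := [set q | cdom i q /\ forall k, `|coord i q 0 k - coord i p 0 k| <= r / 2].
  have nU : nbhs p U.
    near=> q; split; first by near: q; exact: near_cdom.
    near: q; apply: filter_forall => k.
    have cx : {for p, continuous (fun q => coord i q 0 k)}.
      apply: (@continuous_comp _ _ _ (coord i) (fun x : 'rV[R]_2 => x 0 k)).
        exact: coord_cts.
      exact: matrix_normedtype.coord_continuous.
    near=> q; rewrite distrC.
    near: q; apply: (@cvgr_dist_le _ _ _ _ _ _ (coord i p 0 k)) => //.
    by rewrite divr_gt0.
  pose S := [set t | t0 <= t < be /\ be - t < T].
  have nS : (c @ be^'-) (c @` S).
    rewrite /fmap /=; near=> t; exists t => //; split.
      apply/andP; split; last by near: t; exact: nbhs_left_lt.
      by apply: ltW; near: t; exact: nbhs_left_gt.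
    rewrite ltrBlDr -ltrBlDl; near: t; apply: nbhs_left_gt.
    by rewrite ltrBlDr ltrDl.
  by have [_ [[t [tb tT] <-] [it Ut]]] := clp _ _ nS nU; exists t.
pose z := gstate i (c t1) (a t1) (b t1).
have zy0 k : `|z k - y0 k| <= rho k / 2.
  case: k => k; first exact: t1r.
  have [|ha hb] := HC t1; first by rewrite t01.
  have CC : C <= (2 * C + 1) / 2 by rewrite ler_pdivlMr // mulrC lerDl.
  by rewrite /z /y0 /= if_same subr0; case: ifP => _; exact: le_trans CC.
have [u [u0 Hu]] := HT z zy0.
pose y s := u (s - t1); pose x s := spos (y s).
have Hy (s : R) : `|s - t1| < T -> (forall k, `|y s k - y0 k| < rho k) /\
    forall k, is_derive s 1 (fun t => y t k) (gflow i (y s) k).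
  move=> /Hu[h1 h2]; split=> // k.
  exact: (@is_derive_translate _ (fun s => u s k)).
have xr s : `|s - t1| < T -> forall k, `|x s 0 k - coord i p 0 k| < r.
  by move=> /Hy[h _] k; have := h (inl k); rewrite mxE.
have ix s : `|s - t1| < T -> cimg i (x s).
  by move=> sT; apply: boxi => k; apply: ltW; exact: xr.
have dx (s : R) : `|s - t1| < T -> is_derive s 1 x
    (y s (inr 0) *: Np i (param i (x s)) + y s (inr 1) *: Nm i (param i (x s))).
  move=> /Hy[_ h]; apply: is_derive_row => k.
  have -> : (fun s => x s 0 k) = (fun s => y s (inl k)).
    by apply/funext => s'; rewrite mxE.
  by apply: is_derive_eq (h (inl k)) _; rewrite /gflow !mxE.
have curve s (sT : `|s - t1| < T) := chart_curve nf (ix s sT) (dx s sT).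
have fgx (s : R) : `|s - t1| < T ->
    fgeo [set s] (param i \o x) (fun s => y s (inr 0)) (fun s => y s (inr 1)).
  move=> sT _ ->; have [cx cdx] := curve s sT; have [_ h] := Hy s sT.
  by split; [exact: cx|exact: cdx|exact: (h (inr 0))|exact: (h (inr 1))].
have t1T' s : t1 <= s < be -> `|s - t1| < T.
  move=> /andP[h1 h2]; rewrite ger0_norm ?subr_ge0 //; apply: lt_trans t1T.
  by rewrite ltrD2r.
have Js s : t1 <= s < be -> J s.
  by move=> /andP[h1 h2]; apply: Jge; rewrite h2 (le_trans t01).
(* Agreement of the geodesic with the flow extends to the right by uniqueness and passes to left
   limits by continuity. *)
have agree : forall s, t1 <= s < be ->
    [/\ c s = param i (x s), a s = y s (inr 0) & b s = y s (inr 1)].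
  apply: real_induction.
  - have yt1 : y t1 = z by rewrite /y subrr u0.
    by rewrite /x yt1 spos_gstate coordK.
  - move=> t tb [ct at_ bt]; have tT := t1T' t tb; have Jt := Js t tb.
    have [icx xE] := cimg_param (ix t tT).
    have it : cdom i (c t) by rewrite ct.
    have xtE : coord i (c t) = x t by rewrite ct xE.
    have [cct _ _ _] := fg t Jt.
    have : \forall s \near t, (cdom i (c s) /\
        forall k, `|coord i (c s) 0 k - coord i p 0 k| <= r) /\ s < be.
      near=> s; split; last first.
        by near: s; apply: lt_nbhsl; have /andP[] := tb.
      near: s; apply: near_coord_box => // k; rewrite xtE; exact: xr.
    move=> /nbhs_ballP[eta /= eta0 Heta].
    (* [eta] keeps the geodesic in the box and before [be]; [(2 * L)^-1] is a length for which
       [ode_unique] applies. *)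
    pose d := Num.min eta (2 * L)^-1.
    have d0 : 0 < d by rewrite lt_min eta0 invr_gt0 mulr_gt0.
    have Ld : L * d <= 2^-1.
      apply: (@le_trans _ _ (L * (2 * L)^-1)).
        by apply: ler_wpM2l; [exact: ltW|rewrite ge_min lexx orbT].
      by rewrite invfM mulrCA divff ?mulr1 // gt_eqF.
    have near_t s : t <= s < t + d -> [/\ t1 <= s < be, cdom i (c s) &
        forall k, `|coord i (c s) 0 k - coord i p 0 k| <= r].
      move=> /andP[ts sd].
      have : ball t eta s.
        rewrite -ball_normE /ball_ /= distrC ger0_norm ?subr_ge0 //.
        by rewrite ltrBlDl; apply: lt_le_trans sd _; rewrite lerD2l ge_min lexx.
      move=> /Heta[[h1 h2] h3]; split=> //; rewrite h3 andbT.
      by have /andP[h _] := tb; exact: le_trans ts.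
    pose st s := gstate i (c s) (a s) (b s).
    have st_box s : t <= s < t + d -> box y0 rho (st s).
      move=> /near_t[h1 h2 h3] [k|k] /=; first exact: h3.
      have [ha hb] : `|a s| <= C /\ `|b s| <= C.
        by apply: HC; have /andP[h4 h5] := h1; rewrite h5 (le_trans t01).
      have CC : C <= 2 * C + 1.
        by rewrite mulr_natl mulr2n -addrA lerDl addr_ge0.
      by rewrite if_same subr0; case: ifP => _; exact: le_trans CC.
    exists d => // s sd.
    (* Both states lie in the box, hence both solve the clamped system, which is globally
       Lipschitz. *)
    have E : st s = y s.
      apply: (ode_unique L0 Ld (lip_on_clampb rho0 lipF) (t0 := t)) => // [t' k t'd|t' k t'd|].
      + have [h1 h2 h3] := near_t t' t'd.
        rewrite /= clampb_id; last exact: st_box.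
        have [e1 [e2 e3]] := gflow_gstate (a t') (b t') h2.
        have [_ dxt dat dbt] := fg t' (Js t' h1).
        case: k => k; first by rewrite e1; exact: is_derive_row_entry (dxt i h2).
        by move: k; apply: ord2P; rewrite ?e2 ?e3.
      + have [h1 h2 h3] := near_t t' t'd.
        have [hb hd] := Hy t' (t1T' t' h1).
        by rewrite /= clampb_id // => k'; exact/ltW.
      + apply/funext => -[k|k] /=; first by rewrite xtE mxE.
        by move: k; apply: ord2P.
    have [h1 h2 h3] := near_t s sd.
    split.
    + by rewrite /x -E spos_gstate coordK.
    + by rewrite -E.
    + by rewrite -E.
  - move=> t /andP[t1t tb] Plt.
    have tb' : t1 <= t < be by rewrite (ltW t1t).
    have [cct _ da db] := fg t (Js t tb'); have [cx _] := curve t (t1T' t tb').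
    have [_ dy] := Hy t (t1T' t tb').
    split.
    + apply: (continuous_eq_left (@surface_hausdorff _ M) t1t cct cx) => s /Plt[] //.
    + apply: (continuous_eq_left (@norm_hausdorff _ R) t1t (is_derive_continuous da)
        (is_derive_continuous (dy (inr 0)))) => s /Plt[] //.
    + apply: (continuous_eq_left (@norm_hausdorff _ R) t1t (is_derive_continuous db)
        (is_derive_continuous (dy (inr 1)))) => s /Plt[] //.
(* On [[t1, be[] both formulas agree; switching only at [be] makes [c'] equal to [c] on all of
   [J]. *)
pose c' s := if s < be then c s else param i (x s).
pose a' s := if s < be then a s else y s (inr 0).
pose b' s := if s < be then b s else y s (inr 1).
(* The right end exceeds [be] because [be - t1 < T]. *)
pose J' := J `|` [set` `]t1, t1 + T[].
have Jt1 : J t1 by apply: Js; rewrite lexx.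
exists J', c'; split.
- apply: (geodesic_of_frame nf (a := a') (b := b')).
  + by apply: openU => //; exact: interval_open.
  + move=> s t J's J't v /andP[sv vt].
    have [vt1|t1v] := leP v t1.
      left; apply: (iJ s t1) => //; last by rewrite sv.
      case: J's => //=; rewrite in_itv /= => /andP[t1s _].
      by have := le_lt_trans (le_trans sv vt1) t1s; rewrite ltxx.
    case: J't => [Jt|/=]; first by left; apply: (iJ t1 t) => //; rewrite (ltW t1v).
    by rewrite in_itv /= => /andP[_ tT]; right; rewrite /= in_itv /= t1v (le_lt_trans vt).
  + by exists t0; left.
  + move=> t J't; suff : fgeo [set t] c' a' b' by apply.
    case: J't => [Jt|].
      apply: (@fgeo_local c a b); first by move=> _ ->; exact: fg.
      near=> s; rewrite /c' /a' /b'.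
      have -> // : s < be by near: s; apply: lt_nbhsl; exact: Jlt.
    rewrite /= in_itv /= => /andP[t1t tT].
    apply: fgeo_local (fgx t _) _.
      by rewrite ger0_norm ?subr_ge0 1?ltW // ltrBlDl.
    near=> s; rewrite /c' /a' /b' /=; case: ifPn => // sb.
    have [|-> -> ->] // := agree s; rewrite sb andbT ltW //.
    by near: s; exact: lt_nbhsr.
- by move=> t; left.
- by move=> t Jt; rewrite /c' Jlt.
- by right; rewrite /= in_itv /= t1be -ltrBlDl.
Unshelve. all: by end_near. Qed.

(** Otherwise [sup J] lies outside the open set [J], and [geodesic_extend] produces an extension
    containing it, against maximality. *)
Lemma inextendible_unbounded J c : compact [set: M] ->
  inextendible_geodesic g J c -> forall B, exists2 t, J t & B < t.
Proof.
move=> cM [gc mx] B; apply: contrapT => nB.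
have [oJ iJ [t0 Jt0] _ _] := gc; have [a [b fg]] := frame_of_geodesic lg nf gc.
have ubJ : ubound J B.
  by move=> t Jt; rewrite leNgt; apply/negP => Bt; apply: nB; exists t.
have hs : has_sup J by split; [exists t0|exists B].
have sJ : ~ J (sup J).
  move=> Js; have : \forall t \near sup J, J t by exact: open_nbhs_nbhs.
  move=> /nbhs_ballP[e /= e0 He].
  have Je : J (sup J + e / 2).
    apply: He; rewrite -ball_normE /ball_ /= opprD addrA subrr sub0r normrN.
    by rewrite gtr0_norm ?divr_gt0 // ltr_pdivrMr // ltr_pMr // ltr1n.
  have : sup J + e / 2 <= sup J by apply: ub_le_sup => //; exists B.
  by rewrite gerDl leNgt divr_gt0.
have Jlt t : J t -> t < sup J.
  move=> Jt; rewrite lt_neqAle; apply/andP; split; last by apply: ub_le_sup => //; exists B.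
  by apply/eqP => E; apply: sJ; rewrite -E.
have Jge t : t0 <= t < sup J -> J t.
  move=> /andP[t0t ts]; have [s Js st] := sup_gt (ex_intro _ t0 Jt0) ts.
  by apply: (iJ t0 s) => //; rewrite t0t ltW.
have [J' [c' [gc' JJ' cc' J's]]] := geodesic_extend cM oJ iJ fg Jt0 Jlt Jge.
by apply: sJ; move: J's; rewrite (mx J' c' gc' JJ' cc').
Qed.

Lemma null_frame_complete : compact [set: M] -> geodesically_complete g.
Proof.
move=> cM J c ic; apply/seteqP; split=> // t _.
have [s Js ts] := inextendible_unbounded cM ic t.
have [u Ju tu] := inextendible_unbounded cM (inextendible_reflect lg nf ic) (- t).
have [[_ iJ _ _ _] _] := ic.
by apply: (iJ (- u) s) => //; rewrite (ltW ts) andbT lerNl ltW.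
Qed.

End Completeness.

(** * The null frame of two twistor spinors *)

Local Open Scope complex_scope.

(** * Spin(1,1) as a group of real diagonal matrices *)

Section Spin11.
Context {R : realType}.
Implicit Types (t s : R) (x v : 'rV[R]_2).

Definition diag2 t s : 'M[R[i]]_2 :=
  \matrix_(k, l) (if k == l then (if k == 0 then t%:C else s%:C) else 0).

Lemma mul_diag2 t s t' s' : diag2 t s *m diag2 t' s' = diag2 (t * t') (s * s').
Proof.
apply/matrixP; apply: ord2P; apply: ord2P; rewrite !(mxE, sum2) /=;
  by rewrite ?mul0r ?mulr0 ?addr0 ?add0r // -rmorphM.
Qed.

Lemma inv_diag2 t s : t * s != 0 -> invmx (diag2 t s) = diag2 t^-1 s^-1.
Proof.
rewrite mulf_eq0 negb_or => /andP[t0 s0].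
have E : diag2 t s *m diag2 t^-1 s^-1 = 1%:M.
  rewrite mul_diag2 !divff //; apply/matrixP; apply: ord2P; apply: ord2P;
  by rewrite !mxE.
have [u _] := mulmx1_unit E.
by rewrite -[RHS]mul1mx -(mulVmx u) -mulmxA E mulmx1.
Qed.

(** In null coordinates a Clifford vector is antidiagonal. Even products are therefore diagonal, and
    the two half spinor components never mix under Spin(1,1). *)
Lemma clE v : cl v = \matrix_(k, l) (if k == l then 0 else
  if k == 0 then 'i * (v 0 0 + v 0 1)%:C else 'i * (v 0 1 - v 0 0)%:C).
Proof.
apply/matrixP; apply: ord2P; apply: ord2P; rewrite /cl !mxE /=;
  by apply/eqP; rewrite eq_complex /=; apply/andP; split; apply/eqP; ring.
Qed.

Lemma mform_eta v : mform eta v v = (v 0 0 + v 0 1) * (v 0 1 - v 0 0).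
Proof. by rewrite mformE /eta !mxE /=; ring. Qed.

Lemma mul_cl v x : cl v *m cl x =
  diag2 (- ((v 0 0 + v 0 1) * (x 0 1 - x 0 0))) (- ((v 0 1 - v 0 0) * (x 0 0 + x 0 1))).
Proof.
rewrite !clE; apply/matrixP; apply: ord2P; apply: ord2P; rewrite !(mxE, sum2) /=;
  by apply/eqP; rewrite eq_complex /=; apply/andP; split; apply/eqP; ring.
Qed.

(** The product of two vectors is diagonal, and its two entries multiply to the product of their
    norms, hence to 1 or -1; the list is consumed in pairs. *)
Lemma spin11P h : spin11 h ->
  exists t s, (t * s == 1) || (t * s == -1) /\ h = diag2 t s.
Proof.
case=> l [ol al ->] {h}.
have {ol} [n sz] : exists n, size l = n.*2.
  by exists (size l)./2; rewrite -[LHS]odd_double_half (negbTE ol).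
elim: n l sz al => [|n IH] [|x [|y l]] //=.
  move=> _ _; exists 1, 1; split; first by rewrite mulr1 eqxx.
  by rewrite big_nil; apply/matrixP; apply: ord2P; apply: ord2P; rewrite !mxE.
rewrite doubleS => -[sz] /and3P[hx hy al].
have [t [s [ts E]]] := IH l sz al.
rewrite !big_cons E mulrA.
rewrite -[cl x * cl y]/(cl x *m cl y) mul_cl -[_ * _]/(_ *m _) mul_diag2.
eexists; eexists; split; last by [].
move: hx hy ts; rewrite !mform_eta.
move: (x 0 0 + x 0 1) (x 0 1 - x 0 0) (y 0 0 + y 0 1) (y 0 1 - y 0 0) => u w u' w'.
have -> : - (u * w') * t * (- (w * u') * s) = (u * w) * (u' * w') * (t * s) by ring.
by do 3!case/orP => /eqP ->; rewrite ?mulrN ?mulr1 ?mul1r ?opprK ?mulN1r ?opprK ?eqxx ?orbT.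
Qed.

(** Conjugation by [diag2 t s] multiplies the off-diagonal entries of [cl v], which are its null
    coordinates up to the factor ['i], by [t / s] and [s / t]. *)
Lemma spin_cover_null t s (L : 'M[R]_2) : t * s != 0 -> spin_cover (diag2 t s) L ->
  row 0 L + row 1 L = (t / s) *: \row_k 1 /\
  row 0 L - row 1 L = (s / t) *: \row_k (if k == 0 then 1 else -1).
Proof.
move=> ts0 cov.
have E v : (v *m L) 0 0 + (v *m L) 0 1 = t / s * (v 0 0 + v 0 1) /\
    (v *m L) 0 1 - (v *m L) 0 0 = s / t * (v 0 1 - v 0 0).
  have := cov v; rewrite inv_diag2 // !clE => /matrixP H.
  split.
    have := H 0 1; rewrite !(mxE, sum2) /= !(mulr0, mul0r, addr0, add0r).
    move/eqP; rewrite eq_complex /= => /andP[_ /eqP].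
    by rewrite !(mulr0, mul0r, addr0, add0r, mul1r, subr0, sub0r) => ->; ring.
  have := H 1 0; rewrite !(mxE, sum2) /= !(mulr0, mul0r, addr0, add0r).
  move/eqP; rewrite eq_complex /= => /andP[_ /eqP].
  by rewrite !(mulr0, mul0r, addr0, add0r, mul1r, subr0, sub0r) => ->; ring.
have aux (n0 n1 c d : R) : n0 + n1 = c -> n1 - n0 = d -> n0 = (c - d) / 2 /\ n1 = (c + d) / 2.
  by move=> <- <-; split; field.
(* The images of (1, 1) and (1, -1) are the sum and the difference of the rows of [L]. *)
have [h1 h2] := E (\row_k 1); have [h3 h4] := E (\row_k (if k == 0 then 1 else -1)).
have [p0 p1] := aux _ _ _ _ h1 h2; have [m0 m1] := aux _ _ _ _ h3 h4.
rewrite !(mxE, sum2) /= in p0 p1 m0 m1.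
move: (t / s) (s / t) p0 p1 m0 m1 => c d p0 p1 m0 m1.
rewrite !mul1r ?mulN1r in p0 p1 m0 m1.
split; apply: row2P; rewrite !mxE /=.
- by rewrite p0; field.
- by rewrite p1; field.
- by rewrite m0; field.
- by rewrite m1; field.
Qed.

End Spin11.

Definition nsq (R : realType) (z : R[i]) : R :=
  complex.Re z * complex.Re z + complex.Im z * complex.Im z.

Lemma nsq_gt0 (R : realType) (z : R[i]) : z != 0 -> 0 < nsq z.
Proof.
case: z => x y; rewrite eq_complex /= negb_and /nsq /= => /orP[x0|y0].
  by rewrite ltr_pwDl ?sqr_ge0 // -expr2 ?exprn_even_gt0 // sqr_ge0.
by rewrite ltr_wpDl -?expr2 ?sqr_ge0 // exprn_even_gt0.
Qed.

Lemma nsqZ (R : realType) (t : R) (z : R[i]) : nsq (t%:C * z) = t ^+ 2 * nsq z.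
Proof. by case: z => x y; rewrite /nsq /=; ring. Qed.

Lemma null_comb_form (R : realType) (A : 'M[R]_2) (p m : 'rV[R]_2) (u w : R) :
  A^T = A -> mform A p p = 0 -> mform A m m = 0 -> mform A p m = - 2 ->
  mform A ((u / 2) *: p - (w / 2) *: m) ((u / 2) *: p - (w / 2) *: m) = u * w.
Proof.
by move=> AT pp mm pm; rewrite !mformL pp mm (mformC m p AT) pm; field.
Qed.

Lemma cov_near_eq (R : realType) (G : 'rV[R]_2 -> 'M[R]_2) v (Y Z : 'rV[R]_2 -> 'rV[R]_2) x :
  (\forall y \near x, Y y = Z y) -> cov G v Y x = cov G v Z x.
Proof.
by move=> E; rewrite /cov (near_eq_derive _ E) (nbhs_singleton E).
Qed.

(** Makes the time-orientation sign locally constant, so that it passes through all derivatives. *)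
Lemma near_sgr (R : realType) (V : normedModType R) (f : V -> R) (x : V) :
  {for x, continuous f} -> f x != 0 -> \forall y \near x, Num.sg (f y) = Num.sg (f x).
Proof.
move=> cf; rewrite neq_lt => /orP[fx|fx]; near=> y.
  rewrite (ltr0_sg fx) ltr0_sg //; near: y; exact: cvgr_lt cf _ fx.
rewrite (gtr0_sg fx) gtr0_sg //; near: y; exact: cvgr_gt cf _ fx.
Unshelve. all: by end_near. Qed.

Lemma smooth_on_mform (R : realType) (U : set 'rV[R]_2) (A : 'rV[R]_2 -> 'M[R]_2)
    (Y Z : 'rV[R]_2 -> 'rV[R]_2) : open U ->
  (forall k l, smooth_on U (fun y => A y k l)) ->
  (forall k, smooth_on U (fun y => Y y 0 k)) -> (forall k, smooth_on U (fun y => Z y 0 k)) ->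
  smooth_on U (fun y => mform (A y) (Y y) (Z y)).
Proof.
move=> oU sA sY sZ.
have -> : (fun y => mform (A y) (Y y) (Z y)) = (fun y =>
  Y y 0 0 * A y 0 0 * Z y 0 0 + Y y 0 0 * A y 0 1 * Z y 0 1 +
  (Y y 0 1 * A y 1 0 * Z y 0 0 + Y y 0 1 * A y 1 1 * Z y 0 1)).
  by apply/funext => y; rewrite mformE.
have m k l : smooth_on U (fun y => Y y 0 k * A y k l * Z y 0 l).
  by apply: smooth_on_mul => //; exact: smooth_on_mul.
by apply: smooth_on_add => //; apply: smooth_on_add.
Qed.

Section TwistorAlgebra.
Context {R : realType}.

Lemma complex_cancel (u : R) (z0 z1 : R[i]) : u != 0 ->
  u * (complex.Re z1 - complex.Re z0) = 0 -> u * (complex.Im z1 - complex.Im z0) = 0 ->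
  z0 = z1.
Proof.
case: z0 z1 => [x0 y0] [x1 y1] /= u0 /eqP + /eqP.
by rewrite !mulf_eq0 (negbTE u0) /= !subr_eq0 => /eqP -> /eqP ->.
Qed.

Lemma col_lin (U V W : 'cV[R[i]]_2) (c d : R[i]) :
  (forall k, U k 0 = c * V k 0 + d * W k 0) -> U = c *: V + d *: W.
Proof. by move=> h; apply/matrixP => k l; rewrite ord1 !mxE. Qed.

(** The first component of the equation reduces to [(xi 0 1 - xi 0 0) * (D1 0 0 - D0 0 0) = 0] and
    the second to [(xi 0 0 + xi 0 1) * (D0 1 0 + D1 1 0) = 0]. *)
Lemma twistor_algebra (xi : 'rV[R]_2) (D0 D1 : 'cV[R[i]]_2) :
  xi 0 0 + xi 0 1 != 0 -> xi 0 1 - xi 0 0 != 0 ->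
  (xi 0 0)%:C *: D0 + (xi 0 1)%:C *: D1 =
    - ((2^-1)%:C *: (cl xi *m (- (cl1 *m D0) + cl2 *m D1))) ->
  D0 0 0 = D1 0 0 /\ D0 1 0 = - D1 1 0.
Proof.
move=> u0 w0; rewrite clE => /matrixP E.
have E0 := E 0 0; have E1 := E 1 0.
rewrite !(mxE, sum2) /= in E0 E1.
move: (xi 0 0) (xi 0 1) u0 w0 (D0 0 0) (D0 1 0) (D1 0 0) (D1 1 0) E0 E1 => {E xi D0 D1}.
move=> a b u0 w0 [x0 y0] [x1 y1] [x2 y2] [x3 y3] /eqP.
rewrite eq_complex /= => /andP[/eqP e1 /eqP e2] /eqP.
rewrite eq_complex /= => /andP[/eqP e3 /eqP e4].
split.
  by apply: (complex_cancel w0) => /=; clear e3 e4 u0 w0; lra.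
by apply: (complex_cancel u0) => /=; clear e1 e2 u0 w0; lra.
Qed.

End TwistorAlgebra.

(** * Null fields built from the two twistor spinors *)

Section SpinorFrame.
Context {R : realType} {M : surface R}.
Variables (g : chart M -> M -> 'M[R]_2) (Q : spin_structure g).
Hypothesis lg : is_lorentzian g.
Variable X : chart M -> M -> 'rV[R]_2.
Hypothesis vX : is_vfield X.
Hypothesis tX : forall i p, cdom i p -> X i p != 0 /\ mform (g i p) (X i p) (X i p) < 0.
Variables psip psim : Q -> 'cV[R[i]]_2.
Hypotheses (Sp : spinor_plus psip) (Sm : spinor_minus psim).
Hypotheses (Zp : no_zeros psip) (Zm : no_zeros psim).
Hypotheses (Tp : twistor psip) (Tm : twistor psim).
Implicit Types (i j : chart M) (p : M) (q : Q) (a : striv Q).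

Lemma plus_entry q : psip q 1 0 = 0.
Proof.
have [_ /(_ q)] := Sp; rewrite volE => /matrixP/(_ 1 0).
rewrite mul_diag_mx !mxE /= mul1r => /eqP; rewrite -addr_eq0 -mulr2n mulrn_eq0.
by move=> /eqP.
Qed.

Lemma minus_entry q : psim q 0 0 = 0.
Proof.
have [_ /(_ q)] := Sm; rewrite volE => /matrixP/(_ 0 0).
rewrite mul_diag_mx !mxE /= mulN1r => /esym/eqP; rewrite -addr_eq0 -mulr2n mulrn_eq0.
by move=> /eqP.
Qed.

Let Fp q := nsq (psip q 0 0).
Let Fm q := nsq (psim q 1 0).

Let Fp_gt0 q : 0 < Fp q.
Proof.
apply: nsq_gt0; apply: contra (Zp q) => /eqP p0; apply/eqP/matrixP => k l.
by rewrite ord1 mxE; move: k; apply: ord2P => //; exact: plus_entry.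
Qed.

Let Fm_gt0 q : 0 < Fm q.
Proof.
apply: nsq_gt0; apply: contra (Zm q) => /eqP p0; apply/eqP/matrixP => k l.
by rewrite ord1 mxE; move: k; apply: ord2P => //; exact: minus_entry.
Qed.

Let np i q := row 0 (sframe i q) + row 1 (sframe i q).
Let nm i q := row 0 (sframe i q) - row 1 (sframe i q).
(* [uX] and [wX] are the components of [X] along the null directions:
   X = (uX np - wX nm) / 2. *)
Let uX i q := - mform (g i (sproj q)) (X i (sproj q)) (nm i q).
Let wX i q := mform (g i (sproj q)) (X i (sproj q)) (np i q).
(** Since [uX * wX = g(X, X) < 0], the coefficients [uX / 2] and [- wX / 2] of [X] have the same
    sign; with the factor [Num.sg uX], [X] becomes a positive combination of [NpQ] and [NmQ]. *)
Let NpQ i q := (Num.sg (uX i q) * Fp q) *: np i q.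
Let NmQ i q := (Num.sg (uX i q) * Fm q) *: nm i q.
Let OmQ q := Fp q * Fm q.

Let null_forms i q : cdom i (sproj q) -> let A := g i (sproj q) in
  [/\ mform A (np i q) (np i q) = 0, mform A (nm i q) (nm i q) = 0 &
      mform A (np i q) (nm i q) = - 2].
Proof.
move=> iq A; have [h00 h01 h10 h11] := orthonormal_mform (sframe_orthonormal iq).
by rewrite /np /nm !mformL h00 h01 h10 h11; split; ring.
Qed.

Let X_expand i q : cdom i (sproj q) ->
  X i (sproj q) = (uX i q / 2) *: np i q - (wX i q / 2) *: nm i q.
Proof.
move=> iq; have [pp mm pm] := null_forms iq.
have pm0 : mform (g i (sproj q)) (np i q) (nm i q) != 0.
  by rewrite pm oppr_eq0 pnatr_eq0.
rewrite [LHS](null_expand _ (metric_sym lg iq) pp mm pm0) pm -/(wX i q).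
rewrite -[mform _ _ (nm i q)]opprK -/(uX i q) invrN mulrN mulNr opprK mulrN.
by rewrite scaleNr.
Qed.

Let uX_neq0 i q : cdom i (sproj q) -> uX i q != 0 /\ wX i q != 0.
Proof.
move=> iq; have [_] := tX iq; have [pp mm pm] := null_forms iq.
rewrite (X_expand iq) (null_comb_form _ _ (metric_sym lg iq) pp mm pm).
by move=> uw; split; apply/eqP => z; move: uw; rewrite z ?mul0r ?mulr0 ltxx.
Qed.

Let frame_act q h : spin11 h -> exists t s : R,
  [/\ (t * s == 1) || (t * s == -1), h = diag2 t s &
   forall i, cdom i (sproj q) -> np i (sact q h) = (t / s) *: np i q /\
     nm i (sact q h) = (s / t) *: nm i q].
Proof.
move=> sh; have [t [s [ts hE]]] := spin11P sh; exists t, s; split=> // i iq.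
have [L cL fL] := sframe_equivariant q sh; rewrite hE in cL.
have ts0 : t * s != 0 by case/orP: ts => /eqP ->; rewrite ?oppr_eq0 oner_eq0.
have [hp hm] := spin_cover_null ts0 cL.
rewrite /np /nm fL // !row_mul -mulmxDl -mulmxBl hp hm -!scalemxAl.
split; congr (_ *: _); apply/rowP => k; rewrite !(mxE, sum2) /=; ring.
Qed.

(** For [NpQ] the factors are [t^-1 ^+ 2] from the spinor, [t / s] from the null vector and [t * s]
    from the sign, with product 1; similarly for [NmQ]. Invariance lets the fields descend to
    [M]. *)
Let Q_invariant q h : spin11 h -> [/\ OmQ (sact q h) = OmQ q,
  forall i, cdom i (sproj q) -> NpQ i (sact q h) = NpQ i q &
  forall i, cdom i (sproj q) -> NmQ i (sact q h) = NmQ i q].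
Proof.
move=> sh; have [t [s [ts hE fr]]] := frame_act q sh.
have ts0 : t * s != 0 by case/orP: ts => /eqP ->; rewrite ?oppr_eq0 oner_eq0.
have [t0 s0] : t != 0 /\ s != 0 by move: ts0; rewrite mulf_eq0 negb_or => /andP.
have ts2 : (t * s) ^+ 2 = 1 by case/orP: ts => /eqP ->; rewrite ?sqrrN expr1n.
have ent (phi : Q -> 'cV[R[i]]_2) : is_spinor phi ->
    phi (sact q h) 0 0 = (t^-1)%:C * phi q 0 0 /\ phi (sact q h) 1 0 = (s^-1)%:C * phi q 1 0.
  move=> sphi; rewrite (spinor_equivariant sphi q sh) hE inv_diag2 //.
  by rewrite !(mxE, sum2) /= !mul0r addr0 add0r.
have FpE : Fp (sact q h) = t^-1 ^+ 2 * Fp q.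
  by have [e _] := ent _ Sp.1; rewrite /Fp e nsqZ.
have FmE : Fm (sact q h) = s^-1 ^+ 2 * Fm q.
  by have [_ e] := ent _ Sm.1; rewrite /Fm e nsqZ.
have uE i : cdom i (sproj q) -> uX i (sact q h) = (s / t) * uX i q.
  by move=> iq; have [_ e] := fr i iq; rewrite /uX sproj_act // e mformZr mulrN.
(* [s / t] is [t * s] times a positive square, and [t * s] is 1 or -1. *)
have sgE : Num.sg (s / t) = t * s.
  have -> : s / t = (t * s) * (t^-1 ^+ 2) by field.
  rewrite sgrM (gtr0_sg (_ : 0 < t^-1 ^+ 2)) ?mulr1; last first.
    by rewrite exprn_even_gt0 // invr_eq0.
  by case/orP: ts => /eqP ->; rewrite ?sgrN sgr1.
split.
- rewrite /OmQ FpE FmE mulrACA -exprMn -invfM exprVn ts2 invr1 mul1r //.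
- move=> i iq; have [e _] := fr i iq.
  rewrite /NpQ uE // e FpE sgrM sgE scalerA; congr (_ *: _).
  move: (Num.sg _) (Fp q) => e1 F1.
  have -> : t * s * e1 * (t^-1 ^+ 2 * F1) * (t / s) = e1 * F1 by field; rewrite t0 s0.
  by [].
- move=> i iq; have [_ e] := fr i iq.
  rewrite /NmQ uE // e FmE sgrM sgE scalerA; congr (_ *: _).
  move: (Num.sg _) (Fm q) => e1 F1.
  have -> : t * s * e1 * (s^-1 ^+ 2 * F1) * (s / t) = e1 * F1 by field; rewrite t0 s0.
  by [].
Qed.

Section TwistorPoint.
Variables (phi : Q -> 'cV[R[i]]_2) (a : striv Q) (i : chart M) (p : M).
Hypotheses (sphi : is_spinor phi) (ap : sdom a p) (ip : cdom i p).

Let re k := fun y => complex.Re (phi (ssec a (param i y)) k 0).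
Let im k := fun y => complex.Im (phi (ssec a (param i y)) k 0).
Let x := coord i p.
Let S y := sframe i (ssec a (param i y)).
Let om v := mform (g i p) (covder g i v (sec_frame a i 0) p) (sec_frame a i 1 p).
(** The eigenvalue of [vol] on component [k]. *)
Let sgn (k : 'I_2) : R := if k == 0 then -1 else 1.
Let A v k := spin_nabla phi a i v p k 0.

Lemma spinor_smooth_re k : smooth_on (coord i @` (sdom a `&` cdom i)) (re k).
Proof. by have [h _] := spinor_smooth sphi a k 0; exact: h. Qed.

Lemma spinor_smooth_im k : smooth_on (coord i @` (sdom a `&` cdom i)) (im k).
Proof. by have [_ h] := spinor_smooth sphi a k 0; exact: h. Qed.

Lemma in_triv : (coord i @` (sdom a `&` cdom i)) x.
Proof. by exists p. Qed.

Let dre k : differentiable (re k) x.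
Proof. exact: smooth_on_differentiable (spinor_smooth_re k) in_triv. Qed.

Let dim k : differentiable (im k) x.
Proof. exact: smooth_on_differentiable (spinor_smooth_im k) in_triv. Qed.

Let dS : differentiable S x.
Proof. exact: smooth_on_differentiable (sframe_smooth a i) in_triv. Qed.

Lemma spin_nablaE v k : A v k =
  ('D_v (re k) x - 2^-1 * om v * (sgn k * re k x)) +i*
  ('D_v (im k) x - 2^-1 * om v * (sgn k * im k x)).
Proof.
rewrite /A /spin_nabla !mxE -/(om v) /re /im /x coordK // volE.
rewrite sum2 !mxE /tder /=; set m := 2^-1 * om v; rewrite /sgn.
move: k; apply: ord2P => /=.
  move: ('D_v _ _) ('D_v _ _) (phi (ssec a p)) => d1 d2 z.
  case: (z 0 0) (z 1 0) => [x0 y0] [x1 y1].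
  by apply/eqP; rewrite eq_complex /=; apply/andP; split; apply/eqP; ring.
move: ('D_v _ _) ('D_v _ _) (phi (ssec a p)) => d1 d2 z.
case: (z 0 0) (z 1 0) => [x0 y0] [x1 y1].
by apply/eqP; rewrite eq_complex /=; apply/andP; split; apply/eqP; ring.
Qed.

Lemma spin_nabla_lin (c d : R) v w k :
  A (c *: v + d *: w) k = c%:C * A v k + d%:C * A w k.
Proof.
have omD : om (c *: v + d *: w) = c * om v + d * om w.
  have dY : differentiable (sec_frame a i 0 \o param i) x.
    apply: differentiable_entries => k' l.
    have -> : (fun y => (sec_frame a i 0 \o param i) y k' l) = (fun y => S y 0 l).
      by apply/funext => y; rewrite /= /sec_frame !mxE.
    exact: differentiable_entry.
  by rewrite /om !covderE // covDl // !covZl // !mformL.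
rewrite !spin_nablaE omD !deriveDv // !deriveZv //.
move: (om v) (om w) (re k x) (im k x) (sgn k) => o1 o2 r0 i0 s0.
move: ('D_v (re k) x) ('D_w (re k) x) ('D_v (im k) x) ('D_w (im k) x) => d1 d2 d3 d4.
rewrite -[c *: d1]/(c * d1) -[d *: d2]/(d * d2) -[c *: d3]/(c * d3) -[d *: d4]/(d * d4).
by apply/eqP; rewrite eq_complex /=; apply/andP; split; apply/eqP; ring.
Qed.

Let s0 := sec_frame a i 0 p.
Let s1 := sec_frame a i 1 p.

(** The equation is applied to [X], of frame components [xi]. Then [xi 0 0 + xi 0 1 = uX] and
    [xi 0 1 - xi 0 0 = wX] are nonzero, as [twistor_algebra] demands. *)
Lemma twistor_entries : twistor phi -> A s0 0 = A s1 0 /\ A s0 1 = - A s1 1.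
Proof.
move=> Tphi; pose q := ssec a p; have pq : sproj q = p by exact: ssecK.
have iq : cdom i (sproj q) by rewrite pq.
have [u0 w0] := uX_neq0 iq.
pose xi := (\row_k (if k == 0 then (uX i q - wX i q) / 2 else (uX i q + wX i q) / 2)) : 'rV[R]_2.
have [uS _] := orthonormal_unit (sframe_orthonormal iq).
have XE : X i p = xi 0 0 *: s0 + xi 0 1 *: s1.
  rewrite -{1}pq (X_expand iq) /np /nm !mxE /=.
  rewrite -/(sec_frame a i 0 p) -/(sec_frame a i 1 p) -/s0 -/s1.
  by apply/rowP => k; rewrite !mxE; field.
have XF : X i p = xi *m sframe i q.
  by rewrite XE; apply/rowP => k; rewrite !mxE sum2 !mxE.
have lin : spin_nabla phi a i (X i p) p =
    (xi 0 0)%:C *: spin_nabla phi a i s0 p + (xi 0 1)%:C *: spin_nabla phi a i s1 p.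
  by rewrite XE; apply: col_lin => k; exact: spin_nabla_lin.
have cE : cliff a i (X i p) p = cl xi by rewrite /cliff XF mulmxK.
have E := Tphi X vX a i p ap ip; rewrite lin cE in E.
have [x0 x1] : xi 0 0 = (uX i q - wX i q) / 2 /\ xi 0 1 = (uX i q + wX i q) / 2.
  by rewrite !mxE.
apply: (twistor_algebra _ _ E); rewrite x0 x1.
  by have -> : (uX i q - wX i q) / 2 + (uX i q + wX i q) / 2 = uX i q by field.
by have -> : (uX i q + wX i q) / 2 - (uX i q - wX i q) / 2 = wX i q by field.
Qed.

Definition ns k y := nsq (phi (ssec a (param i y)) k 0).

Lemma ns_smooth k : smooth_on (coord i @` (sdom a `&` cdom i)) (ns k).
Proof.
have oW := @open_chart_img _ _ i _ (sdom_open a).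
by apply: smooth_on_add => //; apply: smooth_on_mul => //;
  [exact: spinor_smooth_re..|exact: spinor_smooth_im|exact: spinor_smooth_im].
Qed.

(** Real and imaginary part both vary at the rate [sgn k * om n / 2]; squaring the modulus removes
    the factor 1/2 of the spinor connection. *)
Lemma ns_derive n k : A n k = 0 -> 'D_n (ns k) x = om n * (sgn k * ns k x).
Proof.
rewrite spin_nablaE => /eqP; rewrite eq_complex /= !subr_eq0 => /andP[/eqP er /eqP ei].
have isr : is_derive x n (re k) _ := is_derive_diff n (dre k).
have isi : is_derive x n (im k) _ := is_derive_diff n (dim k).
have D := is_derive_add (is_derive_mul isr isr) (is_derive_mul isi isi).
rewrite (@derive_val _ _ _ _ _ _ _ D) er ei /ns /nsq -/(re k x) -/(im k x).
by move: (om n) (sgn k) (re k x) (im k x) => *; field.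
Qed.

Lemma twistor_ns : twistor phi ->
  'D_(s0 - s1) (ns 0) x = - (om (s0 - s1) * ns 0 x) /\
  'D_(s0 + s1) (ns 1) x = om (s0 + s1) * ns 1 x.
Proof.
move=> /twistor_entries[E0 E1].
have A0 : A (s0 - s1) 0 = 0.
  have -> : s0 - s1 = 1 *: s0 + (-1) *: s1 by rewrite scale1r scaleN1r.
  by rewrite spin_nabla_lin E0 -mulrDl -rmorphD /= subrr mul0r.
have A1 : A (s0 + s1) 1 = 0.
  have -> : s0 + s1 = 1 *: s0 + 1 *: s1 by rewrite !scale1r.
  by rewrite spin_nabla_lin E1 !mul1r addNr.
have h0 := ns_derive A0; have h1 := ns_derive A1.
rewrite /sgn eqxx mulN1r mulrN in h0; rewrite /sgn mul1r in h1.
by split; [exact: h0|exact: h1].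
Qed.

End TwistorPoint.

(** A pointwise choice of trivialisation, without any continuity in [p]; [secE] replaces it by a
    fixed one wherever derivatives are taken. *)
Let tr p : striv Q := projT1 (cid (sdom_cover Q p)).
Let trP p : sdom (tr p) p. Proof. by rewrite /tr; case: cid. Qed.
Let sec p := ssec (tr p) p.
Let Np i p := NpQ i (sec p).
Let Nm i p := NmQ i (sec p).
Let Om p := OmQ (sec p).

Let secE a p : sdom a p -> [/\ Om p = OmQ (ssec a p),
  forall i, cdom i p -> Np i p = NpQ i (ssec a p) &
  forall i, cdom i p -> Nm i p = NmQ i (ssec a p)].
Proof.
move=> ap; have pa : sproj (ssec a p) = p by exact: ssecK.
have pt : sproj (sec p) = p by exact: ssecK (trP p).
have [h [[sh E] _]] := sact_torsor (etrans pa (esym pt)).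
have [e1 e2 e3] := Q_invariant (ssec a p) sh; rewrite -E pa in e1 e2 e3.
by split.
Qed.

(** Near [p] the sign is a constant [e], so the fields become explicit smooth expressions in one
    trivialisation. [Om] is written with two factors [e], harmless as [e * e = 1], to match the
    product [f1 * f2] of [null_frame_cov]. *)
Let local_form a i p : sdom a p -> cdom i p ->
  exists W e, [/\ open W, W (coord i p), W `<=` coord i @` (sdom a `&` cdom i), e * e = 1 &
    forall y, W y -> let S := sframe i (ssec a (param i y)) in
      [/\ Np i (param i y) = (e * ns psip a i 0 y) *: (row 0 S + row 1 S),
          Nm i (param i y) = (e * ns psim a i 1 y) *: (row 0 S - row 1 S) &
          Om (param i y) = (e * ns psip a i 0 y) * (e * ns psim a i 1 y)]].
Proof.
move=> ap ip; pose W := coord i @` (sdom a `&` cdom i).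
have oW : open W := @open_chart_img _ _ i _ (sdom_open a).
have Wx : W (coord i p) by exists p.
have WP y : W y -> [/\ sdom a (param i y), cdom i (param i y) &
    sproj (ssec a (param i y)) = param i y].
  by move=> [q [aq iq] <-]; rewrite coordK // ssecK.
pose f y := uX i (ssec a (param i y)).
pose f' y := (-1) * mform (g i (param i y)) (X i (param i y))
  (row 0 (sframe i (ssec a (param i y))) - row 1 (sframe i (ssec a (param i y)))).
have sS k l : smooth_on W (fun y => sframe i (ssec a (param i y)) k l) :=
  smooth_on_entry k l oW (sframe_smooth a i).
have WU : W `<=` cimg i by move=> _ [q [aq iq] <-]; exists q.
have sf : smooth_on W f.
  apply: (near_eq_smooth_on oW (f := f')) => [y|].
    by rewrite inE => /WP[_ _ E]; rewrite /f /uX E /f' mulN1r.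
  apply: smooth_on_mul => //; first exact: smooth_on_cst.
  apply: smooth_on_mform => // [k l|k|k].
  - have := smooth_on_entry k l (@cimg_open _ M i) (metric_smooth lg i).
    exact: sub_smooth_on.
  - have := smooth_on_entry 0 k (@cimg_open _ M i) (vfield_smooth vX i).
    exact: sub_smooth_on.
  - apply: (near_eq_smooth_on oW (f := fun y => sframe i (ssec a (param i y)) 0 k +
      (-1) * sframe i (ssec a (param i y)) 1 k)) => [y _|].
      by rewrite !mxE mulN1r.
    by apply: smooth_on_add => //; apply: smooth_on_mul => //; exact: smooth_on_cst.
have cf : {for coord i p, continuous f}.
  exact/differentiable_continuous/(smooth_on_differentiable sf Wx).
have f0 : f (coord i p) != 0.
  by rewrite /f coordK //; have [] // := @uX_neq0 i (ssec a p); rewrite ssecK.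
pose e := Num.sg (f (coord i p)).
exists (W `&` [set y | Num.sg (f y) = e]°), e; split.
- by apply: openI => //; exact: open_interior.
- by split; [exact: Wx|exact: (near_sgr cf f0)].
- by move=> y [].
- by rewrite -expr2 sqr_sg f0.
move=> y [Wy /interior_subset /= ey]; have [ay iy yE] := WP y Wy.
have [e1 e2 e3] := secE ay; rewrite e1 (e2 i iy) (e3 i iy) /NpQ /NmQ -/(f y) ey; split=> //.
by rewrite mulrACA -expr2 sqr_sg f0 mul1r.
Qed.

(** [uX] is a scalar product, hence independent of the chart, and so the sign respects the
    transformation law of the null fields. *)
Let compat_frame i j q : cdom i (sproj q) -> cdom j (sproj q) ->
  let T := tjac i j (sproj q) in
  [/\ np j q = np i q *m T, nm j q = nm i q *m T & uX j q = uX i q].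
Proof.
move=> iq jq T; have fE := sframe_compat iq jq.
have nE : nm j q = nm i q *m T by rewrite /nm fE !row_mul mulmxBl.
split=> //; first by rewrite /np fE !row_mul mulmxDl.
rewrite /uX nE (metric_compat lg iq jq) (vfield_compat vX iq jq) -/T; congr (- _).
by rewrite /mform trmx_mul !mulmxA.
Qed.

(** Carries [null_frame_cov] from the explicit local expressions over to the global fields, which
    have the same germ at [coord i p]. *)
Let local_cov i p : cdom i p ->
  [/\ covder g i (Nm i p) (Np i) p = 0, covder g i (Np i p) (Nm i) p = 0,
      covder g i (Np i p) (Np i) p = (tder i (Np i p) Om p / Om p) *: Np i p &
      covder g i (Nm i p) (Nm i) p = (tder i (Nm i p) Om p / Om p) *: Nm i p].
Proof.
move=> ip; pose a := tr p; have ap : sdom a p := trP p.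
have [W [e [oW Wx WS ee loc]]] := local_form ap ip.
have nearW : \forall y \near coord i p, W y by exact: open_nbhs_nbhs.
pose S y := sframe i (ssec a (param i y)).
pose f1 y := e * ns psip a i 0 y; pose f2 y := e * ns psim a i 1 y.
pose P y := f1 y *: (row 0 (S y) + row 1 (S y)).
pose N y := f2 y *: (row 0 (S y) - row 1 (S y)).
have EP : \forall y \near coord i p, (Np i \o param i) y = P y.
  by apply: filterS nearW => y /loc[].
have EN : \forall y \near coord i p, (Nm i \o param i) y = N y.
  by apply: filterS nearW => y /loc[].
have EO : \forall y \near coord i p, (Om \o param i) y = f1 y * f2 y.
  by apply: filterS nearW => y /loc[].
have Pp : Np i p = P (coord i p) by rewrite -(nbhs_singleton EP) /= coordK.
have Nmp : Nm i p = N (coord i p) by rewrite -(nbhs_singleton EN) /= coordK.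
have Op : Om p = f1 (coord i p) * f2 (coord i p).
  by rewrite -(nbhs_singleton EO) /= coordK.
have Sx : (coord i @` (sdom a `&` cdom i)) (coord i p) by exists p.
have e0 : e != 0 by apply/eqP => e0; move: ee; rewrite e0 mul0r => /eqP; rewrite eq_sym oner_eq0.
have dn1 : differentiable (ns psip a i 0) (coord i p).
  exact: smooth_on_differentiable (ns_smooth a i Sp.1 0) Sx.
have dn2 : differentiable (ns psim a i 1) (coord i p).
  exact: smooth_on_differentiable (ns_smooth a i Sm.1 1) Sx.
have df1 : differentiable f1 (coord i p).
  by apply: differentiableM => //; exact: differentiable_cst.
have df2 : differentiable f2 (coord i p).
  by apply: differentiableM => //; exact: differentiable_cst.
have De (f : 'rV[R]_2 -> R) v : differentiable f (coord i p) ->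
    'D_v (fun y => e * f y) (coord i p) = e * 'D_v f (coord i p).
  by move=> df; rewrite (derive_mul (f := cst e)) // derive_cst mul0r add0r.
have n1 : f1 (coord i p) != 0 by rewrite mulf_neq0 // gt_eqF // Fp_gt0.
have n2 : f2 (coord i p) != 0 by rewrite mulf_neq0 // gt_eqF // Fm_gt0.
have [t1 _] := twistor_ns Sp.1 ap ip Tp; have [_ t2] := twistor_ns Sm.1 ap ip Tm.
have dS : differentiable S (coord i p).
  exact: smooth_on_differentiable (sframe_smooth a i) Sx.
have oS : \forall y \near coord i p, S y *m (g i \o param i) y *m (S y)^T = eta.
  apply: filterS nearW => y /WS[q [aq iq] <-]; rewrite /S /= coordK //.
  have qK : sproj (ssec a q) = q by exact: ssecK.
  by have := @sframe_orthonormal _ _ _ Q i (ssec a q); rewrite qK; exact.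
have sE k : (fun y => row k (S y)) = sec_frame a i k \o param i by [].
have S_p k : row k (S (coord i p)) = sec_frame a i k p by rewrite /S coordK.
have omE v : mform ((g i \o param i) (coord i p))
    (cov (g i \o param i) v (fun y => row 0 (S y)) (coord i p)) (row 1 (S (coord i p))) =
    mform (g i p) (covder g i v (sec_frame a i 0) p) (sec_frame a i 1 p).
  by rewrite covderE // S_p /= coordK.
have q1 : 'D_(row 0 (S (coord i p)) - row 1 (S (coord i p))) f1 (coord i p) =
    - (mform ((g i \o param i) (coord i p)) (cov (g i \o param i)
        (row 0 (S (coord i p)) - row 1 (S (coord i p))) (fun y => row 0 (S y)) (coord i p))
        (row 1 (S (coord i p))) * f1 (coord i p)).
  by rewrite omE !S_p De // t1 mulrN mulrCA.
have q2 : 'D_(row 0 (S (coord i p)) + row 1 (S (coord i p))) f2 (coord i p) =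
    mform ((g i \o param i) (coord i p)) (cov (g i \o param i)
        (row 0 (S (coord i p)) + row 1 (S (coord i p))) (fun y => row 0 (S y)) (coord i p))
        (row 1 (S (coord i p))) * f2 (coord i p).
  by rewrite omE !S_p De // t2 mulrCA.
have [c1 c2 c3 c4] := null_frame_cov (metric_sym_near lg ip) (metric_diff lg ip) dS oS
  df1 df2 n1 n2 q1 q2.
rewrite !covderE // !(cov_near_eq _ _ EP) !(cov_near_eq _ _ EN) /tder !(near_eq_derive _ EO).
by rewrite Pp Nmp Op.
Qed.

Let local_smooth (f : 'rV[R]_2 -> R) i : (forall a p, sdom a p -> cdom i p ->
    exists2 W, W (coord i p) & smooth_on W f) -> smooth_on (cimg i) f.
Proof.
by move=> H; apply: smooth_on_local => _ [p ip <-]; exact: (H (tr p) p (trP p) ip).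
Qed.

Lemma spinor_null_frame : null_frame g Np Nm Om.
Proof.
have secK p : sproj (sec p) = p by exact: ssecK (trP p).
have forms i p : cdom i p -> [/\ mform (g i p) (np i (sec p)) (np i (sec p)) = 0,
    mform (g i p) (nm i (sec p)) (nm i (sec p)) = 0,
    mform (g i p) (np i (sec p)) (nm i (sec p)) = -2 & uX i (sec p) != 0].
  move=> ip; have iq : cdom i (sproj (sec p)) by rewrite secK.
  have [] := null_forms iq; rewrite secK => *; split=> //.
  by have [] := uX_neq0 iq.
have compat i j p : cdom i p -> cdom j p -> Np j p = Np i p *m tjac i j p /\
    Nm j p = Nm i p *m tjac i j p.
  move=> ip jp; have := @compat_frame i j (sec p); rewrite secK => /(_ ip jp)[h1 h2 h3].
  by rewrite /Np /Nm /NpQ /NmQ h1 h2 h3 !scalemxAl.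
have sp a i p (W : set 'rV[R]_2) : sdom a p -> cdom i p ->
    W `<=` coord i @` (sdom a `&` cdom i) ->
    [/\ smooth_on W (ns psip a i 0), smooth_on W (ns psim a i 1) &
     forall k l, smooth_on W (fun y => sframe i (ssec a (param i y)) k l)].
  move=> ap ip WS; split.
  - exact: sub_smooth_on WS (ns_smooth a i Sp.1 0).
  - exact: sub_smooth_on WS (ns_smooth a i Sm.1 1).
  - move=> k l; apply: sub_smooth_on WS _.
    exact: (smooth_on_entry k l (@open_chart_img _ _ i _ (sdom_open a)) (sframe_smooth a i)).
have cc e (W : set 'rV[R]_2) : smooth_on W (fun=> e : R) by exact: smooth_on_cst.
split.
- move=> i k; apply: local_smooth => a p ap ip.
  have [W [e [oW Wx WS ee loc]]] := local_form ap ip; exists W => //.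
  have [s1 s2 s3] := sp a i p W ap ip WS.
  apply: (near_eq_smooth_on oW (f := fun y => (e * ns psip a i 0 y) *
    (sframe i (ssec a (param i y)) 0 k + sframe i (ssec a (param i y)) 1 k))) => [y|].
    by rewrite inE => /loc[-> _ _]; rewrite !mxE.
  by apply: smooth_on_mul => //; [exact: smooth_on_mul|exact: smooth_on_add].
- move=> i k; apply: local_smooth => a p ap ip.
  have [W [e [oW Wx WS ee loc]]] := local_form ap ip; exists W => //.
  have [s1 s2 s3] := sp a i p W ap ip WS.
  apply: (near_eq_smooth_on oW (f := fun y => (e * ns psim a i 1 y) *
    (sframe i (ssec a (param i y)) 0 k + (-1) * sframe i (ssec a (param i y)) 1 k))) => [y|].
    by rewrite inE => /loc[_ -> _]; rewrite !mxE mulN1r.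
  apply: smooth_on_mul => //; first exact: smooth_on_mul.
  by apply: smooth_on_add => //; exact: smooth_on_mul.
- move=> i; apply: local_smooth => a p ap ip.
  have [W [e [oW Wx WS ee loc]]] := local_form ap ip; exists W => //.
  have [s1 s2 s3] := sp a i p W ap ip WS.
  apply: (near_eq_smooth_on oW (f := fun y => (e * ns psip a i 0 y) *
    (e * ns psim a i 1 y))) => [y|].
    by rewrite inE => /loc[_ _ /= ->].
  by apply: smooth_on_mul => //; exact: smooth_on_mul.
- by move=> p; exact: mulr_gt0 (Fp_gt0 _) (Fm_gt0 _).
- by move=> i j p ip jp; have [] := compat i j p ip jp.
- by move=> i j p ip jp; have [] := compat i j p ip jp.
- move=> i p ip; have [h1 h2 h3 h4] := forms i p ip.
  by rewrite mformZl mformZr h1 !mulr0.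
- move=> i p ip; have [h1 h2 h3 h4] := forms i p ip.
  by rewrite mformZl mformZr h2 !mulr0.
- move=> i p ip; have [h1 h2 h3 h4] := forms i p ip.
  rewrite mformZl mformZr h3 mulrA mulrACA -expr2 sqr_sg h4 mul1r mulrC //.
- by move=> i p ip; have [] := local_cov ip.
- by move=> i p ip; have [] := local_cov ip.
- by move=> i p ip; have [] := local_cov ip.
- by move=> i p ip; have [] := local_cov ip.
Qed.

End SpinorFrame.

Theorem corollary4p32 (R : realType) (M : surface R)
    (g : chart M -> M -> 'M[R]_2) (Q : spin_structure g)
    (psip psim : Q -> 'cV[R[i]]_2) :
  is_lorentzian g -> time_orientable g ->
  spinor_plus psip -> twistor psip -> no_zeros psip ->
  spinor_minus psim -> twistor psim -> no_zeros psim ->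
  conformally_flat g /\ (compact [set: M] -> geodesically_complete g).
Proof.
move=> lg [X vX tX] Sp Tp Zp Sm Tm Zm.
have nf := spinor_null_frame lg vX tX Sp Sm Zp Zm Tp Tm.
split; first exact: (null_frame_conformally_flat lg nf).
exact: (null_frame_complete lg nf).
Qed.
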